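(* Assume the standing hypotheses on the continuous problem, on the space discretization and on the Runge–Kutta coefficients listed in the context. Assume also that $f(t,u(t))\in D(A)$ for every $t\in[0,T]$, that $$Af(\cdot,u(\cdot))\in C([0,T],X),\qquad u\in C([0,T],D(A^2))\cap C^2([0,T],X),$$ and that, for $t\in[0,T]$, $$A^lu(t)\in Z,\quad l=0,1,2,\qquad Af(t,u(t))\in Z.$$ Then the local error of the full discretization defined in the context satisfies $\rho_{n,h}=O(k^2+k\varepsilon_h)$, where the constant in the Landau notation is independent of $k$ and $h$. Moreover, if in addition $f\in C^2([0,T]\times X,X)$, $u\in C^3([0,T],X)$, there exists a constant $C$ such that $$\|A_0^{-1}f_u(t,u(t))A_0w\|\le C\|w\|\quad\text{for every }w\in D(A_0),\ t\in[0,T],$$ the Runge–Kutta tableau corresponds to a method of classical order $\ge2$, and $$\|A_{h,0}^{-1}f_u(t,P_hu(t))A_{h,0}\|_h\le C,\qquad t\in[0,T],\ h\le h_0,$$ then $A_{h,0}^{-1}\rho_{n,h}=O(k^3+k\eta_h+k^2\varepsilon_h)$.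
   Context: **Continuous problem.** $\Omega\subset\mathbb R^d$ is a bounded domain, $X=C(\overline\Omega)$ with the maximum norm, $Y$ is a Banach space, $A:D(A)\subset X\to X$ and $\partial:D(A)\to Y$ are linear. $u$ is the solution of $u'(t)=Au(t)+f(t,u(t))$, $0\le t\le T$, $u(0)=u_0\in X$, $\partial u(t)=g(t)\in Y$, with $f:[0,T]\times X\to X$ (in general nonlinear) and $g:[0,T]\to Y$. $f_t,f_u$ denote partial (Fréchet) derivatives. *Standing hypotheses on the continuous problem:* (i) $\partial:D(A)\to Y$ is onto and $g\in C^1([0,T],Y)$. (ii) $\ker\partial$ is dense in $X$ and $A_0$, the restriction of $A$ to $D(A_0)=\ker\partial$, generates a $C_0$-semigroup $\{e^{tA_0}\}_{t\ge0}$ on $X$ of negative type $\omega$. (iii) For $\Re z>0$ and $v\in Y$ the problem $Ax=zx$, $\partial x=v$ has a unique solution $x=K(z)v$, and $\|K(z)v\|\le C\|v\|$ with $C$ uniform for $\Re z\ge\omega_0>\omega$. (iv) $f\in C^1([0,T]\times X,X)$. (v) $u\in C^1([0,T],X)$, $u(t)\in D(A)$ for all $t\in[0,T]$, $Au\in C([0,T],X)$. **Space discretization.** For a mesh parameter $h$, $\Omega_h$ is a grid with $N$ nodes; $\|\cdot\|_h$ is the maximum norm on $\mathbb C^N$ (and induced operator norms); $P_h:X\to\mathbb C^N$ maps a function to its grid values; $A_{h,0}$ is an $N\times N$ matrix (discretizing $A_0$) and $C_h:Y\to\mathbb C^N$ is linear, so that $A$ acting on functions with $\partial u=g$ is discretized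 by $A_{h,0}U_h+C_hg$. The function $f$ also makes sense as a map $[0,T]\times\mathbb C^N\to\mathbb C^N$ and $P_hf(t,u)=f(t,P_hu)$ for $t\in[0,T]$, $u\in X$. *Standing hypotheses on the discretization:* (a) $\|e^{tA_{h,0}}\|_h\le1$ for $t\ge0$; $A_{h,0}$ is invertible and $\|A_{h,0}^{-1}\|_h\le C$ with $C$ independent of $h$. (b) Let $R_h:D(A)\to\mathbb C^N$ be defined by $A_{h,0}R_hu+C_h\partial u=P_hAu$. There is a subspace $Z\subset D(A)$ with norm $\|\cdot\|_Z$ such that for $u\in Z$: $A_0^{-1}u\in Z$ and $e^{tA_0}u,f(t,u)\in Z$ for $t\in[0,T]$; $\|A_{h,0}(P_hu-R_hu)\|_h\le\varepsilon_h\|u\|_Z$ and $\|P_hu-R_hu\|_h\le\eta_h\|u\|_Z$, with $\varepsilon_h,\eta_h$ small with $h$. Moreover $\|A_{h,0}^{-1}C_h\|_h\le C''$ with $C''$ independent of $h$. (c) $f\in C^1([0,T]\times\mathbb C^N,\mathbb C^N)$ with derivative in the $\mathbb C^N$ variable uniformly bounded in a neighbourhood of the solution where the numerical approximation stays. **Runge–Kutta coefficients.** $a_{ij}$ ($j<i$), $b_i$, $c_i$ ($1\le i\le s$) form an explicit Runge–Kutta tableau with $\sum_{i=1}^sb_i=1$ and $\sum_{j=1}^{i-1}a_{ij}=c_i$ for $i=1,\dots,s$. $k>0$ is the stepsize, $t_n=nk$, $t_{n+1}\le T$. The functions $\varphi_j$ are $\varphi_0(z)=e^z$, $\varphi_{j+1}(z)=(\varphi_j(z)-1/j!)/z$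 for $z\ne0$, $\varphi_{j+1}(0)=1/(j+1)!$. **Full discretization, one step from $P_hu(t_n)$.** For $i=1,\dots,s$, $$\bar K_{n,h,i}=e^{c_ikA_{h,0}}P_hu(t_n)+c_ik\varphi_1(c_ikA_{h,0})C_h\partial u(t_n)+k\sum_{j=1}^{i-1}a_{ij}e^{(c_i-c_j)kA_{h,0}}f(t_n+c_jk,\bar K_{n,h,j}),$$ $$\begin{aligned}\bar U_{n+1,h}&=e^{kA_{h,0}}P_hu(t_n)+k\varphi_1(kA_{h,0})C_h\partial u(t_n)+k^2\varphi_2(kA_{h,0})C_h\partial Au(t_n)\\&\quad+k\sum_{i=1}^sb_i\big[e^{(1-c_i)kA_{h,0}}f(t_n+c_ik,\bar K_{n,h,i})+(1-c_i)k\varphi_1((1-c_i)kA_{h,0})C_h\partial f(t_n,u(t_n))\big].\end{aligned}$$ The local error is $\rho_{n+1,h}=\bar U_{n+1,h}-P_hu(t_{n+1})$. $O(\cdot)$ bounds are in $\|\cdot\|_h$. $D(A^l)$ carries the graph norm.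
   Formalization: The Z-norms of A^l u(t), f(t,u(t)) and Af(t,u(t)) are assumed bounded on [0,T], and the tableau is assumed to satisfy 0 ≤ c_i ≤ 1, with c_j ≤ c_i whenever a_ij ≠ 0. *)

(* Defs.v *)
From Stdlib Require Import Reals Factorial Lra Lia FunctionalExtensionality ProofIrrelevance.
From mathcomp Require Import ssreflect ssrfun ssrbool eqtype ssrnat seq fintype bigop.
From Coquelicot Require Import Coquelicot.

Set Implicit Arguments.
Unset Strict Implicit.
Unset Printing Implicit Defensive.

Local Open Scope R_scope.

(** * Normed modules from a norm *)

Section FromNorm.
Variables (K : AbsRing) (V : ModuleSpace K) (N : V -> R).
Hypothesis Ntri : forall x y, N (plus x y) <= N x + N y.
Hypothesis Nscal : forall (l : K) x, N (scal l x) <= abs l * N x.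
Hypothesis Nsep : forall x, N x = 0 -> x = zero.

Lemma fn_opp x : N (opp x) <= N x.
Proof.
rewrite -(scal_opp_one x); move: (Nscal (opp one) x).
by rewrite abs_opp_one Rmult_1_l.
Qed.

Lemma fn_zero : N zero = 0.
Proof.
have h1 : N zero <= 0.
  by move: (Nscal zero zero); rewrite scal_zero_l abs_zero Rmult_0_l.
have h2 : N zero <= N zero + N zero.
  by move: (Ntri zero zero); rewrite plus_zero_l.
by apply: Rle_antisym => //; apply: (Rplus_le_reg_l (N zero)); rewrite Rplus_0_r.
Qed.

Lemma fn_ball_center x (e : posreal) : N (minus x x) < e.
Proof. by rewrite minus_eq_zero fn_zero; apply: cond_pos. Qed.

Lemma fn_ball_sym x y e : N (minus y x) < e -> N (minus x y) < e.
Proof. by rewrite -(opp_minus y x) => h; apply: Rle_lt_trans h; apply: fn_opp. Qed.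

Lemma fn_ball_triangle x y z e1 e2 :
  N (minus y x) < e1 -> N (minus z y) < e2 -> N (minus z x) < e1 + e2.
Proof.
move=> h1 h2; rewrite (minus_trans y z x).
apply: Rle_lt_trans (Ntri _ _) _.
by rewrite Rplus_comm; apply: Rplus_lt_compat.
Qed.

Definition uniform_of_norm : UniformSpace.mixin_of V :=
  UniformSpace.Mixin V zero (fun x e y => N (minus y x) < e)
    fn_ball_center fn_ball_sym fn_ball_triangle.

Definition aux_of_norm : NormedModuleAux.class_of K V :=
  NormedModuleAux.Class K V (ModuleSpace.class K V) uniform_of_norm.

Lemma fn_compat2 (x y : V) (e : posreal) :
  N (minus y x) < e -> N (minus y x) < 1 * e.
Proof. by rewrite Rmult_1_l. Qed.

Definition mixin_of_norm :
    NormedModule.mixin_of K (NormedModuleAux.Pack K V aux_of_norm V) :=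
  NormedModule.Mixin K (NormedModuleAux.Pack K V aux_of_norm V) N 1
    Ntri Nscal (fun x y e h => h) fn_compat2 Nsep.

End FromNorm.

(** * K^N with the maximum norm *)

Definition vec (K : AbsRing) (N : nat) := 'I_N -> K.

Section Vec.
Variables (K : AbsRing) (N : nat).
Implicit Types x y z : vec K N.

Definition vec_plus x y : vec K N := fun i => plus (x i) (y i).
Definition vec_zero : vec K N := fun=> zero.
Definition vec_opp x : vec K N := fun i => opp (x i).
Definition vec_scal (l : K) x : vec K N := fun i => mult l (x i).

Lemma vec_plusC x y : vec_plus x y = vec_plus y x.
Proof. by apply: functional_extensionality => i; apply: plus_comm. Qed.
Lemma vec_plusA x y z :
  vec_plus x (vec_plus y z) = vec_plus (vec_plus x y) z.
Proof. by apply: functional_extensionality => i; apply: plus_assoc. Qed.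
Lemma vec_plus0 x : vec_plus x vec_zero = x.
Proof. by apply: functional_extensionality => i; apply: plus_zero_r. Qed.
Lemma vec_plusN x : vec_plus x (vec_opp x) = vec_zero.
Proof. by apply: functional_extensionality => i; apply: plus_opp_r. Qed.

Definition vec_AbelianMonoid_mixin :=
  AbelianMonoid.Mixin (vec K N) vec_plus vec_zero vec_plusC vec_plusA vec_plus0.
Canonical vec_AbelianMonoid :=
  AbelianMonoid.Pack (vec K N) vec_AbelianMonoid_mixin (vec K N).
Definition vec_AbelianGroup_mixin :=
  AbelianGroup.Mixin vec_AbelianMonoid vec_opp vec_plusN.
Canonical vec_AbelianGroup :=
  AbelianGroup.Pack (vec K N)
    (AbelianGroup.Class _ _ vec_AbelianGroup_mixin) (vec K N).

Lemma vec_scalA (l m : K) x :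
  vec_scal l (vec_scal m x) = vec_scal (mult l m) x.
Proof. by apply: functional_extensionality => i; apply: mult_assoc. Qed.
Lemma vec_scal1 x : vec_scal one x = x.
Proof. by apply: functional_extensionality => i; apply: mult_one_l. Qed.
Lemma vec_scalDr (l : K) x y :
  vec_scal l (plus x y) = plus (vec_scal l x) (vec_scal l y).
Proof. by apply: functional_extensionality => i; apply: mult_distr_l. Qed.
Lemma vec_scalDl (l m : K) x :
  vec_scal (plus l m) x = plus (vec_scal l x) (vec_scal m x).
Proof. by apply: functional_extensionality => i; apply: mult_distr_r. Qed.

Definition vec_ModuleSpace_mixin :=
  ModuleSpace.Mixin K vec_AbelianGroup vec_scal
    vec_scalA vec_scal1 vec_scalDr vec_scalDl.
Canonical vec_ModuleSpace :=
  ModuleSpace.Pack K (vec K N)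
    (ModuleSpace.Class K (vec K N) (AbelianGroup.class _) vec_ModuleSpace_mixin)
    (vec K N).

Definition maxnorm (x : vec K N) : R := \big[Rmax/0]_(i < N) abs (x i).

Lemma maxnorm_ub x i : abs (x i) <= maxnorm x.
Proof.
rewrite /maxnorm; have: i \in index_enum 'I_N by apply: mem_index_enum.
elim: (index_enum 'I_N) => // j s IH; rewrite in_cons big_cons => /orP[/eqP -> | /IH h].
  exact: Rmax_l.
by apply: Rle_trans h _; apply: Rmax_r.
Qed.

Lemma maxnorm_lub x M : 0 <= M -> (forall i, abs (x i) <= M) -> maxnorm x <= M.
Proof.
move=> M0 h; rewrite /maxnorm; apply: (big_ind (fun r => r <= M)) => //.
by move=> r1 r2; apply: Rmax_lub.
Qed.

Lemma maxnorm_ge0 x : 0 <= maxnorm x.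
Proof.
rewrite /maxnorm; apply: (big_ind (fun r => 0 <= r)); first exact: Rle_refl.
  by move=> r1 r2 h1 _; apply: Rle_trans h1 (Rmax_l _ _).
by move=> i _; apply: abs_ge_0.
Qed.

Lemma maxnorm_triangle x y : maxnorm (plus x y) <= maxnorm x + maxnorm y.
Proof.
apply: maxnorm_lub => [|i].
  by move: (maxnorm_ge0 x) (maxnorm_ge0 y) => *; lra.
apply: Rle_trans (abs_triangle _ _) _.
exact: Rplus_le_compat (maxnorm_ub x i) (maxnorm_ub y i).
Qed.

Lemma maxnorm_scal (l : K) x : maxnorm (scal l x) <= abs l * maxnorm x.
Proof.
apply: maxnorm_lub => [|i].
  by apply: Rmult_le_pos; [apply: abs_ge_0 | apply: maxnorm_ge0].
apply: Rle_trans (abs_mult _ _) _.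
by apply: Rmult_le_compat_l (maxnorm_ub x i); apply: abs_ge_0.
Qed.

Lemma maxnorm_sep x : maxnorm x = 0 -> x = zero.
Proof.
move=> h; apply: functional_extensionality => i; apply: abs_eq_zero.
by apply: Rle_antisym; [rewrite -h; apply: maxnorm_ub | apply: abs_ge_0].
Qed.

Canonical vec_UniformSpace :=
  UniformSpace.Pack (vec K N)
    (uniform_of_norm maxnorm_triangle maxnorm_scal) (vec K N).
Canonical vec_NormedModuleAux :=
  NormedModuleAux.Pack K (vec K N)
    (aux_of_norm maxnorm_triangle maxnorm_scal) (vec K N).
Canonical vec_NormedModule :=
  NormedModule.Pack K (vec K N)
    (NormedModule.Class K (vec K N)
       (aux_of_norm maxnorm_triangle maxnorm_scal)
       (mixin_of_norm maxnorm_triangle maxnorm_scal maxnorm_sep))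
    (vec K N).

End Vec.

Notation Rvec d := (vec R_AbsRing d).
Notation Cvec N := (vec C_AbsRing N).

(** * C(closure Omega) with the maximum norm *)

Section Domains.
Variables (d : nat) (Om : Rvec d -> Prop).

Definition closure_pt (x : Rvec d) : Prop :=
  forall eps : posreal, exists y, Om y /\ ball x eps y.

Definition clos : Type := {x : Rvec d | closure_pt x}.

Definition connected_set : Prop :=
  forall A B : Rvec d -> Prop, open A -> open B ->
    (forall x, Om x -> A x \/ B x) ->
    (exists x, Om x /\ A x) -> (exists x, Om x /\ B x) ->
    exists x, Om x /\ A x /\ B x.

Definition bounded_domain : Prop :=
  open Om /\ connected_set /\ (exists x, Om x) /\
  (exists M, forall x, Om x -> norm x <= M).

Definition clos_nbhs (x : clos) (P : clos -> Prop) : Prop :=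
  locally (sval x) (fun y => forall hy : closure_pt y, P (exist _ y hy)).

Global Instance clos_nbhs_filter x : Filter (clos_nbhs x).
Proof.
constructor.
- by apply: (@filter_forall _ (locally (sval x))).
- move=> P Q [e1 h1] [e2 h2]; exists (mkposreal _ (Rmin_stable_in_posreal e1 e2)).
  move=> y hb hy; split.
  + by apply: h1; apply: ball_le hb; apply: Rmin_l.
  + by apply: h2; apply: ball_le hb; apply: Rmin_r.
- by move=> P Q h [e h1]; exists e => y hb hy; apply: h; apply: h1.
Qed.

(* [cfun_bdd] is redundant as soon as [Om] is bounded, since the closure is then
   compact; keeping it makes the supremum norm meaningful for every [Om]. *)
Record cfun : Type := Cfun {
  cfun_val :> clos -> C;
  cfun_cont : forall x, filterlim cfun_val (clos_nbhs x) (locally (cfun_val x));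
  cfun_bdd : exists M, forall x, Cmod (cfun_val x) <= M }.

Arguments cfun_cont : clear implicits.
Arguments cfun_bdd : clear implicits.

Lemma cfun_ext (f g : cfun) : (forall x, f x = g x) -> f = g.
Proof.
case: f g => f cf bf [g cg bg] /= h.
have e : f = g by apply: functional_extensionality.
by subst g; rewrite (proof_irrelevance _ cf cg) (proof_irrelevance _ bf bg).
Qed.

Lemma cfun_plus_cont (f g : cfun) x :
  filterlim (fun y => plus (f y) (g y)) (clos_nbhs x) (locally (plus (f x) (g x))).
Proof.
exact (filterlim_comp_2 _ _ _ (cfun_cont f x) (cfun_cont g x)
  (filterlim_plus (V := C_NormedModule) (f x) (g x))).
Qed.

Lemma cfun_plus_bdd (f g : cfun) : exists M, forall x, Cmod (plus (f x) (g x)) <= M.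
Proof.
case: (cfun_bdd f) (cfun_bdd g) => M hM [M' hM']; exists (M + M') => x.
by apply: Rle_trans (Cmod_triangle _ _) _; apply: Rplus_le_compat.
Qed.

Arguments cfun_plus_cont : clear implicits.
Definition cfun_plus f g := Cfun (cfun_plus_cont f g) (cfun_plus_bdd f g).

Lemma cfun_scal_cont (l : C) (f : cfun) x :
  filterlim (fun y => mult l (f y)) (clos_nbhs x) (locally (mult l (f x))).
Proof.
exact (filterlim_comp _ _ _ _ _ _ _ _ (cfun_cont f x)
  (filterlim_scal_r (V := C_NormedModule) l (f x))).
Qed.

Lemma cfun_scal_bdd (l : C) (f : cfun) : exists M, forall x, Cmod (mult l (f x)) <= M.
Proof.
case: (cfun_bdd f) => M hM; exists (Cmod l * M) => x.
rewrite Cmod_mult; apply: Rmult_le_compat_l => //; exact: Cmod_ge_0.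
Qed.

Arguments cfun_scal_cont : clear implicits.
Definition cfun_scal l f := Cfun (cfun_scal_cont l f) (cfun_scal_bdd l f).

Lemma cfun_zero_cont x :
  filterlim (fun _ : clos => zero : C) (clos_nbhs x) (locally (zero : C)).
Proof. exact (filterlim_const _). Qed.
Lemma cfun_zero_bdd : exists M, forall x : clos, Cmod (zero : C) <= M.
Proof. by exists (Cmod zero) => _; apply: Rle_refl. Qed.

Arguments cfun_zero_cont : clear implicits.
Definition cfun_zero := Cfun cfun_zero_cont cfun_zero_bdd.
Definition cfun_opp f := cfun_scal (opp one) f.

Lemma cfun_plusC f g : cfun_plus f g = cfun_plus g f.
Proof. by apply: cfun_ext => x; apply: plus_comm. Qed.
Lemma cfun_plusA f g h :
  cfun_plus f (cfun_plus g h) = cfun_plus (cfun_plus f g) h.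
Proof. by apply: cfun_ext => x; apply: plus_assoc. Qed.
Lemma cfun_plus0 f : cfun_plus f cfun_zero = f.
Proof. by apply: cfun_ext => x; apply: plus_zero_r. Qed.
Lemma cfun_plusN f : cfun_plus f (cfun_opp f) = cfun_zero.
Proof.
apply: cfun_ext => x /=.
by rewrite -opp_mult_l mult_one_l plus_opp_r.
Qed.

Definition cfun_AbelianMonoid_mixin :=
  AbelianMonoid.Mixin cfun cfun_plus cfun_zero cfun_plusC cfun_plusA cfun_plus0.
Canonical cfun_AbelianMonoid := AbelianMonoid.Pack cfun cfun_AbelianMonoid_mixin cfun.
Definition cfun_AbelianGroup_mixin :=
  AbelianGroup.Mixin cfun_AbelianMonoid cfun_opp cfun_plusN.
Canonical cfun_AbelianGroup :=
  AbelianGroup.Pack cfun (AbelianGroup.Class _ _ cfun_AbelianGroup_mixin) cfun.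

Lemma cfun_scalA (l m : C) f :
  cfun_scal l (cfun_scal m f) = cfun_scal (mult l m) f.
Proof. by apply: cfun_ext => x; apply: mult_assoc. Qed.
Lemma cfun_scal1 f : cfun_scal one f = f.
Proof. by apply: cfun_ext => x; apply: mult_one_l. Qed.
Lemma cfun_scalDr (l : C) f g :
  cfun_scal l (plus f g) = plus (cfun_scal l f) (cfun_scal l g).
Proof. by apply: cfun_ext => x; apply: mult_distr_l. Qed.
Lemma cfun_scalDl (l m : C) f :
  cfun_scal (plus l m) f = plus (cfun_scal l f) (cfun_scal m f).
Proof. by apply: cfun_ext => x; apply: mult_distr_r. Qed.

Definition cfun_ModuleSpace_mixin :=
  ModuleSpace.Mixin C_Ring cfun_AbelianGroup cfun_scal
    cfun_scalA cfun_scal1 cfun_scalDr cfun_scalDl.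
Canonical cfun_ModuleSpace :=
  ModuleSpace.Pack C_Ring cfun
    (ModuleSpace.Class C_Ring cfun (AbelianGroup.class _) cfun_ModuleSpace_mixin)
    cfun.

Definition supnorm (f : cfun) : R :=
  real (Lub_Rbar (fun r => exists x, r = Cmod (f x))).

Lemma supnorm_spec (f : cfun) :
  (forall x, Cmod (f x) <= supnorm f) /\
  (forall M, 0 <= M -> (forall x, Cmod (f x) <= M) -> supnorm f <= M) /\
  0 <= supnorm f.
Proof.
rewrite /supnorm.
case: (Lub_Rbar_correct (fun r => exists x, r = Cmod (f x))) => hub hlub.
case: (cfun_bdd f) => M0 hM0.
have hle : Rbar_le (Lub_Rbar (fun r => exists x, r = Cmod (f x))) M0.
  by apply: hlub => _ [x ->]; apply: hM0.
move: hub hlub hle; case: (Lub_Rbar _) => [l| |] hub hlub hle //=.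
- split; first by move=> x; apply: (hub (Cmod (f x))); exists x.
  split; first by move=> M _ hM; apply: (hlub (Finite M)) => _ [x ->]; apply: hM.
  case: (Rle_lt_dec 0 l) => // hl.
  have: Rbar_le l m_infty.
    apply: hlub => _ [x ->]; have := hub _ (ex_intro _ x erefl).
    by move: (Cmod_ge_0 (f x)) => /= h1 h2; lra.
  by [].
- split; last by split=> //; lra.
  by move=> x; have := hub _ (ex_intro _ x erefl).
Qed.

Lemma supnorm_ub (f : cfun) x : Cmod (f x) <= supnorm f.
Proof. by case: (supnorm_spec f). Qed.
Lemma supnorm_lub (f : cfun) M : 0 <= M -> (forall x, Cmod (f x) <= M) -> supnorm f <= M.
Proof. by case: (supnorm_spec f) => _ [h _]; apply: h. Qed.
Lemma supnorm_ge0 (f : cfun) : 0 <= supnorm f.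
Proof. by case: (supnorm_spec f) => _ []. Qed.

Lemma supnorm_triangle (f g : cfun) : supnorm (plus f g) <= supnorm f + supnorm g.
Proof.
apply: supnorm_lub => [|x]; first by move: (supnorm_ge0 f) (supnorm_ge0 g) => *; lra.
apply: Rle_trans (Cmod_triangle _ _) _.
exact: Rplus_le_compat (supnorm_ub f x) (supnorm_ub g x).
Qed.

Lemma supnorm_scal (l : C_AbsRing) (f : cfun) : supnorm (scal l f) <= abs l * supnorm f.
Proof.
apply: supnorm_lub => [|x].
  by apply: Rmult_le_pos; [apply: abs_ge_0 | apply: supnorm_ge0].
apply: Rle_trans (abs_mult (K := C_AbsRing) l (f x)) _.
by apply: Rmult_le_compat_l (supnorm_ub f x); apply: abs_ge_0.
Qed.

Lemma supnorm_sep (f : cfun) : supnorm f = 0 -> f = zero.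
Proof.
move=> h; apply: cfun_ext => x; apply: Cmod_eq_0.
by apply: Rle_antisym; [rewrite -h; apply: supnorm_ub | apply: Cmod_ge_0].
Qed.

Canonical cfun_UniformSpace :=
  UniformSpace.Pack cfun (uniform_of_norm supnorm_triangle supnorm_scal) cfun.
Canonical cfun_NormedModuleAux :=
  NormedModuleAux.Pack C_AbsRing cfun
    (aux_of_norm supnorm_triangle supnorm_scal) cfun.
Canonical cfun_NormedModule :=
  NormedModule.Pack C_AbsRing cfun
    (NormedModule.Class C_AbsRing cfun
       (aux_of_norm supnorm_triangle supnorm_scal)
       (mixin_of_norm supnorm_triangle supnorm_scal supnorm_sep))
    cfun.

End Domains.

(** * Restriction of scalars *)

Section Realify.
Variable V : NormedModule C_AbsRing.

Definition rscal (r : R) (x : V) : V := scal (RtoC r : C_AbsRing) x.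

Lemma rscalA (r q : R) x : rscal r (rscal q x) = rscal (mult r q) x.
Proof. by rewrite /rscal scal_assoc RtoC_mult. Qed.
Lemma rscal1 x : rscal one x = x.
Proof. exact: (scal_one x). Qed.
Lemma rscalDr (r : R) x y : rscal r (plus x y) = plus (rscal r x) (rscal r y).
Proof. exact: scal_distr_l. Qed.
Lemma rscalDl (r q : R) x : rscal (plus r q) x = plus (rscal r x) (rscal q x).
Proof. by rewrite /rscal RtoC_plus; apply: scal_distr_r. Qed.

Definition realify_ModuleSpace_mixin :=
  ModuleSpace.Mixin R_Ring (NormedModule.AbelianGroup _ V) rscal
    rscalA rscal1 rscalDr rscalDl.
Definition realify_aux : NormedModuleAux.class_of R_AbsRing V :=
  NormedModuleAux.Class R_AbsRing V
    (ModuleSpace.Class R_Ring V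
       (AbelianGroup.class (NormedModule.AbelianGroup _ V))
       realify_ModuleSpace_mixin)
    (UniformSpace.class (NormedModule.UniformSpace _ V)).

Lemma rscal_norm (r : R) x : norm (rscal r x) <= abs r * norm x.
Proof.
apply: Rle_trans (norm_scal (RtoC r : C_AbsRing) x) _.
by rewrite /abs /= Cmod_R; apply: Rle_refl.
Qed.

Definition realify_mixin :
    NormedModule.mixin_of R_AbsRing (NormedModuleAux.Pack R_AbsRing V realify_aux V) :=
  NormedModule.Mixin R_AbsRing (NormedModuleAux.Pack R_AbsRing V realify_aux V)
    norm norm_factor norm_triangle rscal_norm
    (@norm_compat1 _ V) (@norm_compat2 _ V) (@norm_eq_zero _ V).

(* The same space over the reals: differentiability in the time variable and the
   Frechet differentiability of the nonlinearity are taken over the reals, so that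
   nonlinearities such as |u|^2 u, which are not holomorphic, are allowed. *)
Definition realify : NormedModule R_AbsRing :=
  NormedModule.Pack R_AbsRing V
    (NormedModule.Class R_AbsRing V realify_aux realify_mixin) V.

End Realify.

(** * Differential calculus relative to a set *)

Section Calculus.
Variables V W : NormedModule R_AbsRing.
Implicit Types (D : V -> Prop) (f : V -> W).

Definition C1_on D f (Df : V -> V -> W) : Prop :=
  (forall x, D x -> filterdiff f (within D (locally x)) (Df x)) /\
  (forall x, D x -> forall eps : posreal, within D (locally x)
     (fun y => forall v, norm (minus (Df y v) (Df x v)) <= eps * norm v)).

(* [Df] is C^1 as a map into the normed space of bounded linear maps from V to W,
   with derivative [D2f x], a bounded bilinear map. *)
Definition C2_on D f (Df : V -> V -> W) : Prop :=
  C1_on D f Df /\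
  exists D2f : V -> V -> V -> W,
  (forall x, D x ->
     (forall v, is_linear (D2f x v)) /\
     (forall w, is_linear (fun v => D2f x v w)) /\
     (exists M, forall v w, norm (D2f x v w) <= M * norm v * norm w)) /\
  (forall x, D x -> forall eps : posreal, within D (locally x)
     (fun y => forall w,
        norm (minus (minus (Df y w) (Df x w)) (D2f x (minus y x) w))
          <= eps * norm (minus y x) * norm w)) /\
  (forall x, D x -> forall eps : posreal, within D (locally x)
     (fun y => forall v w,
        norm (minus (D2f y v w) (D2f x v w)) <= eps * norm v * norm w)).

(* On finite-dimensional V: f is of class C^n. *)
Fixpoint smooth_upto (n : nat) f : Prop :=
  (forall x, continuous f x) /\
  match n with
  | O => True
  | S m => forall v, exists fv : V -> W,
      (forall x, is_derive (fun s : R => f (plus x (scal s v))) 0 (fv x)) /\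
      smooth_upto m fv
  end.

Definition time (T t : R) : Prop := 0 <= t <= T.

Definition deriv_on (T : R) (u u' : R -> W) : Prop :=
  forall t, time T t ->
    filterdiff u (within (time T) (locally t)) (fun r : R => scal r (u' t)).

Fixpoint Ck_on (T : R) (n : nat) (u : R -> W) : Prop :=
  match n with
  | O => continuous_on (time T) u
  | S m => exists u', deriv_on T u u' /\ Ck_on T m u'
  end.

End Calculus.

Arguments deriv_on : clear implicits.
Arguments Ck_on : clear implicits.
Arguments C1_on : clear implicits.
Arguments C2_on : clear implicits.

(** * C_0-semigroups *)

Section LinearOperators.
Variables U V : NormedModule C_AbsRing.

Definition subspace (D : U -> Prop) : Prop :=
  D zero /\ (forall x y, D x -> D y -> D (plus x y)) /\
  (forall (l : C_AbsRing) x, D x -> D (scal l x)).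

Definition linear_on (D : U -> Prop) (L : U -> V) : Prop :=
  (forall x y, D x -> D y -> L (plus x y) = plus (L x) (L y)) /\
  (forall (l : C_AbsRing) x, D x -> L (scal l x) = scal l (L x)).

Definition norm_on (D : U -> Prop) (N : U -> R) : Prop :=
  (forall x y, D x -> D y -> N (plus x y) <= N x + N y) /\
  (forall (l : C_AbsRing) x, D x -> N (scal l x) = abs l * N x) /\
  (forall x, D x -> 0 <= N x) /\
  (forall x, D x -> N x = 0 -> x = zero).

Definition dense_in (D : U -> Prop) : Prop :=
  forall x (eps : posreal), exists y, D y /\ norm (minus y x) < eps.

Definition C0_semigroup (S : R -> U -> U) : Prop :=
  (forall t, 0 <= t -> is_linear (S t)) /\
  (forall x, S 0 x = x) /\
  (forall t r x, 0 <= t -> 0 <= r -> S (t + r) x = S t (S r x)) /\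
  (forall x, filterlim (fun t => S t x) (at_right 0) (locally x)).

(* The operator (D, A), defined on D only, is the infinitesimal generator of S. *)
Definition generates (D : U -> Prop) (A : U -> U) (S : R -> U -> U) : Prop :=
  C0_semigroup S /\
  forall x y, (D x /\ A x = y) <->
    filterlim (fun t : R => scal (RtoC (/ t) : C_AbsRing) (minus (S t x) x))
      (at_right 0) (locally y).

(* The type is the growth bound, possibly -oo. *)
Definition semigroup_type (S : R -> U -> U) (omega : Rbar) : Prop :=
  is_glb_Rbar
    (fun w => exists M, forall t x, 0 <= t -> norm (S t x) <= M * exp (w * t) * norm x)
    omega.

End LinearOperators.

(** * Matrix functions *)

Section Matrices.
Variable N : nat.
Notation MN := (@matrix C N N).
Notation MRing := (@matrix_Ring C_Ring N).

Definition mxapp (M : MN) (v : Cvec N) : Cvec N :=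
  fun i => \big[Cplus/RtoC 0]_(j < N) Cmult (coeff_mat zero M i j) (v j).

Definition mxscale (l : C) (M : MN) : MN :=
  mk_matrix N N (fun i j => Cmult l (coeff_mat zero M i j)).

Definition CSeries (a : nat -> C) : C :=
  (Series (fun n => fst (a n)), Series (fun n => snd (a n))).

(* phi_j(M) = \sum_m M^m / (m + j)!, the Taylor series at M of the entire function
   phi_j; [phimx_rec] and [phimx_at0] are the defining recursion. *)
Definition phimx (j : nat) (M : MN) : MN :=
  mk_matrix N N (fun i l => CSeries (fun m =>
    Cmult (RtoC (/ INR (fact (m + j)))) (coeff_mat zero (pow_n (M : MRing) m) i l))).

Lemma CSeries_unique a l : is_series (V := C_NormedModule) a l -> CSeries a = l.
Proof.
move=> h; case: l h => l1 l2 h; rewrite /CSeries; congr pair; apply: is_series_unique.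
- have e n : sum_n (fun n => fst (a n)) n = fst (sum_n a n).
    elim: n => [|n IH]; first by rewrite !sum_O.
    by rewrite !sum_Sn IH.
  apply: (filterlim_ext (fun n => fst (sum_n a n))) => [n|]; first by rewrite e.
  move=> P [eps heps]; apply: (h (fun z => P (fst z))).
  by exists eps => z [h1 _]; apply: heps.
- have e n : sum_n (fun n => snd (a n)) n = snd (sum_n a n).
    elim: n => [|n IH]; first by rewrite !sum_O.
    by rewrite !sum_Sn IH.
  apply: (filterlim_ext (fun n => snd (sum_n a n))) => [n|]; first by rewrite e.
  move=> P [eps heps]; apply: (h (fun z => P (snd z))).
  by exists eps => z [_ h1]; apply: heps.
Qed.


Lemma finite_bound (a : nat -> R) n :
  exists B, 0 <= B /\ forall i, (i < n)%coq_nat -> a i <= B.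
Proof.
elim: n => [|n [B [B0 hB]]]; first by exists 0; split=> [|i hi]; [exact: Rle_refl | lia].
exists (Rmax B (a n)); split; first by apply: Rle_trans B0 (Rmax_l _ _).
move=> i hi; case: (Nat.eq_dec i n) => [->|ne]; first exact: Rmax_r.
by apply: Rle_trans (Rmax_l _ _); apply: hB; lia.
Qed.

Lemma mxpow_bound (M : MN) : exists B, 0 <= B /\ forall m i l,
  (i < N)%coq_nat -> (l < N)%coq_nat ->
  Cmod (coeff_mat zero (pow_n (M : MRing) m) i l) <= B ^ m.
Proof.
have [c [c0 hc]] : exists c, 0 <= c /\ forall i l,
    (i < N)%coq_nat -> (l < N)%coq_nat -> Cmod (coeff_mat zero M i l) <= c.
  elim: {1}N => [|n [B [B0 hB]]]; first by exists 0; split=> [|i l hi]; [exact: Rle_refl | lia].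
  have [B' [B'0 hB']] := finite_bound (fun l => Cmod (coeff_mat zero M n l)) N.
  exists (B + B'); split=> [|i l hi hl]; first lra.
  case: (Nat.eq_dec i n) => [->|ne]; first by have h := hB' l hl; lra.
  have hi' : (i < n)%coq_nat by lia.
  have h := hB i l hi' hl; lra.
exists (INR (S (Nat.pred N)) * c); split.
  by apply: Rmult_le_pos => //; apply: pos_INR.
elim=> [|m IH] i l hi hl.
  rewrite /= /one /= /Mone coeff_mat_bij //.
  elim: i l {hi hl} => [|i IH] [|l] //=; try exact: IH.
  - by rewrite /one /= Cmod_1; apply: Rle_refl.
  - by rewrite /zero /= Cmod_0; apply: Rle_0_1.
  - by rewrite /zero /= Cmod_0; apply: Rle_0_1.
rewrite /= {1}/mult /= /Mmult coeff_mat_bij // /sum_n.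
apply: Rle_trans (norm_sum_n_m (V := C_NormedModule) _ _ _) _.
set B := INR (S (Nat.pred N)) * c; set e := c * B ^ m.
have le j : (j <= Nat.pred N)%coq_nat ->
    Cmod (mult (coeff_mat zero M i j) (coeff_mat zero (pow_n (M : MRing) m) j l)) <= e.
  move=> hj; rewrite Cmod_mult.
  by apply: Rmult_le_compat; try apply: Cmod_ge_0; [apply: hc | apply: IH] => //; lia.
apply: (Rle_trans _ (sum_n_m (fun=> e) 0 (Nat.pred N))); last first.
  rewrite sum_n_m_const Nat.sub_0_r; apply: Req_le.
  by rewrite /e -Rmult_assoc.
elim: (Nat.pred N) le => [|q IHq] le; first by rewrite !sum_n_n; apply: le.
rewrite !sum_n_Sm; try lia.
by apply: Rplus_le_compat; [apply: IHq => j hj; apply: le; lia | apply: le].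
Qed.

Lemma phimx_series (M : MN) j i l : (i < N)%coq_nat -> (l < N)%coq_nat ->
  is_series (V := C_NormedModule) (fun m =>
    Cmult (RtoC (/ INR (fact (m + j)))) (coeff_mat zero (pow_n (M : MRing) m) i l))
    (coeff_mat zero (phimx j M) i l).
Proof.
move=> hi hl; rewrite /phimx coeff_mat_bij //.
have [B [B0 hB]] := mxpow_bound M.
set a := fun m : nat => _.
suff [s hs] : ex_series (V := C_NormedModule) a by rewrite (CSeries_unique hs).
apply: (ex_series_le (V := C_CompleteNormedModule) a (fun m => / INR (fact m) * B ^ m)).
  move=> m; rewrite /a /norm /= Cmod_mult Cmod_R.
  have hf n : 0 < / INR (fact n) by apply: Rinv_0_lt_compat; apply: INR_fact_lt_0.
  rewrite Rabs_pos_eq; last exact: Rlt_le.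
  apply: Rmult_le_compat; [exact: Rlt_le | exact: Cmod_ge_0 | | exact: hB].
  apply: Rinv_le_contravar; first exact: INR_fact_lt_0.
  by apply: le_INR; apply: fact_le; rewrite /addn /=; lia.
exists (exp B); apply: is_series_ext (is_exp_Reals B) => m.
by rewrite /scal /= /mult /= pow_n_pow Rmult_comm.
Qed.

Lemma phimx_rec (M : MN) j :
  plus (mult (M : MRing) (phimx j.+1 M)) (mxscale (RtoC (/ INR (fact j))) one)
  = phimx j M.
Proof.
apply: (proj2 (coeff_mat_ext_aux zero zero _ _)) => i l hi hl.
have hsum (q : nat) : (q < N)%coq_nat -> is_series (V := C_NormedModule)
    (fun m => Cmult (RtoC (/ INR (fact (m + j.+1)))) (sum_n (fun p =>
       mult (coeff_mat zero M i p) (coeff_mat zero (pow_n (M : MRing) m) p l)) q))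
    (sum_n (fun p => mult (coeff_mat zero M i p)
                          (coeff_mat zero (phimx j.+1 M) p l)) q).
  have one_term p : (p < N)%coq_nat -> is_series (V := C_NormedModule)
    (fun m => Cmult (RtoC (/ INR (fact (m + j.+1))))
       (mult (coeff_mat zero M i p) (coeff_mat zero (pow_n (M : MRing) m) p l)))
    (mult (coeff_mat zero M i p) (coeff_mat zero (phimx j.+1 M) p l)).
    move=> hp; refine (is_series_ext (V := C_NormedModule) _ _ _ _
      (is_series_scal (V := C_NormedModule) (coeff_mat zero M i p) _ _
        (phimx_series (M := M) (j := j.+1) hp hl))) => m.
    by rewrite /scal /= /mult /=; ring.
  elim: q => [|q IH] hq.
    by rewrite sum_O; refine (is_series_ext (V := C_NormedModule) _ _ _ _ (one_term _ hq)) => m; rewrite sum_O.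
  rewrite sum_Sn; have hq' : (q < N)%coq_nat by lia.
  refine (is_series_ext (V := C_NormedModule) _ _ _ _
    (is_series_plus (V := C_NormedModule) _ _ _ _ (IH hq') (one_term _ hq))) => m.
  by rewrite sum_Sn /plus /=; ring.
have hP : (Nat.pred N < N)%coq_nat by lia.
apply: (filterlim_locally_unique (V := C_NormedModule) (F := eventually)
  (sum_n (fun m => Cmult (RtoC (/ INR (fact (m + j))))
     (coeff_mat zero (pow_n (M : MRing) m) i l)))); last exact: phimx_series.
set ser := fun m : nat => _.
have -> : coeff_mat zero (plus (mult (M : MRing) (phimx j.+1 M))
    (mxscale (RtoC (/ INR (fact j))) one)) i l
  = plus (sum_n (fun p => mult (coeff_mat zero M i p)
      (coeff_mat zero (phimx j.+1 M) p l)) (Nat.pred N)) (ser O).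
  rewrite {1}/plus /= /Mplus coeff_mat_bij // {1}/mult /= /Mmult coeff_mat_bij //.
  by rewrite /mxscale coeff_mat_bij.
apply: (is_series_decr_1 (V := C_NormedModule) ser).
have -> : forall x y : C, plus (plus x y) (opp y) = x.
  by move=> x y; rewrite /plus /opp /=; ring.
refine (is_series_ext (V := C_NormedModule) _ _ _ _ (hsum _ hP)) => m.
rewrite /ser /= {2}/mult /= /Mmult coeff_mat_bij //.
by rewrite addnS.
Qed.

Lemma phimx_at0 j : phimx j (zero : MN) = mxscale (RtoC (/ INR (fact j))) one.
Proof.
rewrite -phimx_rec mult_zero_l; exact: plus_zero_l.
Qed.

End Matrices.

(** * Runge-Kutta methods *)

Section ExplicitRecursion.
Variables (V : AbelianMonoid) (G : nat -> (nat -> V) -> V).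

(* Stages K_1, K_2, ... with K_i = G i K, where [G i K] uses K_j for j < i only. *)
Fixpoint stage_table (n : nat) : nat -> V :=
  match n with
  | O => fun=> zero
  | S m => fun j => if j == m then G m (stage_table m) else stage_table m j
  end.

Definition stage (i : nat) : V := G i (stage_table i).

Lemma stage_tableE n j : (j < n)%N -> stage_table n j = stage j.
Proof.
elim: n => // n IH; rewrite ltnS leq_eqVlt /= => /orP[/eqP -> | hj].
  by rewrite eqxx.
by rewrite (ltn_eqF hj); apply: IH.
Qed.

Lemma stageE i :
  (forall K K', (forall j, (j < i)%N -> K j = K' j) -> G i K = G i K') ->
  stage i = G i stage.
Proof. by apply=> j hj; apply: stage_tableE. Qed.

End ExplicitRecursion.

(* Tableau entries are indexed from 1; only a i j with j < i is used. *)
Definition classical_stage (V : NormedModule R_AbsRing) (a : nat -> nat -> R)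
    (c : nat -> R) (F : R -> V -> V) (t0 : R) (y0 : V) (k : R) : nat -> V :=
  stage (fun i K =>
    plus y0 (scal k (sum_n_m (fun j => scal (a i j) (F (t0 + c j * k) (K j))) 1 (Nat.pred i)))).

Definition classical_step (V : NormedModule R_AbsRing) (s : nat) (a : nat -> nat -> R)
    (b c : nat -> R) (F : R -> V -> V) (t0 : R) (y0 : V) (k : R) : V :=
  plus y0 (scal k (sum_n_m (fun i =>
    scal (b i) (F (t0 + c i * k) (classical_stage a c F t0 y0 k i))) 1 s)).

(* Local error O(k^{p+1}) on every smooth system y' = F(t, y) in R^m. *)
Definition classical_order_ge (p s : nat) (a : nat -> nat -> R) (b c : nat -> R) : Prop :=
  forall (m : nat) (F : R -> Rvec m -> Rvec m) (y : R -> Rvec m) (t0 : R),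
    (forall n, smooth_upto (V := prod_NormedModule R_AbsRing R_NormedModule (vec_NormedModule R_AbsRing m))
                 n (fun p => F (fst p) (snd p))) ->
    locally t0 (fun t => is_derive y t (F t (y t))) ->
    exists C k0, 0 < k0 /\ forall k, 0 < k <= k0 ->
      norm (minus (classical_step s a b c F t0 (y t0) k) (y (t0 + k))) <= C * k ^ p.+1.

(* The node conditions make every exponential e^{tau A_0} of the method one with
   tau >= 0, and keep t_n + c_i k inside the time interval. *)
Definition erk_tableau (s : nat) (a : nat -> nat -> R) (b c : nat -> R) : Prop :=
  sum_n_m b 1 s = 1 /\
  (forall i, (1 <= i <= s)%N -> sum_n_m (a i) 1 (Nat.pred i) = c i) /\
  (forall i, (1 <= i <= s)%N -> 0 <= c i <= 1) /\
  (forall i j, (1 <= j < i)%N -> (i <= s)%N -> a i j <> 0 -> c j <= c i).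

(** * The initial boundary value problem *)

Section Data.
Variables (d : nat) (Om : Rvec d -> Prop) (Y : CompleteNormedModule C_AbsRing).
Notation X := (cfun Om).

(* Operators with a domain are total functions together with the domain; their
   values outside the domain are never used. *)
Record ibvp : Type := Ibvp {
  horizon : R;
  domA : X -> Prop;
  opA : X -> X;
  bdry : X -> Y;
  sgrp : R -> X -> X;                 (* e^{t A_0}, t >= 0 *)
  omega : Rbar;
  lift : C -> Y -> X;                 (* K(z) *)
  src : R -> X -> X;                  (* f *)
  dsrc : R * X -> R * X -> X;         (* derivative of f *)
  bdata : R -> Y;                     (* g *)
  init : X;
  sol : R -> X }.                     (* u *)

Record discretization : Type := Discretization {
  mesh : R -> Prop;                                 (* admissible values of h *)
  nodes : R -> nat;
  grid : forall h, 'I_(nodes h) -> clos Om;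
  Ah : forall h, @matrix C (nodes h) (nodes h);     (* A_{h,0} *)
  Ahinv : forall h, @matrix C (nodes h) (nodes h);  (* its inverse *)
  Ch : forall h, Y -> Cvec (nodes h);
  srch : forall h, R -> Cvec (nodes h) -> Cvec (nodes h);
  dsrch : forall h, R * Cvec (nodes h) -> R * Cvec (nodes h) -> Cvec (nodes h);
  Zsp : X -> Prop;
  Znorm : X -> R;
  epsh : R -> R;
  etah : R -> R }.

End Data.

Arguments horizon {d Om Y} _.
Arguments domA {d Om Y} _ _.
Arguments opA {d Om Y} _ _.
Arguments bdry {d Om Y} _ _.
Arguments sgrp {d Om Y} _ _ _.
Arguments omega {d Om Y} _.
Arguments lift {d Om Y} _ _ _.
Arguments src {d Om Y} _ _ _.
Arguments dsrc {d Om Y} _ _ _.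
Arguments bdata {d Om Y} _ _.
Arguments init {d Om Y} _.
Arguments sol {d Om Y} _ _.
Arguments mesh {d Om Y} _ _.
Arguments nodes {d Om Y} _ _.
Arguments grid {d Om Y} _ _ _.
Arguments Ah {d Om Y} _ _.
Arguments Ahinv {d Om Y} _ _.
Arguments Ch {d Om Y} _ _ _.
Arguments srch {d Om Y} _ _ _ _.
Arguments dsrch {d Om Y} _ _ _ _.
Arguments Zsp {d Om Y} _ _.
Arguments Znorm {d Om Y} _ _.
Arguments epsh {d Om Y} _ _.
Arguments etah {d Om Y} _ _.

Section Problem.
Variables (d : nat) (Om : Rvec d -> Prop) (Y : CompleteNormedModule C_AbsRing).
Notation X := (cfun Om).
Notation XR := (realify (cfun_NormedModule Om)).
Notation YR := (realify Y).

Variable P : ibvp Om Y.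
Notation T := (horizon P).
Notation A := (opA P).
Notation u := (sol P).

Definition domA0 (x : X) : Prop := domA P x /\ bdry P x = zero.

Fixpoint domA_pow (l : nat) (x : X) : Prop :=
  match l with
  | O => True
  | S m => domA P x /\ domA_pow m (A x)
  end.

(* v is continuous from [0,T] into D(A^l) with the graph norm *)
Definition continuous_D (l : nat) (v : R -> X) : Prop :=
  (forall t, time T t -> domA_pow l (v t)) /\
  (forall j, (j <= l)%N -> continuous_on (time T) (fun t => iter j A (v t))).

Definition slab (W : Type) (p : R * W) : Prop := time T (fst p).

Definition src_u (t : R) (x w : X) : X := dsrc P (t, x) (0, w).
Arguments src_u : clear implicits.

Record continuous_hyps : Prop := {
  ch_horizon : 0 < T;
  ch_domA : subspace (domA P);
  ch_opA : linear_on (domA P) A;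
  ch_bdry : linear_on (domA P) (bdry P);
  ch_onto : forall v, exists x, domA P x /\ bdry P x = v;
  ch_bdata : Ck_on YR T 1 (bdata P);
  ch_dense : dense_in domA0;
  ch_generates : generates domA0 A (sgrp P);
  ch_type : semigroup_type (sgrp P) (omega P);
  ch_negative : Rbar_lt (omega P) 0;
  ch_lift : forall z v, 0 < Re z ->
    unique (fun x => domA P x /\ A x = scal (z : C_AbsRing) x /\ bdry P x = v) (lift P z v);
  ch_lift_bound : exists w0 C : R, Rbar_lt (omega P) w0 /\
    forall z v, 0 < Re z -> w0 <= Re z -> norm (lift P z v) <= C * norm v;
  ch_src : C1_on (prod_NormedModule R_AbsRing R_NormedModule XR) XR
             (@slab X) (fun p => src P (fst p) (snd p)) (dsrc P);
  ch_sol_C1 : Ck_on XR T 1 u;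
  ch_sol_dom : forall t, time T t -> domA P (u t);
  ch_sol_A : continuous_on (time T) (fun t => A (u t));
  ch_pde : deriv_on XR T u (fun t => plus (A (u t)) (src P t (u t)));
  ch_init : u 0 = init P;
  ch_bc : forall t, time T t -> bdry P (u t) = bdata P t }.

(** * Full discretization *)

Variable D : discretization Om Y.

Definition Ph h (x : X) : Cvec (nodes D h) := fun i => x (grid D h i).
Arguments Ph : clear implicits.

Definition Rh h (x : X) : Cvec (nodes D h) :=
  mxapp (Ahinv D h) (minus (Ph h (A x)) (Ch D h (bdry P x))).
Arguments Rh : clear implicits.

Definition phih (j : nat) h (tau : R) : Cvec (nodes D h) -> Cvec (nodes D h) :=
  mxapp (phimx j (mxscale (RtoC tau) (Ah D h))).
Arguments phih : clear implicits.

Definition srch_u h (t : R) (x w : Cvec (nodes D h)) : Cvec (nodes D h) :=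
  dsrch D h (t, x) (0, w).
Arguments srch_u : clear implicits.

Record discretization_hyps : Prop := {
  dh_mesh : forall h, mesh D h -> 0 < h;
  dh_grid : forall h, mesh D h -> injective (grid D h);
  dh_Ch : forall h, mesh D h -> linear_on (fun=> True) (Ch D h);
  dh_contraction : forall h t v, mesh D h -> 0 <= t -> norm (phih 0 h t v) <= norm v;
  dh_inv : forall h, mesh D h ->
    mult (Ah D h : @matrix_Ring C_Ring (nodes D h)) (Ahinv D h) = one /\
    mult (Ahinv D h : @matrix_Ring C_Ring (nodes D h)) (Ah D h) = one;
  dh_inv_bound : exists C, forall h v, mesh D h -> norm (mxapp (Ahinv D h) v) <= C * norm v;
  dh_Zsub : subspace (Zsp D);
  dh_Zdom : forall x, Zsp D x -> domA P x;
  dh_Znorm : norm_on (Zsp D) (Znorm D);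
  dh_Z_A0inv : forall x, domA0 x -> Zsp D (A x) -> Zsp D x;
  dh_Z_sgrp : forall t x, time T t -> Zsp D x -> Zsp D (sgrp P t x);
  dh_Z_src : forall t x, time T t -> Zsp D x -> Zsp D (src P t x);
  dh_eps : forall h x, mesh D h -> Zsp D x ->
    norm (mxapp (Ah D h) (minus (Ph h x) (Rh h x))) <= epsh D h * Znorm D x;
  dh_eta : forall h x, mesh D h -> Zsp D x ->
    norm (minus (Ph h x) (Rh h x)) <= etah D h * Znorm D x;
  dh_eps_ge0 : forall h, mesh D h -> 0 <= epsh D h;
  dh_eta_ge0 : forall h, mesh D h -> 0 <= etah D h;
  dh_eps_small : filterlim (epsh D) (within (mesh D) (at_right 0)) (locally 0);
  dh_eta_small : filterlim (etah D) (within (mesh D) (at_right 0)) (locally 0);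
  dh_ChBound : exists C, forall h v, mesh D h ->
    norm (mxapp (Ahinv D h) (Ch D h v)) <= C * norm v;
  dh_src_grid : forall h t x, mesh D h -> time T t ->
    Ph h (src P t x) = srch D h t (Ph h x);
  dh_srch : forall h, mesh D h ->
    C1_on (prod_NormedModule R_AbsRing R_NormedModule
             (realify (vec_NormedModule C_AbsRing (nodes D h))))
          (realify (vec_NormedModule C_AbsRing (nodes D h)))
          (@slab (Cvec (nodes D h))) (fun p => srch D h (fst p) (snd p)) (dsrch D h);
  (* The neighbourhood of the solution is a tube whose radius does not depend on h;
     the stages enter it once k and h are small. *)
  dh_srch_tube : exists delta L, 0 < delta /\
    forall h t v w, mesh D h -> time T t -> norm (minus v (Ph h (u t))) <= delta ->
      norm (srch_u h t v w) <= L * norm w }.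

Section Step.
Variables (s : nat) (a : nat -> nat -> R) (b c : nat -> R).

Definition hstage h (k t : R) : nat -> Cvec (nodes D h) :=
  stage (fun i K =>
    plus (plus (phih 0 h (c i * k) (Ph h (u t)))
               (scal (RtoC (c i * k) : C_AbsRing)
                  (phih 1 h (c i * k) (Ch D h (bdry P (u t))))))
         (scal (RtoC k : C_AbsRing)
            (sum_n_m (fun j => scal (RtoC (a i j) : C_AbsRing)
               (phih 0 h ((c i - c j) * k) (srch D h (t + c j * k) (K j))))
             1 (Nat.pred i)))).

Arguments hstage : clear implicits.

Definition hstep h (k t : R) : Cvec (nodes D h) :=
  plus (plus (plus (phih 0 h k (Ph h (u t)))
                   (scal (RtoC k : C_AbsRing) (phih 1 h k (Ch D h (bdry P (u t))))))
             (scal (RtoC (k ^ 2) : C_AbsRing) (phih 2 h k (Ch D h (bdry P (A (u t)))))))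
       (scal (RtoC k : C_AbsRing)
          (sum_n_m (fun i => scal (RtoC (b i) : C_AbsRing)
             (plus (phih 0 h ((1 - c i) * k) (srch D h (t + c i * k) (hstage h k t i)))
                   (scal (RtoC ((1 - c i) * k) : C_AbsRing)
                      (phih 1 h ((1 - c i) * k) (Ch D h (bdry P (src P t (u t))))))))
           1 s)).

Arguments hstep : clear implicits.

(* rho_{n+1,h} *)
Definition local_error h (k : R) (n : nat) : Cvec (nodes D h) :=
  minus (hstep h k (INR n * k)) (Ph h (u (INR n.+1 * k))).

End Step.

(* err = O(bound) as h, k -> 0, uniformly in the steps with t_{n+1} <= T. *)
Definition landau (err : forall h, R -> nat -> Cvec (nodes D h)) (bound : R -> R -> R) : Prop :=
  exists C k0 h0, 0 < k0 /\ 0 < h0 /\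
  forall h k n, mesh D h -> h <= h0 -> 0 < k <= k0 -> INR n.+1 * k <= T ->
    norm (err h k n) <= C * bound h k.

(* A Z-valued function on [0,T]; its Z-norm is required to be bounded there, since
   error constants uniform in t_n involve the supremum of this norm. *)
Definition Z_valued (v : R -> X) : Prop :=
  (forall t, time T t -> Zsp D (v t)) /\
  exists M, forall t, time T t -> Znorm D (v t) <= M.

End Problem.

Arguments slab {d Om Y} P {W} p.
Arguments domA_pow {d Om Y} P l x.
Arguments continuous_D {d Om Y} P l v.
Arguments src_u {d Om Y} P t x w.
Arguments Ph {d Om Y} D h x.
Arguments Rh {d Om Y} P D h x.
Arguments phih {d Om Y} D j h tau v.
Arguments srch_u {d Om Y} D h t x w.
Arguments hstage {d Om Y} P D a c h k t i.
Arguments hstep {d Om Y} P D s a b c h k t.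
Arguments local_error {d Om Y} P D s a b c h k n.
Arguments landau {d Om Y} P D err bound.
Arguments Z_valued {d Om Y} P D v.

(* Main.v *)
Require Import Defs.
From HB Require Import structures.
From Stdlib Require Import Reals Lra Lia Factorial List.
From Stdlib Require Import FunctionalExtensionality Classical ProofIrrelevance.
From mathcomp Require Import ssreflect ssrfun ssrbool eqtype ssrnat seq fintype bigop.
From Coquelicot Require Import Coquelicot.

(* Write M = A_{h,0} and d(x) = M (P_h x - R_h x).  The definition of R_h gives
   C_h (bdry x) = P_h A x - M P_h x + d(x), so the recursion of the functions phi_j turns
   every boundary correction of the method into Taylor terms in P_h A^l u, P_h f and
   P_h A f plus defects d(u), d(A u), d(f), bounded by eps_h (by eta_h after applying M^-1).
   The phi_j(tau M) are contractions since t^(j+1) phi_{j+1}(t M) v has derivative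
   t^j phi_j(t M) v.  Hence the stages satisfy K_i - P_h u(t + c_i k) = O(k), and the first
   estimate follows.

   For the second one, K_i - P_h u(t + c_i k) = M W_i + O(k^2 + k eps_h) with W_i = O(k^2),
   so that M^-1 f_u M W_i = O(k^2) by the stability assumption.  The bounds on the
   nonlinearity are uniform in h because grid vectors extend to functions of the same
   norm, which transfers the smoothness of f on X to C^N.  The terms of order k^2 cancel by
   sum b_i c_i = 1/2 and u'' = A^2 u + A f + (f(., u))'; the latter needs A u' = (A u)',
   i.e. the closedness of the generator A_0 and the differentiability of the boundary data. *)

Set Implicit Arguments.
Unset Strict Implicit.
Unset Printing Implicit Defensive.

Local Open Scope R_scope.

(** * Linear combinations in a real module *)

(** The difficulty is that [A_{h,0}] has no bound uniform in h, even on grid values of smooth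
    functions, since these need not satisfy the homogeneous boundary condition. In the recursion
    [phi_j(tau M) = tau M phi_{j+1}(tau M) + 1/j!] the first term carries one more power of k, but a
    factor M that cannot be estimated; only after multiplication by M^-1 does it become harmless.
    This is why the second estimate gains an order, and why the stage errors must keep their form M
    W_i until M^-1 has passed through the Jacobian of the nonlinearity. The constants must also be
    uniform in time. A tube around the solution in X need not be compact, so compactness is used for
    [0,T] only, and local bounds near each point of the curve are glued along it. No vector-valued
    integral appears: Taylor expansions, the bounds on phi_j and the closedness of the generator all
    rest on a mean value inequality for curves on a closed interval, with one-sided derivatives at
    its ends. *)

Inductive mexp : Type :=
  | MAtom of nat | MZero | MPlus of mexp & mexp | MOpp of mexp | MScal of R & mexp.

Fixpoint mcoef (e : mexp) (n : nat) : R :=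
  match e with
  | MAtom m => if Nat.eqb m n then 1 else 0
  | MZero => 0
  | MPlus e1 e2 => mcoef e1 n + mcoef e2 n
  | MOpp e1 => - mcoef e1 n
  | MScal r e1 => r * mcoef e1 n
  end.

(** Computed by recursion, so that for a concrete environment it simplifies to finitely many
    equations between reals, one for each atom. *)
Fixpoint mcoef_eq (e1 e2 : mexp) (n : nat) : Prop :=
  match n with
  | O => True
  | S m => mcoef e1 m = mcoef e2 m /\ mcoef_eq e1 e2 m
  end.

Section Module.
Variable V : ModuleSpace R_Ring.

Fixpoint meval (env : list V) (e : mexp) : V :=
  match e with
  | MAtom m => List.nth m env zero
  | MZero => zero
  | MPlus e1 e2 => plus (meval env e1) (meval env e2)
  | MOpp e1 => opp (meval env e1)
  | MScal r e1 => scal r (meval env e1)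
  end.

Fixpoint mlin (env : list V) (c : nat -> R) : V :=
  match env with
  | nil => zero
  | x :: env' => plus (scal (c O) x) (mlin env' (fun n => c n.+1))
  end.

Lemma mlin_ext env c c' :
  (forall n, (n < List.length env)%coq_nat -> c n = c' n) -> mlin env c = mlin env c'.
Proof.
elim: env c c' => //= x env IH c c' h; congr plus; first by rewrite h //; lia.
by apply: IH => n hn; apply: h; lia.
Qed.

Lemma mlin_plus env c c' :
  mlin env (fun n => c n + c' n) = plus (mlin env c) (mlin env c').
Proof.
elim: env c c' => /= [|x env IH] c c'; first by rewrite plus_zero_l.
rewrite (scal_distr_r (K := R_Ring)) (IH (fun n => c n.+1)) -!plus_assoc; congr plus.
by rewrite !plus_assoc (plus_comm (scal (c' O) x)).
Qed.

Lemma mlin_scal env l c : mlin env (fun n => l * c n) = scal l (mlin env c).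
Proof.
elim: env c => /= [|x env IH] c; first by rewrite scal_zero_r.
by rewrite (IH (fun n => c n.+1)) scal_distr_l scal_assoc.
Qed.

Lemma mlin_zero env : mlin env (fun=> 0) = zero.
Proof.
elim: env => //= x env ->.
by rewrite (scal_zero_l (K := R_Ring)) plus_zero_l.
Qed.

Lemma mlin_atom env m :
  mlin env (fun n => if Nat.eqb m n then 1 else 0) = List.nth m env zero.
Proof.
elim: env m => [|x env IH] [|m] //=.
  by rewrite mlin_zero plus_zero_r (scal_one (K := R_Ring)).
by rewrite IH (scal_zero_l (K := R_Ring)) plus_zero_l.
Qed.

Lemma meval_mlin env e : meval env e = mlin env (mcoef e).
Proof.
elim: e => /= [m||e1 -> e2 ->|e ->|r e ->].
- by rewrite mlin_atom.
- by rewrite mlin_zero.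
- by rewrite mlin_plus.
- rewrite -(scal_opp_one (K := R_Ring)) -mlin_scal; apply: mlin_ext => n _.
  by rewrite /opp /one /=; ring.
- by rewrite mlin_scal.
Qed.

Lemma meval_eq env e1 e2 :
  mcoef_eq e1 e2 (List.length env) -> meval env e1 = meval env e2.
Proof.
move=> h; rewrite !meval_mlin; apply: mlin_ext => n.
elim: (List.length env) h => [|m IH] /=; first lia.
move=> [h1 h2] hn; case: (Nat.eq_dec n m) => [->//|ne].
by apply: (IH h2); lia.
Qed.
End Module.

Ltac mlookup x env :=
  lazymatch env with
  | ?y :: ?env' =>
    let test := match constr:(Set) with
      | _ => let _ := match constr:(Set) with _ => constr_eq x y end in constr:(true)
      | _ => constr:(false) end in
    lazymatch test with
    | true => constr:(O)
    | false => let n := mlookup x env' in constr:(S n)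
    end
  end.

Ltac mmem x env :=
  lazymatch env with
  | nil => constr:(false)
  | ?y :: ?env' =>
    match constr:(Set) with
    | _ => let _ := match constr:(Set) with _ => constr_eq x y end in constr:(true)
    | _ => mmem x env'
    end
  end.

Ltac madd x env :=
  let b := mmem x env in
  lazymatch b with true => env | false => constr:(x :: env) end.

(** Real and complex scalings share the notation [scal]; a scaling by a complex number not of the
    form [RtoC r] is kept as an atom. *)
Ltac is_real r :=
  match constr:(Set) with
  | _ => let _ := constr:(r : R) in constr:(true)
  | _ => constr:(false)
  end.

Ltac matoms env t :=
  lazymatch t with
  | plus ?x ?y => let e := matoms env x in matoms e y
  | minus ?x ?y => let e := matoms env x in matoms e y
  | opp ?x => matoms env x
  | scal (RtoC _) ?x => matoms env x
  | scal ?r ?x =>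
    let b := is_real r in
    lazymatch b with true => matoms env x | false => madd t env end
  | zero => env
  | _ => madd t env
  end.

Ltac mreify env t :=
  lazymatch t with
  | plus ?x ?y => let a := mreify env x in let b := mreify env y in constr:(MPlus a b)
  | minus ?x ?y =>
    let a := mreify env x in let b := mreify env y in constr:(MPlus a (MOpp b))
  | opp ?x => let a := mreify env x in constr:(MOpp a)
  | scal (RtoC ?r) ?x => let a := mreify env x in constr:(MScal r a)
  | scal ?r ?x =>
    let b := is_real r in
    lazymatch b with
    | true => let a := mreify env x in constr:(MScal r a)
    | false => let n := mlookup t env in constr:(MAtom n)
    end
  | zero => constr:(MZero)
  | _ => let n := mlookup t env in constr:(MAtom n)
  end.

Ltac module_coefs :=
  simpl; repeat split;
  rewrite /one /plus /opp /mult /minus /zero /=.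

(* Decides equalities of linear combinations in a normed module over R, leaving
   the equalities of coefficients that [ring] does not close.  With [V] of the form
   [realify _], complex scalars [RtoC r] are read as real ones. *)
Ltac modular_in V :=
  lazymatch goal with
  | |- ?l = ?r =>
    let env0 := constr:(@nil V) in
    let env1 := matoms env0 l in
    let env := matoms env1 r in
    let a := mreify env l in
    let b := mreify env r in
    refine (@meval_eq V env a b _);
    module_coefs; try ring
  end.

(** * Mean value inequality and compactness of an interval *)

(** The supremum of the points up to which [Q] holds satisfies [Q] by the last premise, and the step
    premise forbids it to lie below [b]. Both the covering argument and the mean value inequality
    are instances. *)
Lemma real_induction (Q : R -> Prop) a b : a <= b -> Q a ->
  (forall s, a <= s < b -> (forall r, a <= r <= s -> Q r) ->
     exists d, 0 < d /\ forall r, s < r < s + d -> r <= b -> Q r) ->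
  (forall s, a < s <= b -> (forall r, a <= r < s -> Q r) -> Q s) -> Q b.
Proof.
move=> ab Qa step lim.
pose S s := a <= s <= b /\ forall r, a <= r <= s -> Q r.
have Sa : S a by split=> [|r hr]; [lra | have -> : r = a by lra].
have [c [ub lub]] : {c | is_lub S c}.
  by apply: completeness; [exists b => s [hs _]; lra | exists a].
have ac : a <= c by apply: ub.
have cb : c <= b by apply: lub => s [hs _]; lra.
have below r : a <= r < c -> Q r.
  move=> hr; apply: NNPP => nQ.
  suff : c <= r by lra.
  apply: lub => s [hs hQ]; case: (Rle_lt_dec s r) => // h.
  by case: nQ; apply: hQ; lra.
have Qc : Q c.
  by case: (Req_dec a c) => [<-//|ne]; apply: lim => //; lra.
case: (Req_dec c b) => [<-//|ne].
have Sc : S c.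
  split=> [|r hr]; first lra.
  by case: (Req_dec r c) => [->//|ne']; apply: below; lra.
have [|d [d0 hd]] := step c _ (proj2 Sc); first lra.
pose m := Rmin b (c + d / 2).
have hm1 : m <= b by apply: Rmin_l.
have hm2 : m <= c + d / 2 by apply: Rmin_r.
have hm : c < m by apply: Rmin_glb_lt; lra.
suff /ub : S m by lra.
split=> [|r hr]; first lra.
case: (Rle_lt_dec r c) => h; first by apply: (proj2 Sc); lra.
by apply: hd; lra.
Qed.

(** [Q d t] weakens as [d] decreases, so local values can be merged by taking minima while moving to
    the right. The single parameter serves as a radius and, through [/ d], as a bound. *)
Lemma compact_unif (Q : R -> R -> Prop) a b : a <= b ->
  (forall d d' t, 0 < d' <= d -> Q d t -> Q d' t) ->
  (forall t, a <= t <= b -> exists d, 0 < d /\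
     forall r, a <= r <= b -> Rabs (r - t) < d -> Q d r) ->
  exists d, 0 < d /\ forall t, a <= t <= b -> Q d t.
Proof.
move=> ab mono loc.
have glue d d' s : 0 < d -> 0 < d' -> (forall t, a <= t <= b -> t <= s -> Q d t) ->
    (forall r, a <= r <= b -> Rabs (r - s) < d' -> Q d' r) ->
    forall s', s' < s + d' -> exists e, 0 < e /\ forall t, a <= t <= b -> t <= s' -> Q e t.
  move=> d0 d'0 h h' s' hs'; exists (Rmin d d'); split; first exact: Rmin_pos.
  have p := Rmin_pos _ _ d0 d'0.
  move=> t ht hts'; case: (Rle_lt_dec t s) => hts.
    by apply: (mono d); [split=> //; apply: Rmin_l | apply: h].
  apply: (mono d'); first by split=> //; apply: Rmin_r.
  by apply: h' => //; rewrite Rabs_pos_eq; lra.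
suff [d [d0 h]] : exists d, 0 < d /\ forall t, a <= t <= b -> t <= b -> Q d t.
  by exists d; split=> // t ht; apply: h => //; lra.
apply: (real_induction (Q := fun s => exists d, 0 < d /\
  forall t, a <= t <= b -> t <= s -> Q d t) ab).
- have [|d [d0 h]] := loc a; first lra.
  exists d; split=> // t ht hta; apply: h => //.
  by have -> : t - a = 0 by [lra]; rewrite Rabs_R0.
- move=> s hs /(_ s) [|d [d0 h]]; first lra.
  have [|d' [d'0 h']] := loc s; first lra.
  exists d'; split=> // r hr _.
  by apply: (glue d d' s) => //; lra.
- move=> s hs h; have [|d' [d'0 h']] := loc s; first lra.
  (* A point before [s], already covered, from which the local neighbourhood of [s] takes over. *)
  pose s0 := Rmax a (s - d' / 2).
  have h1 : a <= s0 by apply: Rmax_l.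
  have h2 : s - d' / 2 <= s0 by apply: Rmax_r.
  have h3 : s0 < s by apply: Rmax_lub_lt; lra.
  have [|d [d0 hd]] := h s0; first lra.
  exists (Rmin d d'); split; first exact: Rmin_pos.
  have p := Rmin_pos _ _ d0 d'0.
  move=> t ht hts; case: (Rle_lt_dec t s0) => hts0.
    by apply: (mono d); [split=> //; apply: Rmin_l | apply: hd].
  apply: (mono d'); first by split=> //; apply: Rmin_r.
  by apply: h' => //; apply: Rabs_def1; lra.
Qed.

Section NormedFacts.
Variables (K : AbsRing) (V : NormedModule K).
Implicit Types x y z : V.

Lemma norm_minus_sym x y : norm (minus x y) = norm (minus y x).
Proof. by rewrite -(norm_opp (minus x y)) opp_minus. Qed.

Lemma norm_minus_triangle y x z :
  norm (minus x z) <= norm (minus x y) + norm (minus y z).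
Proof. by rewrite (minus_trans y x z); apply: norm_triangle. Qed.

Lemma norm_minus_le x y : norm (minus x y) <= norm x + norm y.
Proof. by apply: Rle_trans (norm_triangle _ _) _; rewrite norm_opp; apply: Rle_refl. Qed.

Lemma norm_le_minus x y : norm x <= norm (minus x y) + norm y.
Proof.
have {1}-> : x = plus (minus x y) y by rewrite /minus -plus_assoc plus_opp_l plus_zero_r.
exact: norm_triangle.
Qed.

Lemma norm_minus_diag x : norm (minus x x) = 0.
Proof. by rewrite minus_eq_zero norm_zero. Qed.

End NormedFacts.

Lemma scal_bound (V : NormedModule R_AbsRing) (r B : R) (x : V) :
  norm x <= B -> norm (scal r x) <= Rabs r * B.
Proof.
move=> h; apply: Rle_trans (norm_scal r x) _.
by apply: Rmult_le_compat_l => //; apply: Rabs_pos.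
Qed.

(** A normed module only provides [<=]; the other direction follows by scaling back with [/ r]. *)
Lemma norm_scal_eq (V : NormedModule R_AbsRing) (r : R) (x : V) :
  norm (scal r x) = Rabs r * norm x.
Proof.
apply: Rle_antisym; first exact: scal_bound (Rle_refl _).
case: (Req_dec r 0) => [->|r0]; first by rewrite Rabs_R0 Rmult_0_l; apply: norm_ge_0.
have {1}-> : x = scal (/ r) (scal r x).
  by rewrite scal_assoc /mult /= Rinv_l // (scal_one (K := R_Ring)).
apply: Rle_trans (Rmult_le_compat_l _ _ _ (Rabs_pos _) (scal_bound _ (Rle_refl _))) _.
rewrite -Rmult_assoc -Rabs_mult Rinv_r // Rabs_R1; lra.
Qed.

Lemma le_of_le_eps x y : (forall e, 0 < e -> x <= y + e) -> x <= y.
Proof.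
move=> h; case: (Rle_lt_dec x y) => // hxy.
by have := h ((x - y) / 2); lra.
Qed.

Lemma le_of_le_mul_eps x y c : 0 <= c -> (forall e, 0 < e -> x <= y + e * c) -> x <= y.
Proof.
move=> c0 h; apply: le_of_le_eps => e e0.
have e1 : 0 < e / (c + 1) by apply: Rdiv_lt_0_compat; lra.
apply: Rle_trans (h _ e1) _.
suff : e / (c + 1) * c <= e / (c + 1) * (c + 1).
  by have -> : e / (c + 1) * (c + 1) = e by [field; lra]; lra.
by apply: Rmult_le_compat_l; lra.
Qed.

Section MeanValue.
Variable W : NormedModule R_AbsRing.
Implicit Types phi psi : R -> W.

(** Only left continuity and a bound on right-hand slopes are required: for a semigroup orbit these
    follow directly from the generator, without a proof of two-sided differentiability. *)
Lemma mean_value_right phi a b B : a <= b ->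
  (forall s, a < s <= b -> forall e, 0 < e -> exists d, 0 < d /\
     forall r, a <= r < s -> s - r < d -> norm (minus (phi r) (phi s)) <= e) ->
  (forall s, a <= s < b -> forall e, 0 < e -> exists d, 0 < d /\
     forall r, s < r < s + d -> r <= b ->
       norm (minus (phi r) (phi s)) <= (B + e) * (r - s)) ->
  norm (minus (phi b) (phi a)) <= B * (b - a).
Proof.
move=> ab cont slope.
apply: (le_of_le_mul_eps (c := b - a)) => [|e e0]; first lra.
rewrite -Rmult_plus_distr_r.
apply: (real_induction (Q := fun s => norm (minus (phi s) (phi a)) <= (B + e) * (s - a)) ab).
- by rewrite minus_eq_zero norm_zero Rminus_eq_0 Rmult_0_r; apply: Rle_refl.
- move=> s hs /(_ s) hQ; have [d [d0 hd]] := slope s hs e e0.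
  exists d; split=> // r hr hrb.
  apply: Rle_trans (norm_minus_triangle (phi s) _ _) _.
  have h1 := hd r hr hrb; have h2 : norm (minus (phi s) (phi a)) <= (B + e) * (s - a).
    by apply: hQ; lra.
  lra.
- move=> s hs hQ.
  (* The bound at [s] is taken from a point [r] slightly to its left. The [1] pays for left
     continuity and [Rabs (B + e)] for the shorter interval, since [B + e] may be negative. *)
  apply: (le_of_le_mul_eps (c := 1 + Rabs (B + e))) => [|e1 e10].
    by have := Rabs_pos (B + e); lra.
  have [d [d0 hd]] := cont s hs e1 e10.
  pose m := Rmin d e1; have m0 : 0 < m by apply: Rmin_pos.
  have md : m <= d by apply: Rmin_l.
  have me : m <= e1 by apply: Rmin_r.
  pose r := Rmax a (s - m / 2).
  have h1 : a <= r by apply: Rmax_l.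
  have h2 : s - m / 2 <= r by apply: Rmax_r.
  have h3 : r < s by apply: Rmax_lub_lt; lra.
  apply: Rle_trans (norm_minus_triangle (phi r) _ _) _.
  rewrite norm_minus_sym.
  have h4 : norm (minus (phi r) (phi s)) <= e1 by apply: hd; lra.
  have h5 : norm (minus (phi r) (phi a)) <= (B + e) * (r - a) by apply: hQ; lra.
  have h6 : - Rabs (B + e) * (s - r) <= (B + e) * (s - r).
    by apply: Rmult_le_compat_r; [lra | have := Rle_abs (- (B + e)); rewrite Rabs_Ropp; lra].
  have h7 : Rabs (B + e) * (s - r) <= Rabs (B + e) * e1.
    by apply: Rmult_le_compat_l; [apply: Rabs_pos | lra].
  lra.
Qed.

(** The derivative relative to the interval, hence one-sided at the endpoints. It is stated with
    norms instead of filters so that remainders can be added and compared directly. *)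
Definition has_deriv (a b : R) phi (s : R) (v : W) : Prop :=
  forall e, 0 < e -> exists d, 0 < d /\ forall r, a <= r <= b -> Rabs (r - s) < d ->
    norm (minus (minus (phi r) (phi s)) (scal (r - s) v)) <= e * Rabs (r - s).

Lemma has_deriv_sub a b a' b' phi s v : a <= a' -> b' <= b ->
  has_deriv a b phi s v -> has_deriv a' b' phi s v.
Proof.
move=> ha hb h e e0; have [d [d0 hd]] := h e e0.
by exists d; split=> // r hr; apply: hd; lra.
Qed.

Lemma has_deriv_lip a b phi s v e : has_deriv a b phi s v -> 0 < e -> exists d, 0 < d /\
  forall r, a <= r <= b -> Rabs (r - s) < d ->
    norm (minus (phi r) (phi s)) <= (norm v + e) * Rabs (r - s).
Proof.
move=> h e0; have [d [d0 hd]] := h e e0.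
exists d; split=> // r hr hrs; have := hd r hr hrs.
have := norm_le_minus (minus (phi r) (phi s)) (scal (r - s) v).
have := scal_bound (r - s) (Rle_refl (norm v)); lra.
Qed.

Lemma has_deriv_cont a b phi s v e : has_deriv a b phi s v -> 0 < e -> exists d, 0 < d /\
  forall r, a <= r <= b -> Rabs (r - s) < d -> norm (minus (phi r) (phi s)) <= e.
Proof.
move=> h e0; have [d [d0 hd]] := has_deriv_lip h Rlt_0_1.
have n0 := norm_ge_0 v.
have p : 0 < e / (norm v + 1) by apply: Rdiv_lt_0_compat; lra.
exists (Rmin d (e / (norm v + 1))); split; first exact: Rmin_pos.
move=> r hr hrs; apply: Rle_trans (hd r hr _) _.
  by apply: Rlt_le_trans hrs (Rmin_l _ _).
have -> : e = (norm v + 1) * (e / (norm v + 1)) by field; lra.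
apply: Rmult_le_compat_l; first lra.
by apply: Rlt_le; apply: Rlt_le_trans hrs (Rmin_r _ _).
Qed.

Lemma mean_value phi phi' a b B : a <= b ->
  (forall s, a <= s <= b -> has_deriv a b phi s (phi' s)) ->
  (forall s, a <= s <= b -> norm (phi' s) <= B) ->
  norm (minus (phi b) (phi a)) <= B * (b - a).
Proof.
move=> ab hd hB; apply: mean_value_right => // s hs e e0.
- have [|d [d0 h]] := has_deriv_cont (hd s _) e0; first lra.
  by exists d; split=> // r hr hrs; apply: h; [lra | apply: Rabs_def1; lra].
- have [|d [d0 h]] := has_deriv_lip (hd s _) e0; first lra.
  exists d; split=> // r hr hrb; have : Rabs (r - s) = r - s by apply: Rabs_pos_eq; lra.
  move=> E; have := h r _ _; rewrite E => /(_ _ _) {}h.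
  apply: Rle_trans (h _ _) _; [lra | lra |].
  apply: Rmult_le_compat_r; first lra.
  by have := hB s _; lra.
Qed.

Lemma has_deriv_unique a b phi s v w : a < b -> a <= s <= b ->
  has_deriv a b phi s v -> has_deriv a b phi s w -> v = w.
Proof.
move=> ab hs h1 h2.
suff : norm (minus v w) <= 0.
  move=> h; have /norm_eq_zero e : norm (minus v w) = 0.
    by apply: Rle_antisym => //; apply: norm_ge_0.
  by rewrite -(plus_zero_r w) -e /minus (plus_comm v) plus_assoc plus_opp_r plus_zero_l.
apply: (le_of_le_mul_eps (c := 2)) => [|e e0]; first lra.
have [d1 [d10 hd1]] := h1 e e0; have [d2 [d20 hd2]] := h2 e e0.
have [r [hr [hr0 [hr1 hr2]]]] : exists r, a <= r <= b /\ 0 < Rabs (r - s) /\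
    Rabs (r - s) < d1 /\ Rabs (r - s) < d2.
  (* [r] lies at distance [d / 2] from [s], towards the farther endpoint; half the length of the
     interval as a cap keeps it inside. *)
  pose d := Rmin (Rmin d1 d2) ((b - a) / 2).
  have p : 0 < d by apply: Rmin_pos; [apply: Rmin_pos | lra].
  have q : d <= (b - a) / 2 by apply: Rmin_r.
  have q1 : d <= d1 by apply: Rle_trans (Rmin_l _ _) (Rmin_l _ _).
  have q2 : d <= d2 by apply: Rle_trans (Rmin_l _ _) (Rmin_r _ _).
  case: (Rle_lt_dec s ((a + b) / 2)) => h.
    by exists (s + d / 2); have -> : s + d / 2 - s = d / 2 by [ring]; rewrite Rabs_pos_eq; lra.
  by exists (s - d / 2); have -> : s - d / 2 - s = - (d / 2) by [ring]; rewrite Rabs_Ropp Rabs_pos_eq; lra.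
have k1 := hd1 r hr hr1; have k2 := hd2 r hr hr2.
apply: (Rmult_le_reg_l (Rabs (r - s))) => //.
have <- : norm (scal (r - s) (minus v w)) = Rabs (r - s) * norm (minus v w).
  exact: norm_scal_eq.
have -> : scal (r - s) (minus v w) =
  minus (minus (minus (phi r) (phi s)) (scal (r - s) w))
        (minus (minus (phi r) (phi s)) (scal (r - s) v)) by modular_in W.
apply: Rle_trans (norm_minus_le _ _) _; lra.
Qed.

Lemma has_deriv_plus a b phi psi s v w :
  has_deriv a b phi s v -> has_deriv a b psi s w ->
  has_deriv a b (fun r => plus (phi r) (psi r)) s (plus v w).
Proof.
move=> h1 h2 e e0.
have [|d1 [d10 hd1]] := h1 (e / 2); first lra.
have [|d2 [d20 hd2]] := h2 (e / 2); first lra.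
exists (Rmin d1 d2); split; first exact: Rmin_pos.
move=> r hr hrs.
have k1 := hd1 r hr (Rlt_le_trans _ _ _ hrs (Rmin_l _ _)).
have k2 := hd2 r hr (Rlt_le_trans _ _ _ hrs (Rmin_r _ _)).
have -> : minus (minus (plus (phi r) (psi r)) (plus (phi s) (psi s))) (scal (r - s) (plus v w))
  = plus (minus (minus (phi r) (phi s)) (scal (r - s) v))
         (minus (minus (psi r) (psi s)) (scal (r - s) w)) by modular_in W.
apply: Rle_trans (norm_triangle _ _) _; lra.
Qed.

Lemma has_deriv_ext a b phi psi s v : a <= s <= b ->
  (forall r, a <= r <= b -> phi r = psi r) ->
  has_deriv a b phi s v -> has_deriv a b psi s v.
Proof.
move=> hs E h e e0; have [d [d0 hd]] := h e e0.
by exists d; split=> // r hr; rewrite -!E //; apply: hd.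
Qed.

Lemma has_deriv_opp a b phi s v : has_deriv a b phi s v ->
  has_deriv a b (fun r => opp (phi r)) s (opp v).
Proof.
move=> h e e0; have [d [d0 hd]] := h e e0.
exists d; split=> // r hr hrs.
have -> : minus (minus (opp (phi r)) (opp (phi s))) (scal (r - s) (opp v))
  = opp (minus (minus (phi r) (phi s)) (scal (r - s) v)) by modular_in W.
by rewrite norm_opp; apply: hd.
Qed.

Lemma has_deriv_poly2 a b s0 (v0 v1 v2 : W) s :
  has_deriv a b (fun r => plus v0 (plus (scal (r - s0) v1) (scal ((r - s0) ^ 2 / 2) v2))) s
    (plus v1 (scal (s - s0) v2)).
Proof.
move=> e e0.
have n0 := norm_ge_0 v2.
have p : 0 < e / (norm v2 + 1) by apply: Rdiv_lt_0_compat; lra.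
exists (e / (norm v2 + 1)); split=> // r hr hrs.
set x := minus _ _.
have -> : x = scal ((r - s) ^ 2 / 2) v2 by rewrite /x; modular_in W; field.
apply: Rle_trans (scal_bound _ (Rle_refl _)) _; rewrite Rabs_pos_eq; last first.
  by have := pow2_ge_0 (r - s); lra.
have -> : (r - s) ^ 2 / 2 = Rabs (r - s) * Rabs (r - s) / 2.
  by rewrite -Rabs_mult Rabs_pos_eq; [field | apply: Rle_0_sqr].
have q : Rabs (r - s) * norm v2 <= e.
  have -> : e = e / (norm v2 + 1) * (norm v2 + 1) by field; lra.
  apply: Rmult_le_compat; [exact: Rabs_pos | exact: norm_ge_0 | lra | lra].
have p1 := Rabs_pos (r - s); nra.
Qed.

End MeanValue.

(** * Differential calculus along a curve *)

Lemma within_eps (K : AbsRing) (V : NormedModule K) (D : V -> Prop) x (P : V -> Prop) :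
  within D (locally x) P ->
  exists d, 0 < d /\ forall y, D y -> norm (minus y x) < d -> P y.
Proof.
move=> h; have [d hd] := @locally_norm_le_locally K V x _ h.
by exists d; split; [exact: cond_pos | move=> y Dy hy; apply: hd].
Qed.

Lemma continuous_eps (K : AbsRing) (V : NormedModule K) (T : UniformSpace) (D : T -> Prop)
    (v : T -> V) x e : continuous_on D v -> D x -> 0 < e ->
  within D (locally x) (fun y => norm (minus (v y) (v x)) <= e).
Proof.
move=> h Dx e0; apply: (h x Dx (fun z => norm (minus z (v x)) <= e)).
apply: locally_le_locally_norm; exists (mkposreal e e0) => y hy.
exact: Rlt_le.
Qed.

Lemma norm_pairR (V : NormedModule R_AbsRing) (r : R) (x : V) :
  Rabs r <= norm ((r, x) : prod_NormedModule R_AbsRing R_NormedModule V) /\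
  norm x <= norm ((r, x) : prod_NormedModule R_AbsRing R_NormedModule V) /\
  norm ((r, x) : prod_NormedModule R_AbsRing R_NormedModule V) <= Rabs r + norm x.
Proof.
have [h1 h2] := norm_prod (K := R_AbsRing) (U := R_NormedModule) (V := V) r x.
split; first by apply: Rle_trans h1; apply: Rmax_l.
split; first by apply: Rle_trans h1; apply: Rmax_r.
have p := Rabs_pos r; have q := norm_ge_0 x.
rewrite {1}/norm /= /prod_norm /=.
have -> : norm (r : R_NormedModule) = Rabs r by [].
apply: Rle_trans (sqrt_le_1_alt _ ((Rabs r + norm x) ^ 2) _) _; first by rewrite /=; nra.
by rewrite sqrt_pow2; lra.
Qed.

Section Derivatives.
Variable W : NormedModule R_AbsRing.

Lemma deriv_on_has_deriv T (u u' : R -> W) t : deriv_on W T u u' -> time T t ->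
  has_deriv 0 T u t (u' t).
Proof.
move=> h ht e e0; have [_ hd] := h t ht.
have /within_eps [d [d0 k]] : within (time T) (locally (t : R_NormedModule)) (fun y => norm (minus (minus (u y) (u t))
    (scal (minus y t) (u' t))) <= mkposreal e e0 * norm (minus y t)).
  by apply: hd => P hP; apply: filter_imp hP.
by exists d; split=> // r hr hrt; apply: k.
Qed.

Lemma continuous_on_bounded (K : AbsRing) (V : NormedModule K) T (v : R -> V) : 0 < T ->
  continuous_on (time T) v -> exists B, 0 < B /\ forall t, time T t -> norm (v t) <= B.
Proof.
move=> T0 h.
have [||d [d0 hd]] := @compact_unif (fun d t => norm (v t) <= / d) 0 T (Rlt_le _ _ T0).
- move=> d d' t hd hv; apply: Rle_trans hv _.
  by apply: Rinv_le_contravar; lra.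
- move=> t ht; have /within_eps [d [d0 k]] := continuous_eps (x := t : R_NormedModule) h ht Rlt_0_1.
  have n0 := norm_ge_0 (v t).
  have p : 0 < / (norm (v t) + 1) by apply: Rinv_0_lt_compat; lra.
  exists (Rmin d (/ (norm (v t) + 1))); split; first exact: Rmin_pos.
  move=> r hr hrt; have {}k := k r hr (Rlt_le_trans _ _ _ hrt (Rmin_l _ _)).
  apply: (Rle_trans _ (norm (v t) + 1)).
    by apply: Rle_trans (norm_le_minus _ (v t)) _; lra.
  rewrite -{1}(Rinv_inv (norm (v t) + 1)); apply: Rinv_le_contravar; first exact: Rmin_pos.
  exact: Rmin_r.
by exists (/ d); split; [apply: Rinv_0_lt_compat | exact: hd].
Qed.

Lemma has_deriv_affine a b (x z : W) s :
  has_deriv a b (fun r => plus x (scal r z)) s z.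
Proof.
move=> e e0; exists 1; split=> [|r _ _]; first lra.
have -> : minus (minus (plus x (scal r z)) (plus x (scal s z))) (scal (r - s) z) = zero
  by modular_in W.
by rewrite norm_zero; apply: Rmult_le_pos; [lra | apply: Rabs_pos].
Qed.

Lemma has_deriv_lin a b t z s :
  has_deriv (W := R_NormedModule) a b (fun r => t + r * z) s z.
Proof.
move=> e e0; exists 1; split=> [|r _ _]; first lra.
have -> : minus (minus (t + r * z) (t + s * z)) (scal (r - s) z) = 0 :> R_NormedModule.
  by rewrite /minus /plus /opp /scal /= /mult /=; ring.
have -> : norm (0 : R_NormedModule) = 0 by exact: Rabs_R0.
by apply: Rmult_le_pos; [lra | apply: Rabs_pos].
Qed.

(** The mean value inequality for [u] minus its tangent at [a]. A Lipschitz bound for [u'] at the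
    single point [a] replaces a second derivative; the factor 1/2 of the sharp remainder is given
    up. *)
Lemma taylor1 (u u' : R -> W) a b B : a <= b -> 0 <= B ->
  (forall s, a <= s <= b -> has_deriv a b u s (u' s)) ->
  (forall s, a <= s <= b -> norm (minus (u' s) (u' a)) <= B * (s - a)) ->
  norm (minus (minus (u b) (u a)) (scal (b - a) (u' a))) <= B * (b - a) ^ 2.
Proof.
move=> ab B0 hd hB.
have -> : minus (minus (u b) (u a)) (scal (b - a) (u' a)) =
  minus (plus (u b) (opp (plus zero (scal b (u' a))))) (plus (u a) (opp (plus zero (scal a (u' a))))) by modular_in W.
have -> : B * (b - a) ^ 2 = B * (b - a) * (b - a) by ring.
apply: (mean_value (phi := fun r => plus (u r) (opp (plus zero (scal r (u' a)))))
  (phi' := fun r => plus (u' r) (opp (u' a)))) => // s hs.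
  by apply: has_deriv_plus; [apply: hd | apply: has_deriv_opp; apply: has_deriv_affine].
apply: Rle_trans (hB s hs) _; apply: Rmult_le_compat_l => //; lra.
Qed.

(** The derivative of [u] minus its quadratic Taylor polynomial is the first-order remainder of
    [u'], which [taylor1] bounds on each [[a, s]]. *)
Lemma taylor2 (u u' u'' : R -> W) a b B : a <= b -> 0 <= B ->
  (forall s, a <= s <= b -> has_deriv a b u s (u' s)) ->
  (forall s, a <= s <= b -> has_deriv a b u' s (u'' s)) ->
  (forall s, a <= s <= b -> norm (minus (u'' s) (u'' a)) <= B * (s - a)) ->
  norm (minus (minus (u b) (u a)) (plus (scal (b - a) (u' a)) (scal ((b - a) ^ 2 / 2) (u'' a))))
    <= B * (b - a) ^ 3.
Proof.
move=> ab B0 hd hd' hB.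
pose p r := plus zero (plus (scal (r - a) (u' a)) (scal ((r - a) ^ 2 / 2) (u'' a))).
have -> : minus (minus (u b) (u a)) (plus (scal (b - a) (u' a)) (scal ((b - a) ^ 2 / 2) (u'' a))) =
  minus (plus (u b) (opp (p b))) (plus (u a) (opp (p a))).
  by rewrite /p; modular_in W; field.
have -> : B * (b - a) ^ 3 = B * (b - a) ^ 2 * (b - a) by ring.
apply: (mean_value (phi := fun r => plus (u r) (opp (p r)))
  (phi' := fun r => plus (u' r) (opp (plus (u' a) (scal (r - a) (u'' a)))))) => // s hs.
  by apply: has_deriv_plus; [apply: hd | apply: has_deriv_opp; apply: has_deriv_poly2].
have -> : plus (u' s) (opp (plus (u' a) (scal (s - a) (u'' a)))) =
  minus (minus (u' s) (u' a)) (scal (s - a) (u'' a)) by modular_in W.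
apply: Rle_trans (taylor1 (u' := u'') (B := B) _ _ _ _) _ => //; try lra.
- by move=> r hr; apply: (has_deriv_sub (a := a) (b := b)); [lra | lra | apply: hd'; lra].
- by move=> r hr; apply: hB; lra.
- apply: Rmult_le_compat_l => //; apply: pow_incr; lra.
Qed.

End Derivatives.

Definition fdiff_at (V W : NormedModule R_AbsRing) (D : V -> Prop) (g : V -> W) x l :=
  is_linear l /\ forall e, 0 < e -> exists d, 0 < d /\ forall y, D y ->
    norm (minus y x) < d -> norm (minus (minus (g y) (g x)) (l (minus y x))) <= e * norm (minus y x).

Lemma filterdiff_fdiff_at (V W : NormedModule R_AbsRing) (D : V -> Prop) (g : V -> W) x l :
  filterdiff g (within D (locally x)) l -> fdiff_at D g x l.
Proof.
move=> [lin h]; split=> // e e0.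
have /within_eps [d [d0 k]] : within D (locally x) (fun y => norm (minus (minus (g y) (g x))
    (l (minus y x))) <= mkposreal e e0 * norm (minus y x)).
  by apply: h => P hP; apply: filter_imp hP.
by exists d.
Qed.

Lemma is_linear_minus (V W : NormedModule R_AbsRing) (l : V -> W) x y :
  is_linear l -> l (minus x y) = minus (l x) (l y).
Proof.
move=> lin; rewrite /minus (linear_plus _ lin) -(scal_opp_one (K := R_AbsRing) y).
congr plus; exact: eq_trans (linear_scal _ lin (opp one) y) (scal_opp_one _).
Qed.

Lemma has_deriv_comp (V W : NormedModule R_AbsRing) (D : V -> Prop) (g : V -> W) l
    (c : R -> V) a b s v :
  (forall r, a <= r <= b -> D (c r)) -> fdiff_at D g (c s) l -> has_deriv a b c s v ->
  has_deriv a b (fun r => g (c r)) s (l v).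
Proof.
move=> Dc [lin hg] hc e e0.
have [M [M0 hM]] := linear_norm _ lin.
have n0 := norm_ge_0 v.
have p1 : 0 < e / 2 / (norm v + 1) by apply: Rdiv_lt_0_compat; lra.
have p2 : 0 < e / 2 / M by apply: Rdiv_lt_0_compat; lra.
have [d1 [d10 h1]] := hg _ p1.
have d1' : 0 < d1 / 2 by lra.
have [d2 [d20 h2]] := hc _ p2.
have [d3 [d30 h3]] := has_deriv_lip hc Rlt_0_1.
have [d4 [d40 h4]] := has_deriv_cont hc d1'.
exists (Rmin (Rmin d2 d3) d4); split; first by apply: Rmin_pos => //; apply: Rmin_pos.
move=> r hr hrs.
have l2 : Rabs (r - s) < d2 by apply: Rlt_le_trans hrs _; apply: Rle_trans (Rmin_l _ _) (Rmin_l _ _).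
have l3 : Rabs (r - s) < d3 by apply: Rlt_le_trans hrs _; apply: Rle_trans (Rmin_l _ _) (Rmin_r _ _).
have l4 : Rabs (r - s) < d4 by apply: Rlt_le_trans hrs _; apply: Rmin_r.
have -> : minus (minus (g (c r)) (g (c s))) (scal (r - s) (l v)) =
  plus (minus (minus (g (c r)) (g (c s))) (l (minus (c r) (c s))))
       (l (minus (minus (c r) (c s)) (scal (r - s) v))).
  rewrite !(is_linear_minus _ _ lin) (linear_scal _ lin); modular_in W.
apply: Rle_trans (norm_triangle _ _) _.
have -> : e * Rabs (r - s) = e / 2 * Rabs (r - s) + e / 2 * Rabs (r - s) by field.
apply: Rplus_le_compat.
- have k4 := h4 r hr l4; have hlt : norm (minus (c r) (c s)) < d1 by lra.
  apply: Rle_trans (h1 _ (Dc r hr) hlt) _.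
  apply: Rle_trans (Rmult_le_compat_l _ _ _ (Rlt_le _ _ p1) (h3 r hr l3)) _.
  by apply: Req_le; field; lra.
- apply: Rle_trans (hM _) _.
  apply: Rle_trans (Rmult_le_compat_l _ _ _ (Rlt_le _ _ M0) (h2 r hr l2)) _.
  by apply: Req_le; field; lra.
Qed.

(** * Estimates for the nonlinearity in a tube around a curve *)

Section AlongCurve.
Variables (W : NormedModule R_AbsRing) (T : R).
Notation V := (prod_NormedModule R_AbsRing R_NormedModule W).
Hypothesis T0 : 0 < T.

Lemma has_deriv_pair a b (c : R -> R) (x : R -> W) s c' x' :
  has_deriv (W := R_NormedModule) a b c s c' -> has_deriv a b x s x' ->
  has_deriv (W := V) a b (fun r => (c r, x r)) s (c', x').
Proof.
move=> h1 h2 e e0.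
have [|d1 [d10 k1]] := h1 (e / 2); first lra.
have [|d2 [d20 k2]] := h2 (e / 2); first lra.
exists (Rmin d1 d2); split; first exact: Rmin_pos.
move=> r hr hrs.
have {}k1 := k1 r hr (Rlt_le_trans _ _ _ hrs (Rmin_l _ _)).
have {}k2 := k2 r hr (Rlt_le_trans _ _ _ hrs (Rmin_r _ _)).
apply: Rle_trans (proj2 (proj2 (norm_pairR _ _))) _.
have -> : e * Rabs (r - s) = e / 2 * Rabs (r - s) + e / 2 * Rabs (r - s) by field.
exact: Rplus_le_compat.
Qed.

Variables (u u' : R -> W) (f : R -> W -> W) (Df : V -> V -> W).
Definition in_slab (p : V) : Prop := time T (fst p).
Hypothesis hu : forall t, time T t -> has_deriv 0 T u t (u' t).
Hypothesis hf : C1_on V W in_slab (fun p => f (fst p) (snd p)) Df.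

(** A neighbourhood of [(t, u t)] in the product contains a piece of tube around the curve, because
    [u] is continuous; compactness of the time interval then gives one radius [d] and one bound
    [/ d] for all times. *)
Lemma tube_bound (G : V -> R -> Prop) :
  (forall p B B', B <= B' -> G p B -> G p B') ->
  (forall t, time T t -> exists B, within in_slab (locally ((t, u t) : V)) (fun p => G p B)) ->
  exists d, 0 < d /\ forall t x, time T t -> norm (minus x (u t)) <= d -> G (t, x) (/ d).
Proof.
move=> mono loc.
have [||d [d0 hd]] := @compact_unif (fun d t => forall x, norm (minus x (u t)) <= d -> G (t, x) (/ d))
  0 T (Rlt_le _ _ T0).
- move=> d d' t hd hG x hx; apply: (mono _ (/ d)); first by apply: Rinv_le_contravar; lra.
  by apply: hG; lra.
- move=> t ht; have [B /within_eps [d [d0 hd]]] := loc t ht.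
  have d4 : 0 < d / 4 by lra.
  have [d1 [d10 h1]] := has_deriv_cont (hu ht) d4.
  have B0 := Rabs_pos B.
  have p : 0 < / (Rabs B + 1) by apply: Rinv_0_lt_compat; lra.
  (* The time shift, the motion of the curve and the distance from the curve take at most [d / 4]
     each; the last entry makes [/ m] at least [B]. *)
  pose m := Rmin (Rmin d1 (d / 4)) (/ (Rabs B + 1)).
  have m0 : 0 < m by apply: Rmin_pos => //; apply: Rmin_pos.
  have m1 : m <= d1 by apply: Rle_trans (Rmin_l _ _) (Rmin_l _ _).
  have m2 : m <= d / 4 by apply: Rle_trans (Rmin_l _ _) (Rmin_r _ _).
  have m3 : m <= / (Rabs B + 1) by apply: Rmin_r.
  exists m; split=> // r hr hrt x hx.
  apply: (mono _ B).
    apply: Rle_trans (Rle_abs B) _; apply: (Rle_trans _ (Rabs B + 1)); first lra.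
    by rewrite -{1}(Rinv_inv (Rabs B + 1)); apply: Rinv_le_contravar.
  apply: hd => //; apply: Rle_lt_trans (proj2 (proj2 (norm_pairR _ _))) _.
  have k := h1 r hr (Rlt_le_trans _ _ _ hrt m1).
  have k2 := norm_minus_triangle (u r) x (u t).
  have -> : Rabs (plus r (opp t)) = Rabs (r - t) by [].
  have -> : plus x (opp (u t)) = minus x (u t) by [].
  lra.
- by exists d; split=> // t x ht; apply: hd.
Qed.

Lemma tube_Df : exists d, 0 < d /\ forall t x, time T t -> norm (minus x (u t)) <= d ->
  forall v, norm (Df (t, x) v) <= / d * norm v.
Proof.
apply: (tube_bound (G := fun p B => forall v, norm (Df p v) <= B * norm v)).
- move=> p B B' BB' h v; apply: Rle_trans (h v) _.
  by apply: Rmult_le_compat_r => //; apply: norm_ge_0.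
- move=> t ht; case: hf => hd hc.
  have [lin _] := hd (t, u t) ht; have [M [M0 hM]] := linear_norm _ lin.
  exists (1 + M); apply: filter_imp (hc (t, u t) ht (mkposreal 1 Rlt_0_1)) => p hp v.
  have := hp v => /= h; have := norm_le_minus (Df p v) (Df (t, u t) v); have := hM v; lra.
Qed.

(** The mean value inequality on a segment at fixed time, after subtracting [scal r z]. Taking [z]
    zero gives Lipschitz bounds; taking for [z] a derivative at another point gives Taylor
    remainders. *)
Lemma C1_segment t (x y z : W) B : time T t ->
  (forall r, 0 <= r <= 1 ->
     norm (minus (Df (t, plus x (scal r (minus y x))) (0, minus y x)) z) <= B) ->
  norm (minus (minus (f t y) (f t x)) z) <= B.
Proof.
move=> ht hB.
pose c r : V := (t, plus x (scal r (minus y x))).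
have := mean_value (W := W)
  (phi := fun r => plus (f t (plus x (scal r (minus y x)))) (opp (plus zero (scal r z))))
  (phi' := fun r => plus (Df (c r) (0, minus y x)) (opp z)) (B := B) Rle_0_1.
rewrite Rminus_0_r Rmult_1_r => h.
have -> : minus (minus (f t y) (f t x)) z =
  minus (plus (f t (plus x (scal 1 (minus y x)))) (opp (plus zero (scal 1 z))))
        (plus (f t (plus x (scal 0 (minus y x)))) (opp (plus zero (scal 0 z)))).
  have -> : plus x (scal 1 (minus y x)) = y by modular_in W.
  have -> : plus x (scal 0 (minus y x)) = x by modular_in W.
  by modular_in W.
apply: h => // s hs; apply: has_deriv_plus; last by apply: has_deriv_opp; apply: has_deriv_affine.
apply: (has_deriv_comp (V := V) (c := c) (D := in_slab) (g := fun p => f (fst p) (snd p))) => //.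
  by apply: filterdiff_fdiff_at; apply: (proj1 hf).
apply: has_deriv_pair; last exact: has_deriv_affine.
move=> e e0; exists 1; split=> [|r _ _]; first lra.
have -> : minus (minus t t) (scal (r - s) 0) = 0 :> R_NormedModule.
  by rewrite /minus /plus /opp /scal /= /mult /=; ring.
have -> : norm (0 : R_NormedModule) = 0 by exact: Rabs_R0.
by apply: Rmult_le_pos; [lra | apply: Rabs_pos].
Qed.

Lemma segment_dist (x y x0 : W) r : 0 <= r <= 1 ->
  norm (minus (plus x (scal r (minus y x))) x0) <= norm (minus x x0) + norm (minus y x).
Proof.
move=> hr.
have -> : minus (plus x (scal r (minus y x))) x0 = plus (minus x x0) (scal r (minus y x)) by modular_in W.
apply: Rle_trans (norm_triangle _ _) _; apply: Rplus_le_compat_l.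
rewrite norm_scal_eq Rabs_pos_eq; last lra.
rewrite -[X in _ <= X]Rmult_1_l; apply: Rmult_le_compat_r; [exact: norm_ge_0 | lra].
Qed.

Lemma tube_lipschitz : exists d, 0 < d /\ forall t x, time T t -> norm (minus x (u t)) <= d ->
  norm (minus (f t x) (f t (u t))) <= / d * norm (minus x (u t)).
Proof.
have [d [d0 hd]] := tube_Df; exists d; split=> // t x ht hx.
have -> : minus (f t x) (f t (u t)) = minus (minus (f t x) (f t (u t))) zero by modular_in W.
apply: C1_segment => // r hr.
have -> : forall w : W, minus w zero = w by move=> w; modular_in W.
apply: Rle_trans (hd _ _ ht _ _) _.
  apply: Rle_trans (segment_dist _ _ _ hr) _.
  by rewrite minus_eq_zero norm_zero; lra.
apply: Rmult_le_compat_l; first by apply: Rlt_le; apply: Rinv_0_lt_compat.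
apply: Rle_trans (proj2 (proj2 (norm_pairR _ _))) _.
by rewrite Rabs_R0 Rplus_0_l; apply: Rle_refl.
Qed.

Variable Bu : R.
Hypothesis hBu : forall t, time T t -> norm (u' t) <= Bu.

Lemma Bu_ge0 : 0 <= Bu.
Proof. by apply: Rle_trans (norm_ge_0 (u' 0)) (hBu _); split; lra. Qed.

Lemma bounded_deriv_lip (v v' : R -> W) B :
  (forall t, time T t -> has_deriv 0 T v t (v' t)) ->
  (forall t, time T t -> norm (v' t) <= B) ->
  forall t s, time T t -> time T s -> norm (minus (v s) (v t)) <= B * Rabs (s - t).
Proof.
move=> hd hB.
have main t s : time T t -> time T s -> t <= s -> norm (minus (v s) (v t)) <= B * (s - t).
  move=> [t1 t2] [s1 s2] ts; apply: (mean_value (phi' := v')) => // r hr.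
    by apply: (has_deriv_sub (a := 0) (b := T)) => //; apply: hd; split; lra.
  by apply: hB; split; lra.
move=> t s ht hs; case: (Rle_lt_dec t s) => h.
  by rewrite Rabs_pos_eq; [apply: main | lra].
rewrite norm_minus_sym Rabs_minus_sym Rabs_pos_eq; [apply: main => //; lra | lra].
Qed.

Lemma u_lip t s : time T t -> time T s -> norm (minus (u s) (u t)) <= Bu * Rabs (s - t).
Proof. exact: bounded_deriv_lip hu hBu t s. Qed.

Definition comp_src t := f t (u t).
Definition comp_src' t := Df (t, u t) (1, u' t).

Lemma comp_src_deriv t : time T t -> has_deriv 0 T comp_src t (comp_src' t).
Proof.
move=> ht.
apply: (has_deriv_comp (V := V) (c := fun r => (r, u r)) (D := in_slab) (g := fun p => f (fst p) (snd p))) => //.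
  by apply: filterdiff_fdiff_at; apply: (proj1 hf).
apply: has_deriv_pair; last exact: hu.
apply: (has_deriv_ext (W := R_NormedModule) (phi := fun r => 0 + r * 1) ht); last exact: has_deriv_lin.
by move=> r _; rewrite Rplus_0_l Rmult_1_r.
Qed.

Lemma comp_src_lip : exists L, 0 <= L /\ forall t s, time T t -> time T s ->
  norm (minus (comp_src s) (comp_src t)) <= L * Rabs (s - t).
Proof.
have [d [d0 hd]] := tube_Df; have b0 := Bu_ge0.
have i0 : 0 < / d by apply: Rinv_0_lt_compat.
exists (/ d * (1 + Bu)); split; first by apply: Rmult_le_pos; lra.
apply: (bounded_deriv_lip (v' := comp_src')) => [|t ht]; first exact: comp_src_deriv.
apply: Rle_trans (hd _ _ ht _ _) _; first by rewrite norm_minus_diag; lra.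
apply: Rmult_le_compat_l; first lra.
apply: Rle_trans (proj2 (proj2 (norm_pairR _ _))) _.
by rewrite Rabs_R1; have := hBu ht; lra.
Qed.

Hypothesis hf2 : C2_on V W in_slab (fun p => f (fst p) (snd p)) Df.

(** The segment from [(t, u t)] to [(s, x)] stays in a tube where the second derivative is bounded,
    so the mean value inequality applies to [Df] evaluated at a fixed direction [w]. *)
Lemma tube_Df_lipschitz : exists d L, 0 < d /\ 0 <= L /\ forall t s x, time T t -> time T s ->
  Rabs (s - t) <= d -> norm (minus x (u t)) <= d -> forall w,
  norm (minus (Df (s, x) w) (Df (t, u t) w)) <= L * (Rabs (s - t) + norm (minus x (u t))) * norm w.
Proof.
case: hf2 => _ [D2f [hlin [hD2 hcont]]].
have [||d [d0 hd]] := @tube_bound (fun p B => forall v w, norm (D2f p v w) <= B * norm v * norm w).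
- move=> p B B' BB' h v w; apply: Rle_trans (h v w) _.
  apply: Rmult_le_compat_r; first exact: norm_ge_0.
  by apply: Rmult_le_compat_r => //; apply: norm_ge_0.
- move=> t ht; have [_ [_ [M hM]]] := hlin (t, u t) ht.
  exists (1 + M); apply: filter_imp (hcont (t, u t) ht (mkposreal 1 Rlt_0_1)) => p hp v w.
  have := hp v w => /= h; have := norm_le_minus (D2f p v w) (D2f (t, u t) v w).
  have := hM v w; lra.
have b0 := Bu_ge0.
have i0 : 0 < / d by apply: Rinv_0_lt_compat.
(* During a time [d / (1 + Bu)] the curve moves at most [Bu] times as far, and adding the same
   radius once more gives exactly [d]. *)
exists (d / (1 + Bu)), (/ d); split; first by apply: Rdiv_lt_0_compat; lra.
split=> [|t s x ht hs hst hx w]; first lra.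
pose q : V := (s - t, minus x (u t)).
pose c r : V := (t + r * (s - t), plus (u t) (scal r (minus x (u t)))).
have hc r : 0 <= r <= 1 -> in_slab (c r).
  by rewrite /in_slab /time /c /=; case: ht hs => ? ? [? ?] ?; split; nra.
have := mean_value (W := W) (phi := fun r => Df (c r) w) (phi' := fun r => D2f (c r) q w)
  (B := / d * (Rabs (s - t) + norm (minus x (u t))) * norm w) Rle_0_1.
rewrite Rminus_0_r Rmult_1_r.
have -> : c 1 = (s, x).
  by rewrite /c; congr pair; [rewrite Rmult_1_l; exact: Rplus_minus | modular_in W].
have -> : c 0 = (t, u t).
  by rewrite /c; congr pair; [rewrite Rmult_0_l; exact: Rplus_0_r | modular_in W].
apply=> r hr.
- apply: (has_deriv_comp (V := V) (c := c) (D := in_slab) (g := fun p => Df p w)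
    (l := fun v => D2f (c r) v w)) => //.
    have [_ [lin _]] := hlin _ (hc r hr); split=> // e e0.
    have n0 := norm_ge_0 w.
    have p : 0 < e / (norm w + 1) by apply: Rdiv_lt_0_compat; lra.
    have /within_eps [d1 [d10 h1]] := hD2 _ (hc r hr) (mkposreal _ p).
    exists d1; split=> // y Dy hy; apply: Rle_trans (h1 y Dy hy w) _ => /=.
    have qm := Rmult_le_pos _ _ (Rlt_le _ _ p) (norm_ge_0 (minus y (c r))).
    have E : e = e / (norm w + 1) * (norm w + 1) by field; lra.
    by rewrite [X in _ <= X * _]E; lra.
  by apply: has_deriv_pair; [apply: has_deriv_lin | apply: has_deriv_affine].
- apply: Rle_trans (hd _ _ (hc r hr) _ _ _) _.
    have k1 := segment_dist (u t) x (u (t + r * (s - t))) hr.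
    have k2 := u_lip (hc r hr) ht.
    apply: Rle_trans k1 _.
    have k3 : Rabs (t - (t + r * (s - t))) <= Rabs (s - t).
      have -> : t - (t + r * (s - t)) = - (r * (s - t)) by ring.
      rewrite Rabs_Ropp Rabs_mult (Rabs_pos_eq r); last lra.
      have := Rabs_pos (s - t); nra.
    have k4 : Bu * Rabs (t - (t + r * (s - t))) <= Bu * (d / (1 + Bu)).
      by apply: Rmult_le_compat_l => //; rewrite /= in k3; lra.
    have k5 : Bu * (d / (1 + Bu)) + d / (1 + Bu) = d by field; lra.
    rewrite /= in k2 *; lra.
  apply: Rmult_le_compat_r; first exact: norm_ge_0.
  apply: Rmult_le_compat_l; first lra.
  exact: (proj2 (proj2 (norm_pairR _ _))).
Qed.

(** The increment is taken at time [s] but the derivative is frozen at [(t, u t)], so that all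
    stages of one step share the same Jacobian; freezing costs the term [Rabs (s - t)]. *)
Lemma tube_taylor : exists d L, 0 < d /\ 0 <= L /\ forall t s x, time T t -> time T s ->
  Rabs (s - t) <= d -> norm (minus x (u s)) <= d ->
  norm (minus (minus (f s x) (f s (u s))) (Df (t, u t) (0, minus x (u s))))
    <= L * (Rabs (s - t) + norm (minus x (u s))) * norm (minus x (u s)).
Proof.
have [d [L [d0 [L0 h]]]] := tube_Df_lipschitz; have b0 := Bu_ge0.
have p : 0 < d / (1 + Bu) by apply: Rdiv_lt_0_compat; lra.
have pd : Bu * (d / (1 + Bu)) + d / (1 + Bu) = d by field; lra.
have bp : 0 <= Bu * (d / (1 + Bu)) by apply: Rmult_le_pos; lra.
exists (d / (1 + Bu)), (L * (1 + Bu)); split=> //; split; first by apply: Rmult_le_pos; lra.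
move=> t s x ht hs hst hx.
apply: C1_segment => // r hr.
have k1 := segment_dist (u s) x (u t) hr.
have k2 := u_lip ht hs.
have k3 : Bu * Rabs (s - t) <= Bu * (d / (1 + Bu)) by apply: Rmult_le_compat_l.
apply: Rle_trans (h t s _ ht hs _ _ _) _; [lra | lra |].
have -> : norm ((0, minus x (u s)) : V) = norm (minus x (u s)).
  apply: Rle_antisym; last exact: (proj1 (proj2 (norm_pairR _ _))).
  by apply: Rle_trans (proj2 (proj2 (norm_pairR _ _))) _; rewrite Rabs_R0; lra.
apply: Rmult_le_compat_r; first exact: norm_ge_0.
rewrite Rmult_assoc; apply: Rmult_le_compat_l => //.
have := norm_ge_0 (minus x (u s)); have := Rabs_pos (s - t) => q1 q2.
nra.
Qed.

Variable u'' : R -> W.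
Hypothesis hu' : forall t, time T t -> has_deriv 0 T u' t (u'' t).
Variable Bu' : R.
Hypothesis hBu' : forall t, time T t -> norm (u'' t) <= Bu'.

(** The derivative of [comp_src] varies through its base point, which [tube_Df_lipschitz] controls,
    and through the direction [u'], which is Lipschitz because [u''] is bounded. It is thus
    Lipschitz at [t], and [taylor1] applies. *)
Lemma comp_src_taylor : exists d L, 0 < d /\ 0 <= L /\ forall t s, time T t -> time T s ->
  t <= s -> s - t <= d ->
  norm (minus (minus (comp_src s) (comp_src t)) (scal (s - t) (comp_src' t))) <= L * (s - t) ^ 2.
Proof.
have [d [L [d0 [L0 h]]]] := tube_Df_lipschitz; have b0 := Bu_ge0.
have [d1 [d10 h1]] := tube_Df.
have i0 : 0 < / d1 by apply: Rinv_0_lt_compat.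
have b1 : 0 <= Bu' by apply: Rle_trans (norm_ge_0 (u'' 0)) (hBu' _); split; lra.
have p : 0 < d / (1 + Bu) by apply: Rdiv_lt_0_compat; lra.
have pd : Bu * (d / (1 + Bu)) + d / (1 + Bu) = d by field; lra.
exists (d / (1 + Bu)), (L * (1 + Bu) * (1 + Bu) + / d1 * Bu'); split=> //.
split.
  by apply: Rplus_le_le_0_compat; repeat (apply: Rmult_le_pos; try lra).
move=> t s [t1 t2] [s1 s2] ts hst.
apply: taylor1 => // [|r hr|r hr].
- by apply: Rplus_le_le_0_compat; repeat (apply: Rmult_le_pos; try lra).
- apply: (has_deriv_sub (a := 0) (b := T)) => //; apply: comp_src_deriv; split; lra.
have ht : time T t by split.
have hrT : time T r by split; lra.
rewrite /comp_src'.
apply: Rle_trans (norm_minus_triangle (Df (r, u r) (1, u' t)) _ _) _.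
have lin := proj1 (proj1 hf (r, u r) hrT).
rewrite -(is_linear_minus (V := V) _ _ lin).
have k1 : norm (Df (r, u r) (minus ((1, u' r) : V) (1, u' t))) <= / d1 * (Bu' * (r - t)).
  apply: Rle_trans (h1 _ _ hrT _ _) _; first by rewrite norm_minus_diag; lra.
  apply: Rmult_le_compat_l; first lra.
  apply: Rle_trans (proj2 (proj2 (norm_pairR _ _))) _.
  have -> : plus 1 (opp 1) = 0 by rewrite /plus /opp /=; ring.
  rewrite Rabs_R0 Rplus_0_l.
  have := bounded_deriv_lip hu' hBu' ht hrT; rewrite Rabs_pos_eq //; lra.
have k0 := u_lip ht hrT; rewrite (Rabs_pos_eq (r - t)) in k0; last lra.
have k2 : norm (minus (Df (r, u r) (1, u' t)) (Df (t, u t) (1, u' t)))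
    <= L * ((1 + Bu) * (r - t)) * (1 + Bu).
  have k3 : Bu * (r - t) <= Bu * (d / (1 + Bu)) by apply: Rmult_le_compat_l; lra.
  have k4 : 0 <= Bu * (r - t) by apply: Rmult_le_pos; lra.
  have E : Rabs (r - t) = r - t by apply: Rabs_pos_eq; lra.
  apply: Rle_trans (h t r _ ht hrT _ _ _) _; [lra | lra | rewrite E].
  apply: Rmult_le_compat; [| exact: norm_ge_0 | |].
  - by apply: Rmult_le_pos => //; have := norm_ge_0 (minus (u r) (u t)); lra.
  - by apply: Rmult_le_compat_l => //; lra.
  - apply: Rle_trans (proj2 (proj2 (norm_pairR _ _))) _.
    by rewrite Rabs_R1; have := hBu ht; lra.
rewrite Rmult_plus_distr_r.
rewrite Rplus_comm; apply: Rplus_le_compat; first by apply: Rle_trans k2 _; apply: Req_le; ring.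
by apply: Rle_trans k1 _; apply: Req_le; ring.
Qed.

End AlongCurve.

(** * Matrix functions *)

HB.instance Definition _ :=
  Monoid.isComLaw.Build C (RtoC 0) Cplus Cplus_assoc Cplus_comm Cplus_0_l.

Lemma sum_n_bigC (f : nat -> C) n : sum_n f n = \big[Cplus/RtoC 0]_(p < n.+1) f p.
Proof.
elim: n => [|n IH]; first by rewrite sum_O big_ord_recr big_ord0 /= Cplus_0_l.
by rewrite sum_Sn IH [RHS]big_ord_recr.
Qed.

Lemma is_series_bigC (I : Type) (r : seq I) (a : I -> nat -> C) (s : I -> C) :
  (forall l, is_series (V := C_NormedModule) (a l) (s l)) ->
  is_series (V := C_NormedModule) (fun m => \big[Cplus/RtoC 0]_(l <- r) a l m)
    (\big[Cplus/RtoC 0]_(l <- r) s l).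
Proof.
move=> h; elim: r => [|l r IH].
  rewrite big_nil; apply: (filterlim_ext (fun=> RtoC 0)) => [n|]; last exact: filterlim_const.
  elim: n => [|n IH]; first by rewrite sum_O big_nil.
  by rewrite sum_Sn -IH big_nil /plus /= Cplus_0_l.
rewrite big_cons; apply: (is_series_ext (V := C_NormedModule) _ _ _ _
  (is_series_plus (V := C_NormedModule) _ _ _ _ (h l) IH)) => m.
by rewrite big_cons.
Qed.

Section MatrixApplication.
Variable N : nat.
Notation MRing := (@matrix_Ring C_Ring N).
Implicit Types (A M : @matrix C N N) (v w : Cvec N).

Lemma mxapp_plus A v w : mxapp A (plus v w) = plus (mxapp A v) (mxapp A w).
Proof.
apply: functional_extensionality => i.
change (mxapp A (plus v w) i = Cplus (mxapp A v i) (mxapp A w i)).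
rewrite /mxapp -big_split /=.
by apply: eq_bigr => j _; rewrite /plus /= /vec_plus /plus /=; ring.
Qed.

Lemma mxapp_scal A (l : C_AbsRing) v : mxapp A (scal l v) = scal l (mxapp A v).
Proof.
apply: functional_extensionality => i.
change (mxapp A (scal l v) i = Cmult l (mxapp A v i)); rewrite /mxapp.
rewrite (big_morph (Cmult l) (id1 := RtoC 0) (op1 := Cplus)) => [|x y|]; try ring.
by apply: eq_bigr => j _; rewrite /scal /= /vec_scal /mult /=; ring.
Qed.

Lemma mxapp_opp A v : mxapp A (opp v) = opp (mxapp A v).
Proof. by rewrite -(scal_opp_one v) -(scal_opp_one (mxapp A v)) mxapp_scal. Qed.

Lemma mxapp_minus A v w : mxapp A (minus v w) = minus (mxapp A v) (mxapp A w).
Proof. by rewrite /minus mxapp_plus mxapp_opp. Qed.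

Lemma mxapp_zero A : mxapp A zero = zero.
Proof. by rewrite -(minus_eq_zero (zero : Cvec N)) mxapp_minus !minus_eq_zero. Qed.

Lemma mxapp_addmx A M v : mxapp (plus (A : MRing) M) v = plus (mxapp A v) (mxapp M v).
Proof.
apply: functional_extensionality => i.
change (mxapp (plus (A : MRing) M) v i = Cplus (mxapp A v i) (mxapp M v i)).
rewrite /mxapp -big_split /=.
apply: eq_bigr => j _; rewrite /Mplus coeff_mat_bij; last 2 first.
- exact/ltP/ltn_ord.
- exact/ltP/ltn_ord.
exact: Cmult_plus_distr_r.
Qed.

Lemma mxapp_mxscale (l : C_AbsRing) M v : mxapp (mxscale l M) v = scal l (mxapp M v).
Proof.
apply: functional_extensionality => i.
change (mxapp (mxscale l M) v i = Cmult l (mxapp M v i)); rewrite /mxapp.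
rewrite (big_morph (Cmult l) (id1 := RtoC 0) (op1 := Cplus)) => [|x y|]; try ring.
apply: eq_bigr => j _; rewrite /mxscale coeff_mat_bij; last 2 first.
- exact/ltP/ltn_ord.
- exact/ltP/ltn_ord.
exact/esym/Cmult_assoc.
Qed.

Lemma mxapp_mult A M v : mxapp (mult (A : MRing) M) v = mxapp A (mxapp M v).
Proof.
apply: functional_extensionality => i.
rewrite /mxapp.
rewrite (eq_bigr (fun j : 'I_N => \big[Cplus/RtoC 0]_(p < N)
  Cmult (Cmult (coeff_mat zero A i p) (coeff_mat zero M p j)) (v j))); last first.
  move=> j _; rewrite {1}/mult /= /Mmult coeff_mat_bij; last 2 first.
  - exact/ltP/ltn_ord.
  - exact/ltP/ltn_ord.
  rewrite sum_n_bigC.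
  have -> : (Nat.pred N).+1 = N by apply: prednK; apply: leq_ltn_trans (ltn_ord i).
  rewrite (big_morph (fun x => Cmult x (v j)) (id1 := RtoC 0) (op1 := Cplus)) => [//|x y|]; ring.
rewrite exchange_big /=; apply: eq_bigr => p _.
rewrite (big_morph (Cmult (coeff_mat zero A i p)) (id1 := RtoC 0) (op1 := Cplus)) => [|x y|]; try ring.
by apply: eq_bigr => j _; first [exact: Cmult_assoc | exact/esym/Cmult_assoc].
Qed.

Lemma coeff_mat_one i j : (i < N)%coq_nat -> (j < N)%coq_nat ->
  coeff_mat zero (one : MRing) i j = if i == j then RtoC 1 else RtoC 0.
Proof.
move=> hi hj; rewrite /one /= /Mone coeff_mat_bij //.
by elim: i j {hi hj} => [|i IH] [|j] //=; rewrite IH eqSS.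
Qed.

Lemma mxapp_one v : mxapp (one : MRing) v = v.
Proof.
apply: functional_extensionality => i; rewrite /mxapp (bigD1 i) //=.
rewrite coeff_mat_one; try exact/ltP/ltn_ord.
rewrite eqxx big1 => [|j ne]; first by ring.
rewrite coeff_mat_one; try exact/ltP/ltn_ord.
have -> : (i == j :> nat) = false by rewrite eq_sym; apply/eqP => /ord_inj /eqP; rewrite (negbTE ne).
by ring.
Qed.

Lemma mxapp_pow M m v : mxapp (pow_n (M : MRing) m) v = iter m (mxapp M) v.
Proof. by elim: m => /= [|m IH]; [exact: mxapp_one | rewrite mxapp_mult IH]. Qed.

Lemma iter_mxscale (l : C_AbsRing) M m v :
  iter m (mxapp (mxscale l M)) v = scal (pow_n l m) (iter m (mxapp M) v).
Proof.
elim: m => /= [|m ->]; first by rewrite scal_one.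
by rewrite mxapp_mxscale mxapp_scal scal_assoc.
Qed.

Lemma phimx_app_series M j v i : is_series (V := C_NormedModule)
  (fun m => Cmult (RtoC (/ INR (fact (m + j)))) (iter m (mxapp M) v i))
  (mxapp (phimx j M) v i).
Proof.
apply: (is_series_ext (V := C_NormedModule) (fun m => \big[Cplus/RtoC 0]_(l < N)
   Cmult (Cmult (RtoC (/ INR (fact (m + j)))) (coeff_mat zero (pow_n (M : MRing) m) i l)) (v l))).
  move=> m; rewrite -mxapp_pow /mxapp.
  rewrite (big_morph (Cmult (RtoC (/ INR (fact (m + j))))) (id1 := RtoC 0) (op1 := Cplus)) => [|x y|]; try ring.
  by apply: eq_bigr => l _; first [exact: Cmult_assoc | exact/esym/Cmult_assoc].
apply: is_series_bigC => l.
have h := phimx_series (M := M) (j := j) (ltP (ltn_ord i)) (ltP (ltn_ord l)).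
rewrite Cmult_comm; apply: (is_series_ext (V := C_NormedModule) _ _ _ _
  (is_series_scal (V := C_NormedModule) (v l) _ _ h)) => m.
by rewrite /scal /= /mult /=; ring.
Qed.

Arguments phimx_app_series : clear implicits.

(** Both sides are sums of the same scalar series in each component, and [CSeries] identifies the
    sums. *)
Lemma phimx_app_comm M j v : mxapp (phimx j M) (mxapp M v) = mxapp M (mxapp (phimx j M) v).
Proof.
apply: functional_extensionality => i.
have h1 := phimx_app_series M j (mxapp M v) i.
have h2 : is_series (V := C_NormedModule)
   (fun m => Cmult (RtoC (/ INR (fact (m + j)))) (iter m (mxapp M) (mxapp M v) i))
   (mxapp M (mxapp (phimx j M) v) i).
  apply: (is_series_ext (V := C_NormedModule) (fun m => \big[Cplus/RtoC 0]_(l < N)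
    Cmult (coeff_mat zero M i l) (Cmult (RtoC (/ INR (fact (m + j)))) (iter m (mxapp M) v l)))).
    move=> m; rewrite -iterSr /= {3}/mxapp.
    rewrite (big_morph (Cmult (RtoC (/ INR (fact (m + j))))) (id1 := RtoC 0) (op1 := Cplus)) => [|x y|]; try ring.
    by apply: eq_bigr => l _; rewrite !Cmult_assoc; congr Cmult; exact: Cmult_comm.
  apply: is_series_bigC => l.
  exact: (is_series_scal (V := C_NormedModule) _ _ _ (phimx_app_series M j v l)).
by rewrite -(CSeries_unique h1) -(CSeries_unique h2).
Qed.

Lemma phimx_app_rec M j v :
  mxapp (phimx j M) v =
  plus (mxapp M (mxapp (phimx j.+1 M) v)) (scal (RtoC (/ INR (fact j)) : C_AbsRing) v).
Proof. by rewrite -phimx_rec mxapp_addmx mxapp_mult mxapp_mxscale mxapp_one. Qed.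

End MatrixApplication.

Arguments phimx_app_series {N} M j v i.

(** Multiplication by [t ^ j] turns the coefficient 1/(m+j)! of t^m into that of t^(m+j) in an
    exponential series, so termwise differentiation lowers [j] by one. The shifted coefficients [co]
    encode this. *)
Lemma is_derive_phi_series (a : nat -> R) (s : nat -> R -> R) :
  (forall j t, is_series (fun m => / INR (fact (m + j)) * (t ^ m * a m)) (s j t)) ->
  forall j t, is_derive (fun t => t ^ j.+1 * s j.+1 t) t (t ^ j * s j t).
Proof.
move=> h j t.
pose co (j : nat) := PS_incr_n (fun m => / INR (fact (m + j)) * a m) j.
have ps q r : is_pseries (co q) r (r ^ q * s q r).
  have -> : r ^ q * s q r = scal (pow_n r q) (s q r) by rewrite pow_n_pow.
  apply: is_pseries_incr_n; apply: is_series_ext (h q r) => m.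
  by rewrite pow_n_pow /scal /= /mult /=; ring.
(* Convergence at every real point excludes a finite radius: just outside the disk the terms could
   not tend to 0. *)
have rad : CV_radius (co j.+1) = p_infty.
  apply: NNPP => ne.
  have [r hr] : exists r : R, Rbar_lt (CV_radius (co j.+1)) (Rabs r).
    case E : (CV_radius (co j.+1)) ne => [l||] // _; last by exists 0.
    exists (Rabs l + 1); have h1 := Rle_abs l; have h2 := Rabs_pos l.
    by rewrite /= (Rabs_pos_eq (Rabs l + 1)); lra.
  apply: (CV_disk_outside _ _ hr).
  apply: ex_series_lim_0; exists (r ^ j.+1 * s j.+1 r).
  apply: is_series_ext (ps j.+1 r) => m.
  by rewrite pow_n_pow /scal /= /mult /=; ring.
have -> : t ^ j * s j t = PSeries (PS_derive (co j.+1)) t.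
  rewrite -(is_pseries_unique _ _ _ (ps j t)); apply: PSeries_ext => n.
  rewrite /PS_derive /co !PS_incr_n_simplify.
  case: (Compare_dec.le_lt_dec j n) => h1; case: (Compare_dec.le_lt_dec j.+1 n.+1) => h2; try lia.
    have -> : (n.+1 - j.+1)%coq_nat = (n - j)%coq_nat by lia.
    have -> : (n - j + j.+1)%N = n.+1 by rewrite -[RHS](Nat.sub_add j.+1 n.+1) //; lia.
    have -> : (n - j + j)%N = n by exact: Nat.sub_add.
    rewrite fact_simpl mult_INR; field.
    by split; [apply: INR_fact_neq_0 | apply: not_0_INR].
  by rewrite /zero /= Rmult_0_r.
apply: (is_derive_ext (PSeries (co j.+1))) => [r|]; first exact: is_pseries_unique.
by apply: is_derive_PSeries; rewrite rad.
Qed.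

Lemma is_derive_eps (f : R -> R) t l e : is_derive f t l -> 0 < e ->
  exists d, 0 < d /\ forall r, Rabs (r - t) < d ->
    Rabs (f r - f t - (r - t) * l) <= e * Rabs (r - t).
Proof.
move=> [_ h] e0.
have /(_ (mkposreal e e0)) [d hd] := h t (fun P hP => hP).
by exists d; split; [exact: cond_pos | move=> r hr; apply: hd].
Qed.

Lemma Cmod_le_Rabs (z : C) : Cmod z <= Rabs (Re z) + Rabs (Im z).
Proof.
have -> : z = Cplus (RtoC (Re z)) (Cmult Ci (RtoC (Im z))).
  by case: z => x y; rewrite /Cplus /Cmult /=; congr pair; ring.
apply: Rle_trans (Cmod_triangle _ _) _.
rewrite Cmod_mult !Cmod_R.
have -> : Cmod Ci = 1.
  by rewrite /Cmod /=; have -> : 0 * (0 * 1) + 1 * (1 * 1) = 1 by [ring]; apply: sqrt_1.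
rewrite /Re /Im /=; apply: Req_le; congr (Rabs _ + _); first by ring.
by rewrite Rmult_1_l; congr Rabs; ring.
Qed.

Lemma is_series_ReIm (a : nat -> C) l : is_series (V := C_NormedModule) a l ->
  is_series (fun m => Re (a m)) (Re l) /\ is_series (fun m => Im (a m)) (Im l).
Proof.
move=> h.
have e n : (sum_n (fun m => Re (a m)) n, sum_n (fun m => Im (a m)) n) = sum_n a n.
  elim: n => [|n IH]; first by rewrite !sum_O; case: (a O).
  by rewrite !sum_Sn -IH.
split; [apply: (filterlim_ext (fun n => Re (sum_n a n))) => [n|]; first by rewrite -e
  | apply: (filterlim_ext (fun n => Im (sum_n a n))) => [n|]; first by rewrite -e].
- move=> P [eps heps]; apply: (h (fun z => P (Re z))).
  by exists eps => z [h1 _]; apply: heps.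
- move=> P [eps heps]; apply: (h (fun z => P (Im z))).
  by exists eps => z [_ h1]; apply: heps.
Qed.

(** * Contractivity of the functions phi_j of a matrix *)

Section PhiBound.
Variables (N : nat) (M : @matrix C N N).
Notation Phi j t := (mxapp (phimx j (mxscale (RtoC t) M))).

(** Real and imaginary parts of a component are separate real power series in [t], each
    differentiated termwise; half of the tolerance goes to each part. *)
Lemma phi_component_deriv (v : Cvec N) (i : 'I_N) j t a b :
  has_deriv (W := realify C_NormedModule) a b
    (fun t => Cmult (RtoC (t ^ j.+1)) (Phi j.+1 t v i)) t (Cmult (RtoC (t ^ j)) (Phi j t v i)).
Proof.
pose x m := iter m (mxapp M) v i.
have ser q r : is_series (V := C_NormedModule)
    (fun m => Cmult (RtoC (/ INR (fact (m + q)))) (Cmult (RtoC (r ^ m)) (x m)))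
    (Phi q r v i).
  apply: is_series_ext (phimx_app_series (mxscale (RtoC r) M) q v i) => m.
  rewrite iter_mxscale {1}/scal /= /vec_scal.
  have -> : pow_n (RtoC r : C_AbsRing) m = RtoC (r ^ m).
    by elim: m => //= m ->; rewrite RtoC_mult.
  by [].
have sRe q r : is_series (fun m => / INR (fact (m + q)) * (r ^ m * Re (x m))) (Re (Phi q r v i)).
  apply: is_series_ext (proj1 (is_series_ReIm (ser q r))) => m.
  by rewrite /Re /Cmult /RtoC /=; ring.
have sIm q r : is_series (fun m => / INR (fact (m + q)) * (r ^ m * Im (x m))) (Im (Phi q r v i)).
  apply: is_series_ext (proj2 (is_series_ReIm (ser q r))) => m.
  by rewrite /Im /Cmult /RtoC /=; ring.
have dRe e e0 := is_derive_eps (e := e) (is_derive_phi_series sRe j t) e0.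
have dIm e e0 := is_derive_eps (e := e) (is_derive_phi_series sIm j t) e0.
move=> e e0.
have [|d1 [d10 h1]] := dRe (e / 2) _; first lra.
have [|d2 [d20 h2]] := dIm (e / 2) _; first lra.
exists (Rmin d1 d2); split; first exact: Rmin_pos.
move=> r _ hr.
have k1 := h1 r (Rlt_le_trans _ _ _ hr (Rmin_l _ _)).
have k2 := h2 r (Rlt_le_trans _ _ _ hr (Rmin_r _ _)).
set z := minus _ _; apply: Rle_trans (Cmod_le_Rabs z) _.
have -> : e * Rabs (r - t) = e / 2 * Rabs (r - t) + e / 2 * Rabs (r - t) by field.
apply: Rplus_le_compat.
- apply: Rle_trans k1; apply: Req_le; congr Rabs.
  by rewrite /z /minus /plus /opp /scal /= /rscal /scal /= /mult /Re /=; ring.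
- apply: Rle_trans k2; apply: Req_le; congr Rabs.
  by rewrite /z /minus /plus /opp /scal /= /rscal /scal /= /mult /Im /=; ring.
Qed.

Lemma phi_bound : (forall t v, 0 <= t -> norm (Phi 0 t v) <= norm v) ->
  forall j t v, 0 <= t -> norm (Phi j t v) <= norm v.
Proof.
move=> h0; elim=> [//|j IH] t v t0.
(* The mean value bound must be divided by [t ^ j.+1]; at [t = 0] the recursion instead leaves [v]
   divided by (j+1)!. *)
case: (Req_dec t 0) => [->|tn].
  rewrite phimx_app_rec mxapp_mxscale (scal_zero_l (K := C_AbsRing)) plus_zero_l.
  apply: Rle_trans (norm_scal _ _) _; rewrite -[X in _ <= X]Rmult_1_l.
  apply: Rmult_le_compat_r; first exact: norm_ge_0.
  have -> : abs (RtoC (/ INR (fact j.+1)) : C_AbsRing) = Rabs (/ INR (fact j.+1)) by exact: Cmod_R.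
  rewrite Rabs_pos_eq; last by apply: Rlt_le; apply: Rinv_0_lt_compat; apply: INR_fact_lt_0.
  rewrite -Rinv_1; apply: Rinv_le_contravar; first lra.
  by rewrite -INR_1; apply: le_INR; apply: lt_O_fact.
apply: maxnorm_lub => [|i]; first exact: norm_ge_0.
have tp : 0 < t ^ j.+1 by apply: pow_lt; lra.
apply: (Rmult_le_reg_l (t ^ j.+1)) => //.
have := mean_value (W := realify C_NormedModule)
  (phi := fun t => Cmult (RtoC (t ^ j.+1)) (Phi j.+1 t v i))
  (phi' := fun t => Cmult (RtoC (t ^ j)) (Phi j t v i)) (a := 0) (b := t) (B := t ^ j * norm v) t0
  (fun s _ => phi_component_deriv _ _ _ _ _ _).
have normE (z : C) : norm (z : realify C_NormedModule) = Cmod z by [].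
have -> : minus (Cmult (RtoC (t ^ j.+1)) (Phi j.+1 t v i)) (Cmult (RtoC (0 ^ j.+1)) (Phi j.+1 0 v i))
   = Cmult (RtoC (t ^ j.+1)) (Phi j.+1 t v i) :> realify C_NormedModule.
  by rewrite /minus /plus /opp /= Rmult_0_l; ring.
have -> : norm (Cmult (RtoC (t ^ j.+1)) (Phi j.+1 t v i) : realify C_NormedModule)
   = t ^ j.+1 * abs (Phi j.+1 t v i).
  rewrite normE Cmod_mult Cmod_R Rabs_pos_eq //; lra.
move=> h; apply: Rle_trans (h _) _; last by rewrite Rminus_0_r /=; apply: Req_le; ring.
move=> s hs; rewrite normE Cmod_mult Cmod_R.
apply: Rmult_le_compat; [exact: Rabs_pos | exact: Cmod_ge_0 | |].
  by rewrite Rabs_pos_eq; [apply: pow_incr | apply: pow_le; lra].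
by apply: Rle_trans (maxnorm_ub _ i) (IH s v _); lra.
Qed.

End PhiBound.

(** * Extension of grid functions *)

(** For mutual distances [a] of the nodes, balls of radius [/ r] around different nodes have
    disjoint interiors. *)
Lemma exists_scaling (I : finType) (a : I -> R) : (forall i, 0 < a i) ->
  exists r, 0 < r /\ forall i, 2 <= r * a i.
Proof.
move=> a0.
suff [r [r0 h]] : exists r, 0 < r /\ forall i, i \in index_enum I -> 2 <= r * a i.
  by exists r; split=> // i; apply: h; apply: mem_index_enum.
elim: (index_enum I) => [|j l [r [r0 h]]]; first by exists 1; split; [lra | move=> i].
have p : 0 < 2 / a j by apply: Rdiv_lt_0_compat; [lra | apply: a0].
exists (r + 2 / a j); split=> [|i]; first lra.
rewrite in_cons Rmult_plus_distr_r => /orP [/eqP -> | /h k].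
  have -> : 2 / a j * a j = 2 by field; have := a0 j; lra.
  have := Rmult_lt_0_compat _ _ r0 (a0 j); lra.
have := Rmult_lt_0_compat _ _ p (a0 i); lra.
Qed.

Section GridExtension.
Variables (d : nat) (Om : Rvec d -> Prop).

(** The tent function of height 1 and radius [/ r] centred at [p]. *)
Definition bump (r : R) (p : Rvec d) (x : clos Om) : R := Rmax 0 (1 - r * norm (minus (sval x) p)).

Lemma bump_range r p x : 0 < r -> 0 <= bump r p x <= 1.
Proof.
move=> r0; split; first exact: Rmax_l.
apply: Rmax_lub; first lra.
have := Rmult_le_pos _ _ (Rlt_le _ _ r0) (norm_ge_0 (minus (sval x) p)); lra.
Qed.

Lemma bump_lipschitz r p x y : 0 < r ->
  Rabs (bump r p y - bump r p x) <= r * norm (minus (sval y) (sval x)).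
Proof.
move=> r0; rewrite /bump.
have h1 : r * norm (minus (sval y) p) <= r * (norm (minus (sval y) (sval x)) + norm (minus (sval x) p)).
  by apply: Rmult_le_compat_l; [lra | apply: norm_minus_triangle].
have h2 : r * norm (minus (sval x) p) <= r * (norm (minus (sval y) (sval x)) + norm (minus (sval y) p)).
  apply: Rmult_le_compat_l; first lra.
  by rewrite (norm_minus_sym (sval y) (sval x)); apply: norm_minus_triangle.
have h3 := Rmult_le_pos _ _ (Rlt_le _ _ r0) (norm_ge_0 (minus (sval y) (sval x))).
rewrite /Rmax; case: Rle_dec; case: Rle_dec => *; apply: Rabs_le; lra.
Qed.

Lemma bump_cont r p x : 0 < r ->
  filterlim (fun y => RtoC (bump r p y)) (clos_nbhs x) (locally (RtoC (bump r p x))).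
Proof.
move=> r0 P [eps hP]; rewrite /filtermap /clos_nbhs.
have q : 0 < eps / r by apply: Rdiv_lt_0_compat => //; apply: cond_pos.
exists (mkposreal _ q) => y hy hcl; apply: hP; split; last first.
  by rewrite /= /ball /= /AbsRing_ball minus_eq_zero abs_zero; apply: cond_pos.
apply: Rle_lt_trans (bump_lipschitz p x (exist _ y hcl) r0) _ => /=.
have {}hy : norm (minus y (sval x)) < eps / r := hy.
have -> : pos eps = r * (eps / r) by field; lra.
exact: Rmult_lt_compat_l.
Qed.

Lemma bump_bdd r p : 0 < r -> exists M, forall x, Cmod (RtoC (bump r p x)) <= M.
Proof.
move=> r0; exists 1 => x; rewrite Cmod_R Rabs_pos_eq; have := bump_range p x r0; lra.
Qed.

(** A combination of tents with disjoint supports: at each point at most one summand is nonzero, so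
    the norm does not grow, whatever the number and spacing of the nodes. *)
Lemma grid_extension N (g : 'I_N -> clos Om) (v : Cvec N) : injective g ->
  exists x : cfun Om, (forall i, x (g i) = v i) /\ norm x <= norm v.
Proof.
move=> inj.
(* The value 1 on the diagonal is a dummy keeping the family positive. *)
have [|r [r0 hr]] := @exists_scaling _ (fun ij : 'I_N * 'I_N =>
    if ij.1 == ij.2 then 1 else norm (minus (sval (g ij.1)) (sval (g ij.2)))).
  case=> i j /=; case: eqP => ne; first lra.
  have [//|h] := Rle_lt_or_eq_dec _ _ (norm_ge_0 (minus (sval (g i)) (sval (g j)))).
  case: ne; apply: inj.
  have /norm_eq_zero e := esym h.
  have {}e : sval (g i) = sval (g j).
    by rewrite -(plus_zero_l (sval (g j))) -e /minus -plus_assoc plus_opp_l plus_zero_r.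
  case: (g i) (g j) e => x hx [y hy] /= e; subst y.
  by rewrite (proof_irrelevance _ hx hy).
pose b i := Cfun (fun x => @bump_cont r (sval (g i)) x r0) (@bump_bdd r (sval (g i)) r0).
pose F : cfun Om := \big[plus/zero]_(i < N) scal (v i : C_AbsRing) (b i).
have FE x : F x = \big[Cplus/RtoC 0]_(i < N) Cmult (v i) (RtoC (bump r (sval (g i)) x)).
  by rewrite /F (big_morph (fun f : cfun Om => f x) (id1 := RtoC 0) (op1 := Cplus)).
have sep i j x : i != j -> 0 < bump r (sval (g i)) x -> bump r (sval (g j)) x = 0.
  move=> ne hi; have := hr (i, j); rewrite /= (negbTE ne) => h.
  have k : norm (minus (sval (g i)) (sval (g j))) <=
      norm (minus (sval x) (sval (g i))) + norm (minus (sval x) (sval (g j))).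
    have -> : norm (minus (sval x) (sval (g i))) = norm (minus (sval (g i)) (sval x)).
      exact: norm_minus_sym.
    exact: norm_minus_triangle.
  move: hi; rewrite /bump /Rmax; case: Rle_dec => // h1 h2; last lra.
  case: Rle_dec => // h3; exfalso.
  suff : r * norm (minus (sval (g i)) (sval (g j))) < 2 by lra.
  have k2 := Rmult_le_compat_l r _ _ (Rlt_le _ _ r0) k.
  lra.
have one x i : 0 < bump r (sval (g i)) x -> F x = Cmult (v i) (RtoC (bump r (sval (g i)) x)).
  move=> hi; rewrite FE (bigD1 i) //= big1 => [|j ne]; first by ring.
  by rewrite (sep i j) // 1?eq_sym //; ring.
exists F; split=> [i|].
  have h1 : bump r (sval (g i)) (g i) = 1.
    by rewrite /bump minus_eq_zero norm_zero Rmult_0_r Rminus_0_r Rmax_right //; lra.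
  by rewrite (one _ i) h1; [ring | lra].
apply: supnorm_lub => [|x]; first exact: norm_ge_0.
case: (classic (exists i, 0 < bump r (sval (g i)) x)) => [[i hi]|none].
  rewrite (one _ _ hi) Cmod_mult Cmod_R.
  have h := bump_range (sval (g i)) x r0.
  rewrite Rabs_pos_eq; last lra.
  have h2 : Cmod (v i) <= norm v := maxnorm_ub v i.
  have := Cmod_ge_0 (v i); nra.
rewrite FE big1 => [|i _]; first by rewrite Cmod_0; apply: norm_ge_0.
have -> : bump r (sval (g i)) x = 0; last by ring.
have := bump_range (sval (g i)) x r0 => h.
case: (Rle_lt_or_eq_dec 0 (bump r (sval (g i)) x)) => [|h1|//]; first lra.
by case: none; exists i.
Qed.

End GridExtension.

(** * Closedness of generators *)

Section Generator.
Variables (V : NormedModule C_AbsRing) (D : V -> Prop) (A : V -> V) (S : R -> V -> V).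
Notation VR := (realify V).

(** If no negative exponent were admissible, 0 would be a lower bound of the admissible exponents,
    against the negativity of their infimum. For a negative one the exponential factor is at most
    1. *)
Lemma semigroup_type_bound (om : Rbar) : semigroup_type S om -> Rbar_lt om 0 ->
  exists M, 0 <= M /\ forall t x, 0 <= t -> norm (S t x) <= M * norm x.
Proof.
move=> [_ glb] om0; apply: NNPP => none.
suff /glb : is_lb_Rbar (fun w => exists M, forall t x, 0 <= t -> norm (S t x) <= M * exp (w * t) * norm x) 0.
  by move/Rbar_le_not_lt.
move=> w [M hM] /=; case: (Rle_lt_dec 0 w) => // w0; case: none.
exists (Rabs M); split=> [|t x t0]; first exact: Rabs_pos.
apply: Rle_trans (hM t x t0) _; apply: Rmult_le_compat_r; first exact: norm_ge_0.
have e1 : exp (w * t) <= 1.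
  rewrite -exp_0; case: (Req_dec (w * t) 0) => [->|ne]; first exact: Rle_refl.
  apply: Rlt_le; apply: exp_increasing; nra.
have := exp_pos (w * t); have := Rle_abs M; have := Rabs_pos M; nra.
Qed.

Lemma at_right_eps (P : R -> Prop) : at_right 0 P -> exists d, 0 < d /\ forall t, 0 < t < d -> P t.
Proof.
move=> [d hd]; exists d; split; first exact: cond_pos.
move=> t ht; apply: hd; last lra.
rewrite /ball /= /AbsRing_ball /abs /minus /plus /opp /= Ropp_0 Rplus_0_r Rabs_pos_eq; lra.
Qed.

Lemma filterlim_at_right_eps (f : R -> V) l e : filterlim f (at_right 0) (locally l) -> 0 < e ->
  exists d, 0 < d /\ forall t, 0 < t < d -> norm (minus (f t) l) <= e.
Proof.
move=> h e0; apply: at_right_eps; apply: (h (fun z => norm (minus z l) <= e)).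
apply: locally_le_locally_norm; exists (mkposreal e e0) => y; exact: Rlt_le.
Qed.

Hypothesis gen : generates D A S.
Variable M : R.
Hypothesis M0 : 0 <= M.
Hypothesis hM : forall t x, 0 <= t -> norm (S t x) <= M * norm x.

Lemma sgrp_minus t x y : 0 <= t -> S t (minus x y) = minus (S t x) (S t y).
Proof.
move=> t0; case: (gen) => [[lin _] _]; have l := lin t t0.
rewrite /minus (linear_plus _ l) -(scal_opp_one y); congr plus.
exact: eq_trans (linear_scal _ l (opp one) y) (scal_opp_one _).
Qed.

Lemma generator_increment z e : D z -> 0 < e -> exists d, 0 < d /\ forall t, 0 < t < d ->
  norm (minus (minus (S t z) z : VR) (scal t (A z : VR))) <= e * t.
Proof.
move=> Dz e0; case: (gen) => [_ /(_ z (A z)) [/(_ (conj Dz erefl)) lim _]].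
have [d [d0 hd]] := filterlim_at_right_eps lim e0.
exists d; split=> // t ht.
have -> : minus (minus (S t z) z : VR) (scal t (A z : VR)) =
  scal t (minus (scal (/ t) (minus (S t z) z : VR)) (A z : VR)).
  by modular_in (realify V); field; lra.
rewrite norm_scal_eq Rabs_pos_eq; last lra.
by rewrite Rmult_comm; apply: Rmult_le_compat_r; [lra | apply: hd].
Qed.

(** The classical proof writes [S t z - z] as the integral of [S s (A z)] and passes to the limit.
    Here the mean value inequality for [S s z - z - s y] replaces the integral, and the
    approximation error [e'] is sent to 0 afterwards with [t] fixed. *)
Lemma generator_closed x y :
  (forall e, 0 < e -> exists z, D z /\ norm (minus z x) <= e /\ norm (minus (A z) y) <= e) ->
  D x /\ A x = y.
Proof.
move=> approx; case: (gen) => [[lin [S0 [Sadd Sc]]] genE].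
apply/genE => P hP.
have [e he] := @locally_norm_le_locally C_AbsRing V y P hP.
have e2 : 0 < e / 2 by have := cond_pos e; lra.
have := Sc y; move/filterlim_at_right_eps => /(_ _ e2) [d [d0 hd]].
exists (mkposreal d d0) => t ht t0; apply: he.
have {}ht : 0 < t < d.
  split=> //; move: ht; rewrite /ball /= /AbsRing_ball /abs /minus /plus /opp /= Ropp_0 Rplus_0_r.
  by rewrite Rabs_pos_eq; lra.
suff main : norm (minus (minus (S t x) x : VR) (scal t (y : VR))) <= e / 2 * t.
  have E : minus (scal (/ t) (minus (S t x) x : VR)) (y : VR) =
      scal (/ t) (minus (minus (S t x) x : VR) (scal t (y : VR))).
    by modular_in (realify V); field; lra.
  rewrite /ball_norm.
  apply: (Rle_lt_trans _ (norm (minus (scal (/ t) (minus (S t x) x : VR)) (y : VR)))); first exact: Rle_refl.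
  rewrite E norm_scal_eq Rabs_pos_eq; last by apply: Rlt_le; apply: Rinv_0_lt_compat.
  apply: (Rle_lt_trans _ (/ t * (e / 2 * t))).
    by apply: Rmult_le_compat_l => //; apply: Rlt_le; apply: Rinv_0_lt_compat.
  have -> : / t * (e / 2 * t) = e / 2 by field; lra.
  by lra.
(* [M * t] comes from replacing [A z] by [y] over a time [t], [M + 1] from replacing [z] by [x] in
   [S t x - x]. *)
apply: (le_of_le_mul_eps (c := M * t + (M + 1))) => [|e' e'0].
  by have := Rmult_le_pos _ _ M0 (Rlt_le _ _ t0); lra.
have [z [Dz [hz1 hz2]]] := approx e' e'0.
pose phi s : VR := minus (minus (S s z) z : VR) (scal s (y : VR)).
have B0 : norm (minus (phi t) (phi 0)) <= (M * e' + e / 2) * (t - 0).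
  apply: mean_value_right => [|s hs e1 e10|s hs e1 e10]; first lra.
  (* Left continuity at [s] is reduced to right continuity at 0 by [S s z = S r (S (s - r) z)] and
     the uniform bound [M]. *)
  - have p : 0 < e1 / 2 / (M + 1) by apply: Rdiv_lt_0_compat; lra.
    have := Sc z; move/filterlim_at_right_eps => /(_ _ p) [d1 [d10 hd1]].
    have n0 := norm_ge_0 y.
    have p2 : 0 < e1 / 2 / (norm y + 1) by apply: Rdiv_lt_0_compat; lra.
    exists (Rmin d1 (e1 / 2 / (norm y + 1))); split; first exact: Rmin_pos.
    move=> r hr hsr.
    have q1 : s - r < d1 by apply: Rlt_le_trans hsr (Rmin_l _ _).
    have q2 : s - r < e1 / 2 / (norm y + 1) by apply: Rlt_le_trans hsr (Rmin_r _ _).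
    have E : S s z = S r (S (s - r) z).
      by rewrite -Sadd; [congr S; ring | lra | lra].
    have -> : minus (phi r) (phi s) = plus (S r (minus z (S (s - r) z)) : VR) (scal (s - r) (y : VR)).
      by rewrite /phi E sgrp_minus; [modular_in (realify V) | lra].
    apply: Rle_trans (norm_triangle _ _) _.
    have -> : e1 = e1 / 2 / (M + 1) * (M + 1) + e1 / 2 / (norm y + 1) * (norm y + 1) by field; lra.
    apply: Rplus_le_compat.
      apply: (Rle_trans _ (M * norm (minus z (S (s - r) z)))); first by apply: hM; lra.
      rewrite norm_minus_sym; have k := hd1 (s - r).
      have {}k : norm (minus (S (s - r) z) z) <= e1 / 2 / (M + 1) by apply: k; lra.
      have := norm_ge_0 (minus (S (s - r) z) z); nra.
    rewrite norm_scal_eq Rabs_pos_eq; last lra.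
    have -> : norm (y : VR) = norm y by [].
    nra.
  (* The right slope at [s] is [S s (A z - y) + (S s y - y)], at most [M * e' + e / 2] because
     [s < d]. *)
  - have p : 0 < e1 / (M + 1) by apply: Rdiv_lt_0_compat; lra.
    have [d1 [d10 hd1]] := generator_increment Dz p.
    exists d1; split=> // r hr hrt.
    have E : S r z = S s (S (r - s) z).
      by rewrite -Sadd; [congr S; ring | lra | lra].
    have SR w c : S s (scal c (w : VR)) = scal c (S s w : VR).
      have s0 : 0 <= s by lra.
      exact: (linear_scal _ (lin s s0) (RtoC c) w).
    have -> : minus (phi r) (phi s) = plus (S s (minus (minus (S (r - s) z) z : VR) (scal (r - s) (A z : VR))) : VR)
       (scal (r - s) (plus (S s (minus (A z) y) : VR) (minus (S s y) y : VR))).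
      by rewrite /phi E !(sgrp_minus (t := s)) ?SR; [modular_in (realify V) | lra ..].
    apply: Rle_trans (norm_triangle _ _) _.
    have k1 : norm (S s (minus (minus (S (r - s) z) z : VR) (scal (r - s) (A z : VR)))) <= M * (e1 / (M + 1) * (r - s)).
      apply: Rle_trans (hM _ _) _; first lra.
      by apply: Rmult_le_compat_l => //; apply: hd1; lra.
    have k2 : norm (S s (minus (A z) y)) <= M * e'.
      apply: Rle_trans (hM _ _) _; first lra.
      exact: Rmult_le_compat_l.
    have k3 : norm (minus (S s y) y) <= e / 2.
      case: (Req_dec s 0) => [->|ne]; first by rewrite S0 norm_minus_diag; lra.
      by apply: hd; lra.
    have k4 : norm (plus (S s (minus (A z) y) : VR) (minus (S s y) y : VR)) <= M * e' + e / 2.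
      apply: Rle_trans (norm_triangle _ _) _; exact: Rplus_le_compat k2 k3.
    have k5 : M * (e1 / (M + 1) * (r - s)) <= e1 * (r - s).
      rewrite -Rmult_assoc; apply: Rmult_le_compat_r; first lra.
      have E1 : e1 / (M + 1) * (M + 1) = e1 by field; lra.
      lra.
    have k6 := scal_bound (r - s) k4.
    rewrite Rabs_pos_eq in k6; last lra.
    apply: Rle_trans (Rplus_le_compat _ _ _ _ k1 k6) _; lra.
rewrite Rminus_0_r in B0.
have -> : minus (minus (S t x) x : VR) (scal t (y : VR)) =
   plus (minus (phi t) (phi 0)) (minus (S t (minus x z)) (minus x z) : VR).
  by rewrite /phi S0 sgrp_minus; [modular_in (realify V) | lra].
apply: Rle_trans (norm_triangle _ _) _.
have k1 : norm (minus (S t (minus x z)) (minus x z)) <= M * e' + e'.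
  apply: Rle_trans (norm_minus_le _ _) _; rewrite norm_minus_sym in hz1.
  apply: Rplus_le_compat => //; apply: Rle_trans (hM _ _) _; first lra.
  exact: Rmult_le_compat_l.
apply: Rle_trans (Rplus_le_compat _ _ _ _ B0 k1) _; lra.
Qed.

End Generator.

(** * The continuous problem *)

Section Continuous.
Variables (d : nat) (Om : Rvec d -> Prop) (Y : CompleteNormedModule C_AbsRing) (P : ibvp Om Y).
Hypothesis hc : continuous_hyps P.
Notation X := (cfun Om).
Notation XR := (realify (cfun_NormedModule Om)).
Notation YR := (realify Y).
Notation T := (horizon P).
Notation A := (opA P).
Notation u := (sol P).
Notation f := (src P).

Lemma linear_on_minus (U V : NormedModule C_AbsRing) (D : U -> Prop) (L : U -> V) x y :
  subspace D -> linear_on D L -> D x -> D y ->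
  D (minus x y) /\ L (minus x y) = minus (L x) (L y).
Proof.
move=> [_ [sp ss]] [lp ls] Dx Dy.
have Doy : D (opp y) by rewrite -scal_opp_one; apply: ss.
split; first exact: sp.
rewrite /minus lp // -(scal_opp_one y) ls //; congr plus; exact: scal_opp_one.
Qed.

Lemma lift_minus z v w : 0 < Re z -> Defs.lift P z (minus v w) = minus (Defs.lift P z v) (Defs.lift P z w).
Proof.
move=> z0; have [[hv1 [hv2 hv3]] _] := ch_lift hc v z0.
have [[hw1 [hw2 hw3]] _] := ch_lift hc w z0.
have [_ uni] := ch_lift hc (minus v w) z0; apply: uni.
have [h1 h2] := linear_on_minus (ch_domA hc) (ch_opA hc) hv1 hw1.
have [_ h3] := linear_on_minus (ch_domA hc) (ch_bdry hc) hv1 hw1.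
split=> //; rewrite h2 h3 hv2 hw2 hv3 hw3; split=> //.
by rewrite /minus scal_distr_l scal_opp_r.
Qed.

(* Subtracting the lift K(z) of the boundary values reduces to the generator A_0,
   which is closed. *)
Lemma opA_closed x w v :
  (forall e, 0 < e -> exists z, domA P z /\ norm (minus z x) <= e /\
     norm (minus (A z) w) <= e /\ norm (minus (bdry P z) v) <= e) ->
  domA P x /\ A x = w.
Proof.
move=> approx.
have [M [M0 hM]] := semigroup_type_bound (ch_type hc) (ch_negative hc).
have [w0 [C [_ hK]]] := ch_lift_bound hc.
(* A real point in the half-plane where the lift exists and also in the one where it is uniformly
   bounded. *)
pose r := Rmax w0 1; pose z0 := RtoC r.
have r1 : 1 <= r by apply: Rmax_r.
have z1 : 0 < Re z0 by rewrite /z0 /=; lra.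
have {}hK y : norm (Defs.lift P z0 y) <= Rabs C * norm y.
  apply: Rle_trans (hK z0 y z1 (Rmax_l _ _)) _.
  by apply: Rmult_le_compat_r; [apply: norm_ge_0 | apply: Rle_abs].
have [[kv1 [kv2 kv3]] _] := ch_lift hc v z1.
have C0 := Rabs_pos C.
have [|[x1 x2] x3] := generator_closed (ch_generates hc) M0 hM
  (x := minus x (Defs.lift P z0 v)) (y := minus w (scal (z0 : C_AbsRing) (Defs.lift P z0 v))).
  (* The approximation error itself, the lift of the boundary error, and [A] applied to that lift,
     on which it is multiplication by [z0]. *)
  move=> e e0; pose q := 1 + Rabs C + r * Rabs C.
  have q0 : 0 < q.
    rewrite /q; have : 0 <= r * Rabs C by apply: Rmult_le_pos; lra.
    lra.
  have p : 0 < e / q by apply: Rdiv_lt_0_compat.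
  have E : e = e / q * (1 + Rabs C + r * Rabs C) by rewrite -/q; field; lra.
  have rC : 0 <= e / q * (r * Rabs C) by apply: Rmult_le_pos; [lra | apply: Rmult_le_pos; lra].
  have pC : 0 <= e / q * Rabs C by apply: Rmult_le_pos; lra.
  have [z [Dz [hz1 [hz2 hz3]]]] := approx _ p.
  have [[k1 [k2 k3]] _] := ch_lift hc (bdry P z) z1.
  have [D1 A1] := linear_on_minus (ch_domA hc) (ch_opA hc) Dz k1.
  have [_ B1] := linear_on_minus (ch_domA hc) (ch_bdry hc) Dz k1.
  have K1 : norm (minus (Defs.lift P z0 (bdry P z)) (Defs.lift P z0 v)) <= Rabs C * (e / q).
    rewrite -lift_minus //; apply: Rle_trans (hK _) _.
    exact: Rmult_le_compat_l.
  exists (minus z (Defs.lift P z0 (bdry P z))); split.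
    by split=> //; rewrite B1 k3 minus_eq_zero.
  split.
    have -> : minus (minus z (Defs.lift P z0 (bdry P z))) (minus x (Defs.lift P z0 v)) =
      minus (minus z x) (minus (Defs.lift P z0 (bdry P z)) (Defs.lift P z0 v)) by modular_in (realify (cfun_NormedModule Om)).
    apply: Rle_trans (norm_minus_le _ _) _.
    apply: Rle_trans (Rplus_le_compat _ _ _ _ hz1 K1) _; move: (e / q) E rC pC => m; lra.
  have -> : minus (A (minus z (Defs.lift P z0 (bdry P z)))) (minus w (scal (z0 : C_AbsRing) (Defs.lift P z0 v))) =
    minus (minus (A z) w) (scal (z0 : C_AbsRing) (minus (Defs.lift P z0 (bdry P z)) (Defs.lift P z0 v))).
    rewrite A1 k2; apply: (@eq_trans _ _ (minus (minus (A z) w) (minus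
      (scal (z0 : C_AbsRing) (Defs.lift P z0 (bdry P z))) (scal (z0 : C_AbsRing) (Defs.lift P z0 v))))).
      by modular_in (realify (cfun_NormedModule Om)).
    by rewrite /minus scal_distr_l scal_opp_r.
  apply: Rle_trans (norm_minus_le _ _) _.
  have K2 : norm (scal (z0 : C_AbsRing) (minus (Defs.lift P z0 (bdry P z)) (Defs.lift P z0 v))) <= r * (Rabs C * (e / q)).
    apply: Rle_trans (norm_scal _ _) _.
    have -> : abs (z0 : C_AbsRing) = r by rewrite /abs /= Cmod_R Rabs_pos_eq //; lra.
    by apply: Rmult_le_compat_l => //; lra.
  apply: Rle_trans (Rplus_le_compat _ _ _ _ hz2 K2) _; move: (e / q) E rC pC => m; lra.
have -> : x = plus (minus x (Defs.lift P z0 v)) (Defs.lift P z0 v) by modular_in (realify (cfun_NormedModule Om)).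
split; first by apply: (proj1 (proj2 (ch_domA hc))).
rewrite (proj1 (ch_opA hc)) // x3 kv2; modular_in (realify (cfun_NormedModule Om)).
Qed.

(** Closedness is applied to the difference quotients of [u]. Their boundary values are difference
    quotients of [bdata P], so the differentiability of the data makes them converge. *)
Lemma opA_deriv t (u1 w : X) : time T t ->
  has_deriv (W := XR) 0 T u t u1 -> has_deriv (W := XR) 0 T (fun r => A (u r)) t w ->
  domA P u1 /\ A u1 = w.
Proof.
move=> ht h1 h2.
have [g' [hg _]] := ch_bdata hc.
have h3 := deriv_on_has_deriv hg ht.
have T0 := ch_horizon hc.
apply: (opA_closed (v := g' t)) => e e0.
have [d1 [d10 hd1]] := h1 e e0; have [d2 [d20 hd2]] := h2 e e0; have [d3 [d30 hd3]] := h3 e e0.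
have [r [hr [hr0 hr1]]] : exists r, 0 <= r <= T /\ r - t <> 0 /\
    (Rabs (r - t) < d1 /\ Rabs (r - t) < d2 /\ Rabs (r - t) < d3).
  pose m := Rmin (Rmin (Rmin d1 d2) d3) (T / 2).
  have p : 0 < m by repeat apply: Rmin_pos => //; lra.
  have q : m <= T / 2 by apply: Rmin_r.
  have q0 : m <= Rmin (Rmin d1 d2) d3 by apply: Rmin_l.
  have q3 : m <= d3 by apply: Rle_trans q0 (Rmin_r _ _).
  have q00 := Rle_trans _ _ _ q0 (Rmin_l _ _).
  have q1 : m <= d1 by apply: Rle_trans q00 (Rmin_l _ _).
  have q2 : m <= d2 by apply: Rle_trans q00 (Rmin_r _ _).
  case: ht => t1 t2; case: (Rle_lt_dec t (T / 2)) => h.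
    by exists (t + m / 2); have -> : t + m / 2 - t = m / 2 by [ring]; rewrite Rabs_pos_eq; lra.
  by exists (t - m / 2); have -> : t - m / 2 - t = - (m / 2) by [ring]; rewrite Rabs_Ropp Rabs_pos_eq; lra.
have du : domA P (minus (u r) (u t)) /\ A (minus (u r) (u t)) = minus (A (u r)) (A (u t)).
  by apply: linear_on_minus; [exact: ch_domA | exact: ch_opA | exact: ch_sol_dom ..].
have [_ bu] : domA P (minus (u r) (u t)) /\ bdry P (minus (u r) (u t)) = minus (bdry P (u r)) (bdry P (u t)).
  by apply: linear_on_minus; [exact: ch_domA | exact: ch_bdry | exact: ch_sol_dom ..].
case: du => du Au.
have quot (V : NormedModule R_AbsRing) (y v : V) : norm (minus y (scal (r - t) v)) <= e * Rabs (r - t) ->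
    norm (minus (scal (/ (r - t)) y) v) <= e.
  move=> h; have -> : minus (scal (/ (r - t)) y) v = scal (/ (r - t)) (minus y (scal (r - t) v)).
    by modular_in V; field.
  rewrite norm_scal_eq; apply: (Rmult_le_reg_l (Rabs (r - t))); first exact: Rabs_pos_lt.
  by rewrite -Rmult_assoc -Rabs_mult Rinv_r // Rabs_R1 Rmult_1_l Rmult_comm.
exists (scal (RtoC (/ (r - t)) : C_AbsRing) (minus (u r) (u t))).
split; first by apply: (proj2 (proj2 (ch_domA hc))).
split; first by apply: (quot XR); apply: hd1; tauto.
split.
  by rewrite (proj2 (ch_opA hc)) // Au; apply: (quot XR); apply: hd2; tauto.
rewrite (proj2 (ch_bdry hc)) // bu !(ch_bc hc) //.
by apply: (quot YR); apply: hd3; tauto.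
Qed.

Hypothesis hFdom : forall t, time T t -> domA P (f t (u t)).
Hypothesis huD : continuous_D P 2 u.

Definition sol' t : X := plus (A (u t)) (f t (u t)).

Lemma sol_deriv t : time T t -> has_deriv (W := XR) 0 T u t (sol' t).
Proof. exact: (deriv_on_has_deriv (ch_pde hc)). Qed.

(** The regularity hypothesis only provides some derivative [v]; by uniqueness it is the right-hand
    side of the equation on the whole interval. *)
Lemma sol'_deriv v v' : deriv_on XR T u v -> deriv_on XR T v v' ->
  forall t, time T t -> has_deriv (W := XR) 0 T sol' t (v' t).
Proof.
move=> h1 h2 t ht.
apply: (has_deriv_ext (phi := v) ht) => [r hr|]; last exact: deriv_on_has_deriv.
apply: (has_deriv_unique (a := 0) (b := T) (phi := (u : R -> XR)) (ch_horizon hc) hr).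
  exact: deriv_on_has_deriv.
exact: sol_deriv.
Qed.

(** [A u] is differentiable because it equals [u' - f(., u)], a difference of differentiable curves;
    hence [opA_deriv] gives [A u'], which is then split by linearity. *)
Lemma second_derivative v' : (forall t, time T t -> has_deriv (W := XR) 0 T sol' t (v' t)) ->
  forall t, time T t ->
  v' t = plus (plus (A (A (u t))) (A (f t (u t)))) (dsrc P (t, u t) (1, sol' t)).
Proof.
move=> h t ht.
have hF := comp_src_deriv sol_deriv (ch_src hc) ht.
have [dom E] : domA P (sol' t) /\ A (sol' t) = plus (v' t) (opp (dsrc P (t, u t) (1, sol' t))).
  apply: (opA_deriv (t := t)) => //; first exact: sol_deriv.
  apply: (has_deriv_ext (W := XR) (phi := fun r => plus (sol' r : XR) (opp (f r (u r) : XR))) ht).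
    by move=> r hr; rewrite /sol'; modular_in (realify (cfun_NormedModule Om)).
  by apply: has_deriv_plus; [apply: h | apply: has_deriv_opp].
have {}E : v' t = plus (A (sol' t)) (dsrc P (t, u t) (1, sol' t)) by rewrite E; modular_in (realify (cfun_NormedModule Om)).
rewrite E /sol' (proj1 (ch_opA hc)) //; last exact: hFdom.
by case: huD => /(_ t ht) [_ []].
Qed.

End Continuous.

(** * The discrete problem *)

Local Notation "r *: x" := (scal (RtoC r : C_AbsRing) x) (at level 40).

Ltac vmod D h := modular_in (realify (vec_NormedModule C_AbsRing (nodes D h))).

Section VecSums.
Variable N : nat.
Implicit Types (v w : nat -> Cvec N) (x : Cvec N).

Lemma norm_rscal r x : norm (r *: x) = Rabs r * norm x.
Proof. exact: (norm_scal_eq (V := realify (vec_NormedModule C_AbsRing N))). Qed.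

Lemma sum_rscal_const (a : nat -> R) x m n :
  sum_n_m (fun j => a j *: x) m n = (sum_n_m a m n) *: x.
Proof.
elim: n => [|n IH].
  case: m => [|m]; first by rewrite !sum_n_n.
  by rewrite !sum_n_m_zero; try lia; rewrite (scal_zero_l (K := C_AbsRing)).
case: (Compare_dec.le_lt_dec m n.+1) => h.
  rewrite !sum_n_Sm // IH; exact/esym/(scal_distr_r (K := R_AbsRing) (V := realify (vec_NormedModule C_AbsRing N))).
by rewrite !sum_n_m_zero; try lia; rewrite (scal_zero_l (K := C_AbsRing)).
Qed.

Lemma mxapp_sum (B : @matrix C N N) v m n :
  mxapp B (sum_n_m v m n) = sum_n_m (fun j => mxapp B (v j)) m n.
Proof.
elim: n => [|n IH].
  case: m => [|m]; first by rewrite !sum_n_n.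
  by rewrite !sum_n_m_zero; try lia; rewrite mxapp_zero.
case: (Compare_dec.le_lt_dec m n.+1) => h; first by rewrite !sum_n_Sm // mxapp_plus IH.
by rewrite !sum_n_m_zero; try lia; rewrite mxapp_zero.
Qed.

Lemma sum_vec_ext v w m n : (forall j, (m <= j)%coq_nat -> (j <= n)%coq_nat -> v j = w j) ->
  sum_n_m v m n = sum_n_m w m n.
Proof. by move=> h; apply: sum_n_m_ext_loc => j [h1 h2]; apply: h. Qed.

End VecSums.

Section Discrete.
Variables (d : nat) (Om : Rvec d -> Prop) (Y : CompleteNormedModule C_AbsRing) (P : ibvp Om Y).
Variable D : discretization Om Y.
Hypothesis hc : continuous_hyps P.
Hypothesis hd : discretization_hyps P D.
Notation X := (cfun Om).
Notation XR := (realify (cfun_NormedModule Om)).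
Notation T := (horizon P).
Notation A := (opA P).
Notation u := (sol P).
Notation f := (src P).
Notation Phi j h tau := (phih D j h tau).
Notation M h := (mxapp (Ah D h)).
Notation J h := (mxapp (Ahinv D h)).

Definition defect h (x : X) : Cvec (nodes D h) := M h (minus (Ph D h x) (Rh P D h x)).
Arguments defect : clear implicits.

Lemma norm_Ph h (x : X) : norm (Ph D h x) <= norm x.
Proof. by apply: maxnorm_lub => [|i]; [apply: norm_ge_0 | apply: (supnorm_ub x)]. Qed.

Lemma Ph_plus h (x y : X) : Ph D h (plus x y) = plus (Ph D h x) (Ph D h y).
Proof. by []. Qed.

Lemma Ph_rscal h r (x : X) : Ph D h (r *: x) = r *: Ph D h x.
Proof. by []. Qed.

Lemma Ph_minus h (x y : X) : Ph D h (minus x y) = minus (Ph D h x) (Ph D h y).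
Proof.
rewrite /minus Ph_plus; congr plus; apply: functional_extensionality => i.
by rewrite /Ph /opp /= -opp_mult_l mult_one_l.
Qed.

Lemma J_M h v : mesh D h -> J h (M h v) = v.
Proof. by move=> mh; rewrite -mxapp_mult (proj2 (dh_inv hd mh)) mxapp_one. Qed.

Lemma M_J h v : mesh D h -> M h (J h v) = v.
Proof. by move=> mh; rewrite -mxapp_mult (proj1 (dh_inv hd mh)) mxapp_one. Qed.

Lemma Phi_rec0 h tau v : Phi 0 h tau v = plus (tau *: M h (Phi 1 h tau v)) v.
Proof. by rewrite /phih phimx_app_rec mxapp_mxscale /= Rinv_1; congr plus; apply: scal_one. Qed.

Lemma Phi_rec1 h tau v : Phi 1 h tau v = plus (tau *: M h (Phi 2 h tau v)) v.
Proof. by rewrite /phih phimx_app_rec mxapp_mxscale /= Rinv_1; congr plus; apply: scal_one. Qed.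

Lemma Phi_rec2 h tau v : Phi 2 h tau v = plus (tau *: M h (Phi 3 h tau v)) ((/ 2) *: v).
Proof.
rewrite /phih phimx_app_rec mxapp_mxscale; congr (plus _ (_ *: _)).
Qed.

Lemma Phi_plus j h tau v w : Phi j h tau (plus v w) = plus (Phi j h tau v) (Phi j h tau w).
Proof. exact: mxapp_plus. Qed.
Lemma Phi_minus j h tau v w : Phi j h tau (minus v w) = minus (Phi j h tau v) (Phi j h tau w).
Proof. exact: mxapp_minus. Qed.
Lemma Phi_rscal j h tau r v : Phi j h tau (r *: v) = r *: Phi j h tau v.
Proof. exact: mxapp_scal. Qed.

Lemma Phi_M j h tau v : Phi j h tau (M h v) = M h (Phi j h tau v).
Proof.
(* [phimx_app_comm] yields commutation with [tau] times the matrix, and [tau] has to be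
   cancelled. *)
case: (Req_dec tau 0) => [->|tau0].
  rewrite /phih (phimx_app_rec _ j (M h v)) (phimx_app_rec _ j v) !mxapp_mxscale !(scal_zero_l (K := C_AbsRing)) !plus_zero_l.
  by rewrite mxapp_scal.
have := phimx_app_comm (mxscale (RtoC tau) (Ah D h)) j v.
rewrite !mxapp_mxscale mxapp_scal => /(f_equal (fun w => (/ tau) *: w)).
rewrite !scal_assoc; have -> : mult (RtoC (/ tau) : C_AbsRing) (RtoC tau) = one.
  by rewrite /mult /= -RtoC_mult Rinv_l.
by rewrite !scal_one.
Qed.

Lemma Phi_J j h tau v : mesh D h -> Phi j h tau (J h v) = J h (Phi j h tau v).
Proof. by move=> mh; rewrite -{2}(M_J v mh) Phi_M J_M. Qed.

Lemma norm_Phi j h tau v : mesh D h -> 0 <= tau -> norm (Phi j h tau v) <= norm v.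
Proof. by move=> mh; apply: phi_bound => t w t0; exact: (dh_contraction hd). Qed.

Lemma consistency h x : mesh D h ->
  Ch D h (bdry P x) = plus (minus (Ph D h (A x)) (M h (Ph D h x))) (defect h x).
Proof. by move=> mh; rewrite /defect mxapp_minus /Rh M_J //; vmod D h. Qed.

Lemma J_defect h x : mesh D h -> J h (defect h x) = minus (Ph D h x) (Rh P D h x).
Proof. by move=> mh; rewrite /defect J_M. Qed.

(** [Phi_rec0] produces exactly the term [M h (Ph D h x)] under [Phi 1] that [consistency]
    subtracts, so no factor [M] survives. *)
Lemma exp_step h tau x : mesh D h ->
  plus (Phi 0 h tau (Ph D h x)) (tau *: Phi 1 h tau (Ch D h (bdry P x))) =
  plus (plus (Ph D h x) (tau *: Phi 1 h tau (Ph D h (A x)))) (tau *: Phi 1 h tau (defect h x)).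
Proof.
by move=> mh; rewrite consistency // Phi_plus Phi_minus Phi_M Phi_rec0; vmod D h.
Qed.

(** The same cancellation one level higher, through [Phi_rec1]; in the method it is used with [A u]
    in place of [x]. *)
Lemma exp_step2 h tau x : mesh D h ->
  (tau ^ 2) *: Phi 2 h tau (Ch D h (bdry P x)) =
  plus (minus ((tau ^ 2) *: Phi 2 h tau (Ph D h (A x)))
              (tau *: minus (Phi 1 h tau (Ph D h x)) (Ph D h x)))
       ((tau ^ 2) *: Phi 2 h tau (defect h x)).
Proof.
by move=> mh; rewrite consistency // Phi_plus Phi_minus Phi_M (Phi_rec1 _ (Ph D h x)); vmod D h.
Qed.

(** * Bounds uniform in the step size, the mesh and the time *)

(** The starting time is any real number, not only a multiple of [k]: the constants depend on the
    interval alone. *)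
Definition admissible h k t := mesh D h /\ 0 < k /\ 0 <= t /\ t + k <= T.

Lemma admissible_time h k t r : admissible h k t -> 0 <= r <= 1 -> time T (t + r * k).
Proof. by move=> [_ [k0 [t0 tk]]] [r0 r1]; split; nra. Qed.

Lemma admissible_time0 h k t : admissible h k t -> time T t.
Proof. by move=> [_ [k0 [t0 tk]]]; split; lra. Qed.

(** The bound is a function of the three numbers k, eps_h and eta_h, so that comparing two bounds
    becomes an inequality between reals. *)
Definition isO (e : forall h, R -> R -> Cvec (nodes D h)) (B : R -> R -> R -> R) : Prop :=
  exists C k0 h0, 0 <= C /\ 0 < k0 /\ 0 < h0 /\ forall h k t, admissible h k t ->
    h <= h0 -> k <= k0 -> norm (e h k t) <= C * B k (epsh D h) (etah D h).

Implicit Types e : forall h, R -> R -> Cvec (nodes D h).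

Lemma isO_ext e e' B : (forall h k t, admissible h k t -> e h k t = e' h k t) ->
  isO e B -> isO e' B.
Proof.
move=> E [C [k0 [h0 [C0 [k00 [h00 H]]]]]]; exists C, k0, h0; repeat split=> //.
by move=> h k t adm hh hk; rewrite -E //; apply: H.
Qed.

Lemma eps_small : exists h0, 0 < h0 /\ forall h, mesh D h -> h <= h0 -> 0 <= epsh D h <= 1.
Proof.
have : locally (0 : R) (fun r => Rabs r < 1).
  exists (mkposreal 1 Rlt_0_1) => r; rewrite /ball /= /AbsRing_ball /abs /minus /plus /opp /=.
  by rewrite Ropp_0 Rplus_0_r.
move/(dh_eps_small hd) => [h0 H].
exists (h0 / 2); have p := cond_pos h0; split=> [|h mh hh]; first lra.
have e0 := dh_eps_ge0 hd mh; have hp := dh_mesh hd mh.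
split=> //; have := H h _ hp mh; rewrite Rabs_pos_eq // => K; apply: Rlt_le; apply: K.
rewrite /ball /= /AbsRing_ball /abs /minus /plus /opp /= Ropp_0 Rplus_0_r Rabs_pos_eq; lra.
Qed.

(** After shrinking the thresholds both [k] and eps_h are at most 1, so surplus factors may be
    dropped; the smallness of eps_h enters here. *)
Lemma isO_weaken C' e B B' : 0 <= C' ->
  (forall k r q, 0 < k <= 1 -> 0 <= r <= 1 -> 0 <= q -> B k r q <= C' * B' k r q) ->
  isO e B -> isO e B'.
Proof.
move=> C'0 le [C [k0 [h0 [C0 [k00 [h00 H]]]]]].
have [h1 [h10 small]] := eps_small.
exists (C * C'), (Rmin k0 1), (Rmin h0 h1); split; first exact: Rmult_le_pos.
split; first by apply: Rmin_pos; lra.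
split; first exact: Rmin_pos.
move=> h k t adm hh hk.
have hk0 := Rle_trans _ _ _ hk (Rmin_l _ _); have hk1 := Rle_trans _ _ _ hk (Rmin_r _ _).
have hh0 := Rle_trans _ _ _ hh (Rmin_l _ _); have hh1 := Rle_trans _ _ _ hh (Rmin_r _ _).
apply: Rle_trans (H h k t adm hh0 hk0) _; rewrite Rmult_assoc; apply: Rmult_le_compat_l => //.
have [mh [kp _]] := adm.
by apply: le; [lra | apply: small | exact: (dh_eta_ge0 hd mh)].
Qed.

Lemma isO_plus e e' B : isO e B -> isO e' B -> isO (fun h k t => plus (e h k t) (e' h k t)) B.
Proof.
move=> [C [k0 [h0 [C0 [k00 [h00 H]]]]]] [C' [k0' [h0' [C0' [k00' [h00' H']]]]]].
exists (C + C'), (Rmin k0 k0'), (Rmin h0 h0'); split; first lra.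
split; first exact: Rmin_pos.
split; first exact: Rmin_pos.
move=> h k t adm hh hk; apply: Rle_trans (norm_triangle _ _) _.
rewrite Rmult_plus_distr_r; apply: Rplus_le_compat; [apply: H | apply: H'] => //.
- exact: Rle_trans hh (Rmin_l _ _).
- exact: Rle_trans hk (Rmin_l _ _).
- exact: Rle_trans hh (Rmin_r _ _).
- exact: Rle_trans hk (Rmin_r _ _).
Qed.

Lemma isO_rscal e B (g : R -> R) (b : R -> R) C' :
  0 <= C' -> (forall k, 0 < k -> Rabs (g k) <= C' * b k) ->
  isO e B -> isO (fun h k t => g k *: e h k t) (fun k r q => b k * B k r q).
Proof.
move=> C'0 hg [C [k0 [h0 [C0 [k00 [h00 H]]]]]].
exists (C' * C), k0, h0; split; first exact: Rmult_le_pos.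
split=> //; split=> // h k t adm hh hk.
rewrite norm_rscal.
have -> : C' * C * (b k * B k (epsh D h) (etah D h)) = (C' * b k) * (C * B k (epsh D h) (etah D h)) by ring.
apply: Rmult_le_compat; [exact: Rabs_pos | exact: norm_ge_0 | | exact: H].
by apply: hg; case: adm => _ [].
Qed.

Lemma isO_pow e B x n : isO e B ->
  isO (fun h k t => (x * k ^ n) *: e h k t) (fun k r q => k ^ n * B k r q).
Proof.
apply: (isO_rscal (b := fun k => k ^ n) (Rabs_pos x)) => k k0.
rewrite Rabs_mult (Rabs_pos_eq (k ^ n)); first exact: Rle_refl.
by apply: pow_le; lra.
Qed.

Lemma isO_const e B x : isO e B -> isO (fun h k t => x *: e h k t) B.
Proof.
move=> h; apply: (isO_weaken (C' := 1) (B := fun k r q => 1 * B k r q)) => [||]; [lra | move=> *; lra |].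
apply: (isO_rscal (g := fun=> x) (b := fun=> 1) (Rabs_pos x)) => // k _; lra.
Qed.

Lemma isO_Phi e B j (g : R -> R) : (forall k, 0 < k -> 0 <= g k) ->
  isO e B -> isO (fun h k t => Phi j h (g k) (e h k t)) B.
Proof.
move=> hg [C [k0 [h0 [C0 [k00 [h00 H]]]]]]; exists C, k0, h0; repeat split=> //.
move=> h k t adm hh hk; apply: Rle_trans (norm_Phi _ _ _ _) _; [by case: adm | | exact: H].
by apply: hg; case: adm => _ [].
Qed.

Lemma isO_J e B : isO e B -> isO (fun h k t => J h (e h k t)) B.
Proof.
move=> [C [k0 [h0 [C0 [k00 [h00 H]]]]]]; have [C' hC'] := dh_inv_bound hd.
exists (Rabs C' * C), k0, h0; split; first by apply: Rmult_le_pos => //; apply: Rabs_pos.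
split=> //; split=> // h k t adm hh hk.
apply: Rle_trans (hC' h _ (proj1 adm)) _; rewrite Rmult_assoc.
apply: (Rle_trans _ (Rabs C' * norm (e h k t))).
  by apply: Rmult_le_compat_r; [apply: norm_ge_0 | apply: Rle_abs].
by apply: Rmult_le_compat_l; [apply: Rabs_pos | apply: H].
Qed.

Lemma isO_zero B : (forall k r q, 0 < k -> 0 <= r -> 0 <= q -> 0 <= B k r q) -> isO (fun h k t => zero) B.
Proof.
move=> h; exists 1, 1, 1; repeat split; try lra.
move=> h' k t [mh [k0 _]] _ _; rewrite norm_zero Rmult_1_l.
by apply: h => //; [exact: (dh_eps_ge0 hd mh) | exact: (dh_eta_ge0 hd mh)].
Qed.

Lemma isO_sum (E : nat -> forall h, R -> R -> Cvec (nodes D h)) B n :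
  (forall k r q, 0 < k -> 0 <= r -> 0 <= q -> 0 <= B k r q) ->
  (forall i, (1 <= i <= n)%N -> isO (E i) B) ->
  isO (fun h k t => sum_n_m (fun i => E i h k t) 1 n) B.
Proof.
move=> B0; elim: n => [|n IH] H.
  apply: (isO_ext _ (isO_zero B0)) => h k t _.
  by rewrite sum_n_m_zero //; lia.
apply: (isO_ext (e := fun h k t => plus (sum_n_m (fun i => E i h k t) 1 n) (E n.+1 h k t))).
  by move=> h k t _; rewrite sum_n_Sm //; lia.
apply: isO_plus; last by apply: H; rewrite /= leqnn.
by apply: IH => i /andP [i1 i2]; apply: H; rewrite i1 ltnW.
Qed.

Lemma isO_Ph (x : R -> R -> X) B :
  (exists C k0, 0 <= C /\ 0 < k0 /\ forall h k t, admissible h k t -> k <= k0 ->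
     norm (x k t) <= C * B k (epsh D h) (etah D h)) ->
  isO (fun h k t => Ph D h (x k t)) B.
Proof.
move=> [C [k0 [C0 [k00 H]]]]; exists C, k0, 1; repeat split=> //; first lra.
by move=> h k t adm _ hk; apply: Rle_trans (norm_Ph _ _) _; apply: H.
Qed.

Lemma isO_Ph_bounded (x : R -> X) C : (forall t, time T t -> norm (x t) <= C) ->
  isO (fun h k t => Ph D h (x t)) (fun _ _ _ => 1).
Proof.
move=> H; apply: (isO_Ph (x := fun _ => x)); exists (Rabs C), 1; split; first exact: Rabs_pos.
split=> [|h k t adm _]; first lra.
apply: Rle_trans (H t (admissible_time0 adm)) _; have := Rle_abs C; lra.
Qed.

Lemma isO_defect (x : R -> X) : Z_valued P D x ->
  isO (fun h k t => defect h (x t)) (fun _ r _ => r) /\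
  isO (fun h k t => J h (defect h (x t))) (fun _ _ q => q).
Proof.
move=> [Zx [C H]]; split; exists (Rabs C), 1, 1; (split; first exact: Rabs_pos);
  (split; first lra); (split; first lra) => h k t adm _ _;
  have ht := admissible_time0 adm; have mh := proj1 adm.
- apply: Rle_trans (dh_eps hd mh (Zx t ht)) _; rewrite Rmult_comm.
  apply: Rmult_le_compat_r; first exact: (dh_eps_ge0 hd mh).
  by have := H t ht; have := Rle_abs C; lra.
- rewrite J_defect //; apply: Rle_trans (dh_eta hd mh (Zx t ht)) _; rewrite Rmult_comm.
  apply: Rmult_le_compat_r; first exact: (dh_eta_ge0 hd mh).
  by have := H t ht; have := Rle_abs C; lra.
Qed.

(** * The discrete nonlinearity *)

Lemma grid_lift h (v : Cvec (nodes D h)) : mesh D h ->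
  exists x : X, Ph D h x = v /\ norm x <= norm v.
Proof.
move=> mh; have [x [h1 h2]] := grid_extension v (dh_grid hd mh).
by exists x; split=> //; apply: functional_extensionality.
Qed.

(** Both sides are the derivative at 0 of one curve of grid vectors, since restriction to the grid
    commutes with the nonlinearity; derivatives are unique. *)
Lemma src_u_grid h t (x w : X) : mesh D h -> time T t ->
  Ph D h (dsrc P (t, x) (0, w)) = srch_u D h t (Ph D h x) (Ph D h w).
Proof.
move=> mh ht.
pose VR := realify (vec_NormedModule C_AbsRing (nodes D h)).
pose phi r : VR := srch D h t (plus (Ph D h x : VR) (scal r (Ph D h w : VR))).
have cst (W : NormedModule R_AbsRing) (y z : W) : has_deriv
    (W := prod_NormedModule R_AbsRing R_NormedModule W) 0 1
    (fun r => (t, plus y (scal r z))) 0 (0, z).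
  apply: has_deriv_pair; last exact: has_deriv_affine.
  apply: (has_deriv_ext (phi := fun r => t + r * 0)); [lra | by move=> r _; rewrite Rmult_0_r Rplus_0_r | exact: has_deriv_lin].
apply: (has_deriv_unique (W := VR) (a := 0) (b := 1) (s := 0) (phi := phi)); try lra.
- have h1 : has_deriv (W := XR) 0 1 (fun r => f t (plus (x : XR) (scal r (w : XR)))) 0 (dsrc P (t, x) (0, w)).
    apply: (has_deriv_comp (V := prod_NormedModule R_AbsRing R_NormedModule XR) (W := XR) (D := in_slab T)
      (g := fun p => f (fst p) (snd p)) (c := fun r => (t, plus (x : XR) (scal r (w : XR))))) => //.
    have -> : plus (x : XR) (scal 0 (w : XR)) = x by modular_in (realify (cfun_NormedModule Om)).
    by apply: filterdiff_fdiff_at; apply: (proj1 (ch_src hc)).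
  move=> e e0; have [dd [d0 H]] := h1 e e0; exists dd; split=> // r hr hrs.
  apply: Rle_trans (H r hr hrs); rewrite /phi.
  have E q : srch D h t (plus (Ph D h x : VR) (scal q (Ph D h w : VR))) = Ph D h (f t (plus (x : XR) (scal q (w : XR)))).
    by rewrite dh_src_grid.
  rewrite !E; apply: Rle_trans (norm_Ph h _); rewrite !Ph_minus; exact: Rle_refl.
- apply: (has_deriv_comp (V := prod_NormedModule R_AbsRing R_NormedModule VR) (W := VR) (D := in_slab T)
    (g := fun p => srch D h (fst p) (snd p)) (c := fun r => (t, plus (Ph D h x : VR) (scal r (Ph D h w : VR))))
    (l := dsrch D h (t, Ph D h x)) (v := (0, Ph D h w))) => //; last exact: (cst VR).
  have -> : plus (Ph D h x : VR) (scal 0 (Ph D h w : VR)) = Ph D h x.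
    by modular_in (realify (vec_NormedModule C_AbsRing (nodes D h))).
  by apply: filterdiff_fdiff_at; apply: (proj1 (dh_srch hd mh)).
Qed.

Lemma srch_u_plus h t x v w : mesh D h -> time T t ->
  srch_u D h t x (plus v w) = plus (srch_u D h t x v) (srch_u D h t x w).
Proof.
move=> mh ht; have [lin _] := proj1 (dh_srch hd mh) (t, x) ht.
rewrite /srch_u; have := linear_plus _ lin (0, v) (0, w).
have -> : plus ((0, v) : prod_NormedModule R_AbsRing R_NormedModule (realify (vec_NormedModule C_AbsRing (nodes D h)))) (0, w) = (0, plus v w).
  by congr pair; apply: Rplus_0_l.
by [].
Qed.

Variable Bu : R.
Hypothesis hBu : forall t, time T t -> norm (sol' P t) <= Bu.

(** Extending the deviation rather than [v] itself writes [v] as the grid values of [u t + x], with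
    the same distance from the solution; estimates in X then hold on the grid with the same
    constants. *)
Lemma srch_diff_lift h t v : mesh D h -> time T t -> exists x : X,
  [/\ Ph D h x = minus v (Ph D h (u t)), norm x <= norm (minus v (Ph D h (u t))) &
  minus (srch D h t v) (Ph D h (f t (u t))) = Ph D h (minus (f t (plus (u t) x)) (f t (u t)))].
Proof.
move=> mh ht; have [x [h1 h2]] := grid_lift (minus v (Ph D h (u t))) mh.
exists x; split=> //.
have -> : v = Ph D h (plus (u t) x).
  have -> : Ph D h (plus (u t) x) = plus (Ph D h (u t)) (Ph D h x) by [].
  by rewrite h1; vmod D h.
by rewrite Ph_minus -(dh_src_grid hd).
Qed.

Lemma srch_diff (e : forall h, R -> R -> Cvec (nodes D h)) r : 0 <= r <= 1 ->
  isO (fun h k t => minus (e h k t) (Ph D h (u (t + r * k)))) (fun k _ _ => k) ->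
  isO (fun h k t => minus (srch D h (t + r * k) (e h k t)) (Ph D h (f (t + r * k) (u (t + r * k)))))
    (fun k _ _ => k).
Proof.
move=> hr [C [k0 [h0 [C0 [k00 [h00 H]]]]]].
have [dd [d0 lip]] := tube_lipschitz (ch_horizon hc) (sol_deriv hc) (ch_src hc).
have i0 : 0 < / dd by apply: Rinv_0_lt_compat.
(* This bound on [k] makes [C * k <= dd], so that the lifted argument stays in the tube. *)
have p : 0 < dd / (C + 1) by apply: Rdiv_lt_0_compat; lra.
exists (/ dd * C), (Rmin k0 (dd / (C + 1))), h0; split; first by apply: Rmult_le_pos; lra.
split; first exact: Rmin_pos.
split=> // h k t adm hh hk.
have mh := proj1 adm; have ht := admissible_time adm hr.
have {}H := H h k t adm hh (Rle_trans _ _ _ hk (Rmin_l _ _)).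
have [x [h1 h2 ->]] := srch_diff_lift (e h k t) mh ht.
have x1 : minus (plus (u (t + r * k)) x) (u (t + r * k)) = x by modular_in (realify (cfun_NormedModule Om)).
have hk2 := Rle_trans _ _ _ hk (Rmin_r _ _).
have kp : 0 < k by case: adm => _ [].
have Cd : C * k <= dd.
  have E : dd = (C + 1) * (dd / (C + 1)) by field; lra.
  apply: (Rle_trans _ ((C + 1) * k)); first nra.
  by rewrite E; apply: Rmult_le_compat_l; lra.
apply: Rle_trans (norm_Ph _ _) _.
apply: Rle_trans (lip _ _ ht _) _; first by rewrite x1; apply: Rle_trans h2 _; lra.
rewrite x1 Rmult_assoc; apply: Rmult_le_compat_l; first lra.
by apply: Rle_trans h2 _.
Qed.

(** [tube_taylor] for the lifted deviation; [src_u_grid] turns the derivative on X at the start of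
    the step into the discrete Jacobian. *)
Lemma srch_taylor (e : forall h, R -> R -> Cvec (nodes D h)) r : 0 <= r <= 1 ->
  C2_on (prod_NormedModule R_AbsRing R_NormedModule XR) XR (slab P (W := X))
    (fun p => f (fst p) (snd p)) (dsrc P) ->
  isO (fun h k t => minus (e h k t) (Ph D h (u (t + r * k)))) (fun k _ _ => k) ->
  isO (fun h k t => minus
      (minus (srch D h (t + r * k) (e h k t)) (Ph D h (f (t + r * k) (u (t + r * k)))))
      (srch_u D h t (Ph D h (u t)) (minus (e h k t) (Ph D h (u (t + r * k))))))
    (fun k _ _ => k ^ 2).
Proof.
move=> hr hf2 [C [k0 [h0 [C0 [k00 [h00 H]]]]]].
have [dd [L [d0 [L0 tay]]]] := tube_taylor (ch_horizon hc) (sol_deriv hc) (ch_src hc) hBu hf2.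
have p : 0 < dd / (C + 1) by apply: Rdiv_lt_0_compat; lra.
exists (L * (1 + C) * C), (Rmin k0 (dd / (C + 1))), h0; split; first by apply: Rmult_le_pos => //; apply: Rmult_le_pos; lra.
split; first exact: Rmin_pos.
split=> // h k t adm hh hk.
have mh := proj1 adm; have ht := admissible_time adm hr; have ht0 := admissible_time0 adm.
have {}H := H h k t adm hh (Rle_trans _ _ _ hk (Rmin_l _ _)).
have [x [h1 h2 ->]] := srch_diff_lift (e h k t) mh ht.
have x1 : minus (plus (u (t + r * k)) x) (u (t + r * k)) = x by modular_in (realify (cfun_NormedModule Om)).
have hk2 := Rle_trans _ _ _ hk (Rmin_r _ _).
have kp : 0 < k by case: adm => _ [].
have Cd : (C + 1) * k <= dd.
  have E : dd = (C + 1) * (dd / (C + 1)) by field; lra.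
  by rewrite E; apply: Rmult_le_compat_l; lra.
have Ck := Rmult_le_pos _ _ C0 (Rlt_le _ _ kp).
have rk : Rabs (t + r * k - t) <= k.
  have -> : t + r * k - t = r * k by ring.
  rewrite Rabs_pos_eq; nra.
rewrite -h1 -src_u_grid //.
have hx : norm x <= C * k by apply: Rle_trans h2 _.
have := tay t (t + r * k) (plus (u (t + r * k)) x) ht0 ht; rewrite x1 => {}tay.
apply: (Rle_trans _ (L * (Rabs (t + r * k - t) + norm x) * norm x)).
  rewrite -Ph_minus; apply: Rle_trans (norm_Ph _ _) _.
  by apply: tay; [apply: Rle_trans rk _ | apply: Rle_trans hx _]; lra.
have n0 := norm_ge_0 x; have a0 := Rabs_pos (t + r * k - t).
have -> : L * (1 + C) * C * k ^ 2 = (L * (k + C * k)) * (C * k) by ring.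
apply: Rmult_le_compat => //; first by apply: Rmult_le_pos; lra.
by apply: Rmult_le_compat_l; lra.
Qed.

End Discrete.

(** * The local error *)

Lemma sum_n_m_scal_R (a : nat -> R) x m n :
  sum_n_m (fun i => a i * x) m n = sum_n_m a m n * x.
Proof. exact: (sum_n_m_mult_r (K := R_Ring) x a m n). Qed.

Lemma sum_n_m_sub_R (a a' : nat -> R) m n :
  sum_n_m (fun i => a i - a' i) m n = sum_n_m a m n - sum_n_m a' m n.
Proof.
elim: n => [|n IH].
  case: m => [|m]; first by rewrite !sum_n_n.
  by rewrite !sum_n_m_zero; try lia; rewrite Rminus_0_r.
case: (Compare_dec.le_lt_dec m n.+1) => h.
  by rewrite !sum_n_Sm // IH /plus /=; ring.
by rewrite !sum_n_m_zero; try lia; rewrite Rminus_0_r.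
Qed.

Section Method.
Variables (d : nat) (Om : Rvec d -> Prop) (Y : CompleteNormedModule C_AbsRing) (P : ibvp Om Y).
Variable D : discretization Om Y.
Variables (s : nat) (a : nat -> nat -> R) (b c : nat -> R).
Hypothesis hc : continuous_hyps P.
Hypothesis hd : discretization_hyps P D.
Hypothesis tab : erk_tableau s a b c.
Notation X := (cfun Om).
Notation XR := (realify (cfun_NormedModule Om)).
Notation T := (horizon P).
Notation A := (opA P).
Notation u := (sol P).
Notation f := (src P).
Notation F := (fun t => src P t (sol P t)).
Notation F' := (fun t => dsrc P (t, sol P t) (1, sol' P t)).
Notation Phi j h tau := (phih D j h tau).
Notation M h := (mxapp (Ah D h)).
Notation J h := (mxapp (Ahinv D h)).
Notation delta h x := (@defect d Om Y P D h x).
Notation K i h k t := (hstage P D a c h k t i).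
Notation SK i h k t := (srch D h (t + c i * k) (hstage P D a c h k t i)).
Notation ord := (@isO d Om Y P D).

Variable u2 : R -> X.
Hypothesis hu2 : forall t, time T t -> has_deriv (W := XR) 0 T (sol' P) t (u2 t).
Variable B : R.
Hypothesis hB : forall t, time T t ->
  [/\ norm (sol' P t) <= B, norm (u2 t) <= B & norm (F t) <= B] /\
  [/\ norm (A (u t)) <= B, norm (A (A (u t))) <= B & norm (A (F t)) <= B].
Hypothesis hZ0 : Z_valued P D u.
Hypothesis hZ1 : Z_valued P D (fun t => A (u t)).
Hypothesis hZF : Z_valued P D F.

Lemma B_ge0 : 0 <= B.
Proof.
have T0 := ch_horizon hc; have ht : time T 0 by split; lra.
by case: (hB ht) => [[h _ _] _]; apply: Rle_trans h; apply: norm_ge_0.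
Qed.

Lemma hBu t : time T t -> norm (sol' P t) <= B.
Proof. by move=> /hB [[]]. Qed.

Lemma hBu2 t : time T t -> norm (u2 t) <= B.
Proof. by move=> /hB [[]]. Qed.

Lemma node_range i : (1 <= i <= s)%N -> 0 <= c i <= 1.
Proof. by case: tab => _ [_ [h _]]; apply: h. Qed.

Lemma isO_lin e Bd x : ord e Bd ->
  ord (fun h k t => (x * k) *: e h k t) (fun k r q => k * Bd k r q).
Proof.
apply: (isO_rscal (b := fun k => k) (Rabs_pos x)) => k k0.
rewrite Rabs_mult (Rabs_pos_eq k); lra.
Qed.

Lemma isO_k e Bd : ord e Bd -> ord (fun h k t => k *: e h k t) (fun k r q => k * Bd k r q).
Proof.
apply: (isO_rscal (C' := 1) (b := fun k => k)) => [|k k0]; first lra.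
by rewrite Rabs_pos_eq; lra.
Qed.

Lemma isO_kn n e Bd : ord e Bd -> ord (fun h k t => (k ^ n) *: e h k t) (fun k r q => k ^ n * Bd k r q).
Proof.
apply: (isO_rscal (C' := 1) (b := fun k => k ^ n)) => [|k k0]; first lra.
rewrite Rabs_pos_eq; first lra.
by apply: pow_le; lra.
Qed.

Lemma stage_eq i h k t : K i h k t =
  plus (plus (Phi 0 h (c i * k) (Ph D h (u t))) ((c i * k) *: Phi 1 h (c i * k) (Ch D h (bdry P (u t)))))
    (k *: sum_n_m (fun j => a i j *: Phi 0 h ((c i - c j) * k) (SK j h k t)) 1 (Nat.pred i)).
Proof.
rewrite /hstage stageE // => L L' E; congr (plus _ (_ *: _)).
apply: sum_vec_ext => j h1 h2; rewrite E //.
by apply/ltP; lia.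
Qed.

Lemma stage_range i j : (1 <= i <= s)%N -> (1 <= j <= Nat.pred i)%N -> (1 <= j < i)%N /\ (1 <= j <= s)%N.
Proof.
move=> /andP [/leP i1 /leP i2] /andP [/leP j1 /leP j2].
by split; apply/andP; split; apply/leP; lia.
Qed.

(** When [a i j = 0] the difference [c i - c j] may be negative and [Phi] need not be a contraction,
    but the term vanishes; otherwise the tableau guarantees [c j <= c i]. *)
Lemma stage_term_ord l i j e Bd : (1 <= i <= s)%N -> (1 <= j <= Nat.pred i)%N ->
  (forall k r q, 0 < k -> 0 <= r -> 0 <= q -> 0 <= Bd k r q) ->
  ord e Bd -> ord (fun h k t => a i j *: Phi l h ((c i - c j) * k) (e h k t)) Bd.
Proof.
move=> hi hj Bd0 he; have [hj1 hj2] := stage_range hi hj.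
case: (Req_dec (a i j) 0) => [->|ne].
  apply: (isO_ext _ (isO_zero hd Bd0)) => h k t _.
  exact/esym/(scal_zero_l (K := C_AbsRing)).
apply: (isO_const hd); apply: (isO_Phi hd l (g := fun k => (c i - c j) * k)) => // k k0.
case: tab => _ [_ [_ le]]; case/andP: (hi) => _ i2; have := le i j hj1 i2 ne => ?.
by apply: Rmult_le_pos; lra.
Qed.

Lemma src_shift_ord r : 0 <= r <= 1 ->
  ord (fun h k t => Ph D h (minus (F (t + r * k)) (F t))) (fun k _ _ => k).
Proof.
move=> hr; have [L [L0 hL]] := comp_src_lip (ch_horizon hc) (sol_deriv hc) (ch_src hc) hBu.
apply: isO_Ph; exists L, 1; split=> //; split=> [|h k t adm _]; first lra.
have kp : 0 < k by case: adm => _ [].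
apply: Rle_trans (hL t _ (admissible_time0 adm) (admissible_time adm hr)) _.
apply: Rmult_le_compat_l => //; have -> : t + r * k - t = r * k by ring.
rewrite Rabs_pos_eq; nra.
Qed.

Lemma sol_taylor_ord r : 0 <= r <= 1 ->
  ord (fun h k t => Ph D h (minus (plus (u t) ((r * k) *: sol' P t)) (u (t + r * k)))) (fun k _ _ => k ^ 2).
Proof.
move=> hr; have B0 := B_ge0.
apply: isO_Ph; exists B, 1; split=> //; split=> [|h k t adm _]; first lra.
have kp : 0 < k by case: adm => _ [].
have rk : 0 <= r * k by apply: Rmult_le_pos; lra.
have ht := admissible_time0 adm; have htr := admissible_time adm hr.
have := taylor1 (W := XR) (u := u) (u' := sol' P) (a := t) (b := t + r * k) (B := B).
have -> : t + r * k - t = r * k by ring.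
move=> tay.
have -> : minus (plus (u t) ((r * k) *: sol' P t)) (u (t + r * k)) =
  opp (minus (minus (u (t + r * k)) (u t)) ((r * k) *: sol' P t)).
  by modular_in (realify (cfun_NormedModule Om)).
rewrite norm_opp; apply: (Rle_trans _ (B * (r * k) ^ 2)); last first.
  apply: Rmult_le_compat_l => //; apply: pow_incr; split=> //.
  by rewrite -[X in _ <= X]Rmult_1_l; apply: Rmult_le_compat_r; lra.
have inT q : t <= q <= t + r * k -> time T q.
  by case: ht htr => ? ? [? ?] ?; split; lra.
apply: tay => // [|q hq|q hq]; first lra.
- apply: (has_deriv_sub (a := 0) (b := T)); [by case: ht | by case: htr |].
  by apply: sol_deriv; [exact: hc | apply: inT].
- have := bounded_deriv_lip hu2 hBu2 ht (inT q hq).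
  by rewrite Rabs_pos_eq; lra.
Qed.

Lemma sol_shift_ord r : 0 <= r <= 1 ->
  ord (fun h k t => Ph D h (minus (u t) (u (t + r * k)))) (fun k _ _ => k).
Proof.
move=> hr; have B0 := B_ge0; apply: isO_Ph; exists B, 1; split=> //; split=> [|h k t adm _]; first lra.
have kp : 0 < k by case: adm => _ [].
rewrite norm_minus_sym.
apply: Rle_trans (u_lip (sol_deriv hc) hBu (admissible_time0 adm) (admissible_time adm hr)) _.
apply: Rmult_le_compat_l => //; have -> : t + r * k - t = r * k by ring.
rewrite Rabs_pos_eq; nra.
Qed.

Lemma Au_ord : ord (fun h k t => Ph D h (A (u t))) (fun _ _ _ => 1).
Proof. by apply: (isO_Ph_bounded D (C := B)) => t /hB [_ []]. Qed.
Lemma AAu_ord : ord (fun h k t => Ph D h (A (A (u t)))) (fun _ _ _ => 1).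
Proof. by apply: (isO_Ph_bounded D (C := B)) => t /hB [_ []]. Qed.
Lemma F_ord : ord (fun h k t => Ph D h (F t)) (fun _ _ _ => 1).
Proof. by apply: (isO_Ph_bounded D (C := B)) => t /hB [[]]. Qed.
Lemma AF_ord : ord (fun h k t => Ph D h (A (F t))) (fun _ _ _ => 1).
Proof. by apply: (isO_Ph_bounded D (C := B)) => t /hB [_ []]. Qed.

Lemma node_ge0 i k : (1 <= i <= s)%N -> 0 < k -> 0 <= c i * k.
Proof. by move=> /node_range h k0; apply: Rmult_le_pos; lra. Qed.

Lemma conode_ge0 i k : (1 <= i <= s)%N -> 0 < k -> 0 <= (1 - c i) * k.
Proof. by move=> /node_range h k0; apply: Rmult_le_pos; lra. Qed.

Lemma stage_src_ord_of i : (1 <= i <= s)%N ->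
  ord (fun h k t => minus (K i h k t) (Ph D h (u (t + c i * k)))) (fun k _ _ => k) ->
  ord (fun h k t => minus (SK i h k t) (Ph D h (F t))) (fun k _ _ => k).
Proof.
move=> hi h.
have h1 := srch_diff hc hd (node_range hi) h.
apply: (isO_ext _ (isO_plus h1 (src_shift_ord (node_range hi)))) => h' k t _.
by rewrite Ph_minus; vmod D h'.
Qed.

(** Strong induction: closeness of the earlier stages to the solution bounds their source terms, and
    everything added to [Ph D h (u t)] carries a factor [k]. *)
Lemma stage_ord i : (1 <= i <= s)%N ->
  ord (fun h k t => minus (K i h k t) (Ph D h (u (t + c i * k)))) (fun k _ _ => k).
Proof.
elim/ltn_ind: i => i IH hi.
have ci := node_range hi.
pose S h k t := sum_n_m (fun j => a i j *: Phi 0 h ((c i - c j) * k) (SK j h k t)) 1 (Nat.pred i).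
have hS : ord S (fun _ _ _ => 1).
  apply: isO_sum => // [k r q *|j hj]; first lra.
  have [hj1 hj2] := stage_range hi hj.
  apply: stage_term_ord => // [k r q *|]; first lra.
  have := stage_src_ord_of hj2 (IH j _ hj2) => /(_ _) h.
  have {}h : ord (fun h k t => minus (SK j h k t) (Ph D h (F t))) (fun _ _ _ => 1).
    apply: (isO_weaken hd (C' := 1)) (h _) => [|*|]; [lra | lra | by case/andP: hj1].
  apply: (isO_ext _ (isO_plus h F_ord)) => h' k t _; vmod D h'.
apply: (isO_ext (e := fun h k t => plus (Ph D h (minus (u t) (u (t + c i * k))))
  (plus (plus ((c i * k) *: Phi 1 h (c i * k) (Ph D h (A (u t))))
        ((c i * k) *: Phi 1 h (c i * k) (delta h (u t))))
     (k *: S h k t)))).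
  move=> h k t [mh _]; rewrite stage_eq (exp_step hd) // Ph_minus -/(S h k t); vmod D h.
apply: isO_plus; first exact: sol_shift_ord.
apply: isO_plus; first apply: isO_plus.
- apply: (isO_weaken hd (C' := 1)) (isO_lin (c i) (isO_Phi hd 1 (g := fun k => c i * k) _ Au_ord)) => [|*|k k0]; [lra | lra |].
  exact: node_ge0.
- apply: (isO_weaken hd (C' := 1)) (isO_lin (c i) (isO_Phi hd 1 (g := fun k => c i * k) _ (proj1 (isO_defect hd hZ0)))) => [|k r q *|k k0]; [lra | nra |].
  exact: node_ge0.
- by apply: (isO_weaken hd (C' := 1)) (isO_k hS) => [|*]; lra.
Qed.

Lemma stage_src_ord i : (1 <= i <= s)%N ->
  ord (fun h k t => minus (SK i h k t) (Ph D h (F t))) (fun k _ _ => k).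
Proof. by move=> hi; apply: stage_src_ord_of => //; apply: stage_ord. Qed.

Definition rho h k t := minus (hstep P D s a b c h k t) (Ph D h (u (t + k))).
Arguments rho : clear implicits.

(** What is left of the [i]-th bracket of the method after [exp_step] and the removal of
    [Ph D h (F t)]. *)
Definition incr i h k t :=
  plus (plus (Phi 0 h ((1 - c i) * k) (minus (SK i h k t) (Ph D h (F t))))
             (((1 - c i) * k) *: Phi 1 h ((1 - c i) * k) (Ph D h (A (F t)))))
       (((1 - c i) * k) *: Phi 1 h ((1 - c i) * k) (delta h (F t))).
Arguments incr : clear implicits.

(** Between [exp_step] and [exp_step2] the terms [Phi 1] of [A u] cancel and leave [A u] itself.
    Together with the copies of [F t] removed in [incr], whose weights sum to 1, this builds the
    tangent of [u]. *)
Lemma rho_eq h k t : mesh D h -> rho h k t =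
  plus (plus (plus (Ph D h (minus (plus (u t) (k *: sol' P t)) (u (t + k))))
                   ((k ^ 2) *: Phi 2 h k (Ph D h (A (A (u t))))))
             (plus (k *: Phi 1 h k (delta h (u t))) ((k ^ 2) *: Phi 2 h k (delta h (A (u t))))))
       (k *: sum_n_m (fun i => b i *: incr i h k t) 1 s).
Proof.
move=> mh; rewrite /rho /hstep (exp_step hd) // (exp_step2 hd) //.
have -> : sum_n_m (fun i => b i *: (plus (Phi 0 h ((1 - c i) * k) (SK i h k t))
    (((1 - c i) * k) *: Phi 1 h ((1 - c i) * k) (Ch D h (bdry P (F t)))))) 1 s =
  plus (sum_n_m (fun i => b i *: incr i h k t) 1 s) (Ph D h (F t)).
  have {1}-> : Ph D h (F t) = sum_n_m (fun i => b i *: Ph D h (F t)) 1 s.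
    by rewrite sum_rscal_const (proj1 tab); apply/esym/scal_one.
  rewrite -sum_n_m_plus; apply: sum_vec_ext => i _ _.
  have E := exp_step hd ((1 - c i) * k) (F t) mh.
  have {}E : ((1 - c i) * k) *: Phi 1 h ((1 - c i) * k) (Ch D h (bdry P (F t))) =
    minus (plus (plus (Ph D h (F t)) (((1 - c i) * k) *: Phi 1 h ((1 - c i) * k) (Ph D h (A (F t)))))
       (((1 - c i) * k) *: Phi 1 h ((1 - c i) * k) (delta h (F t)))) (Phi 0 h ((1 - c i) * k) (Ph D h (F t))).
    by rewrite -E; vmod D h.
  rewrite E /incr Phi_minus; vmod D h.
rewrite /sol' Ph_minus Ph_plus Ph_rscal Ph_plus; vmod D h.
Qed.

Lemma incr_ord i : (1 <= i <= s)%N -> ord (incr i) (fun k _ _ => k).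
Proof.
move=> hi; have g0 := fun k => @conode_ge0 i k hi.
apply: isO_plus; first apply: isO_plus.
- exact: (isO_Phi hd 0 (g := fun k => (1 - c i) * k) g0 (stage_src_ord hi)).
- by apply: (isO_weaken hd (C' := 1)) (isO_lin (1 - c i) (isO_Phi hd 1 (g := fun k => (1 - c i) * k) g0 AF_ord)) => [|*]; lra.
- by apply: (isO_weaken hd (C' := 1)) (isO_lin (1 - c i) (isO_Phi hd 1 (g := fun k => (1 - c i) * k) g0 (proj1 (isO_defect hd hZF)))) => [|k r q *]; [lra | nra].
Qed.

Lemma rho_ord : ord rho (fun k r _ => k ^ 2 + k * r).
Proof.
have k0 := fun (k : R) => @Rlt_le 0 k.
apply: (isO_ext (e := _)) => [h k t [mh _]|]; first exact/esym/rho_eq.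
apply: isO_plus; first (apply: isO_plus; apply: isO_plus).
- apply: (isO_weaken hd (C' := 1) (B := fun k _ _ => k ^ 2)) => [|k r q *|]; [lra | nra |].
  apply: (isO_ext _ (sol_taylor_ord (r := 1) _)) => [h k t _|]; last lra.
  by rewrite !Rmult_1_l.
- by apply: (isO_weaken hd (C' := 1)) (isO_kn 2 (isO_Phi hd 2 (g := fun k => k) k0 AAu_ord)) => [|k r q *]; [lra | nra].
- by apply: (isO_weaken hd (C' := 1)) (isO_k (isO_Phi hd 1 (g := fun k => k) k0 (proj1 (isO_defect hd hZ0)))) => [|k r q *]; [lra | nra].
- by apply: (isO_weaken hd (C' := 1)) (isO_kn 2 (isO_Phi hd 2 (g := fun k => k) k0 (proj1 (isO_defect hd hZ1)))) => [|k r q *]; [lra | nra].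
- have h : ord (fun h k t => sum_n_m (fun i => b i *: incr i h k t) 1 s) (fun k _ _ => k).
    apply: isO_sum => // [k r q *|i hi]; first lra.
    by apply: (isO_const hd); apply: incr_ord.
  by apply: (isO_weaken hd (C' := 1)) (isO_k h) => [|k r q *]; [lra | nra].
Qed.

(** * The error after application of the inverse matrix *)

Variable u3 : R -> X.
Hypothesis hu3 : forall t, time T t -> has_deriv (W := XR) 0 T u2 t (u3 t).
Hypothesis hB3 : forall t, time T t -> norm (u3 t) <= B.
Hypothesis hu2E : forall t, time T t -> u2 t = plus (plus (A (A (u t))) (A (F t))) (F' t).
Hypothesis hf2 : C2_on (prod_NormedModule R_AbsRing R_NormedModule XR) XR (slab P (W := X))
  (fun p => f (fst p) (snd p)) (dsrc P).
Hypothesis hbc : sum_n_m (fun i => b i * c i) 1 s = / 2.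
Hypothesis hstab : exists C h0, 0 < h0 /\ forall h t v, mesh D h -> h <= h0 -> time T t ->
  norm (J h (srch_u D h t (Ph D h (u t)) (M h v))) <= C * norm v.

(** The vector W_i: the coefficients of [M h] produced by [Phi_rec1] on [A u] and by [Phi_rec0] on
    the source terms, whose remaining parts add up to [u + c_i k u']. *)
Definition corr i h k t :=
  plus (((c i * k) ^ 2) *: Phi 2 h (c i * k) (Ph D h (A (u t))))
    (k *: sum_n_m (fun j => a i j *: Phi 1 h ((c i - c j) * k) (((c i - c j) * k) *: Ph D h (F t))) 1 (Nat.pred i)).
Arguments corr : clear implicits.

Lemma corr_ord i : (1 <= i <= s)%N -> ord (corr i) (fun k _ _ => k ^ 2).
Proof.
move=> hi; have g0 := fun k => @node_ge0 i k hi.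
apply: isO_plus.
  apply: (isO_ext (e := fun h k t => (c i ^ 2 * k ^ 2) *: Phi 2 h (c i * k) (Ph D h (A (u t))))).
    by move=> h k t _; congr (_ *: _); rewrite Rpow_mult_distr.
  by apply: (isO_weaken hd (C' := 1)) (isO_pow (c i ^ 2) 2 (isO_Phi hd 2 (g := fun k => c i * k) g0 Au_ord)) => [|*]; lra.
have hS : ord (fun h k t => sum_n_m (fun j => a i j *: Phi 1 h ((c i - c j) * k) (((c i - c j) * k) *: Ph D h (F t))) 1 (Nat.pred i)) (fun k _ _ => k).
  apply: isO_sum => // [k r q *|j hj]; first lra.
  apply: stage_term_ord => // [k r q *|]; first lra.
  by apply: (isO_weaken hd (C' := 1)) (isO_lin (c i - c j) F_ord) => [|*]; lra.
by apply: (isO_weaken hd (C' := 1)) (isO_k hS) => [|k r q *]; [lra | nra].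
Qed.

(** By the row sums of the tableau the part free of [M h] is the tangent of [u]. There remain a
    defect of size k eps_h and k times a sum that [stage_src_ord] shows to be O(k). *)
Lemma stage_refined_ord i : (1 <= i <= s)%N ->
  ord (fun h k t => minus (minus (K i h k t) (Ph D h (u (t + c i * k)))) (M h (corr i h k t)))
    (fun k r _ => k ^ 2 + k * r).
Proof.
move=> hi; have g0 := fun k => @node_ge0 i k hi.
pose S h k t := sum_n_m (fun j => a i j *: Phi 0 h ((c i - c j) * k) (minus (SK j h k t) (Ph D h (F t)))) 1 (Nat.pred i).
have hS : ord S (fun k _ _ => k).
  apply: isO_sum => // [k r q *|j hj]; first lra.
  have [hj1 hj2] := stage_range hi hj.
  apply: stage_term_ord => // [k r q *|]; first lra.
  exact: stage_src_ord.
apply: (isO_ext (e := fun h k t => plus (plus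
   (Ph D h (minus (plus (u t) ((c i * k) *: sol' P t)) (u (t + c i * k))))
   ((c i * k) *: Phi 1 h (c i * k) (delta h (u t)))) (k *: S h k t))).
  move=> h k t [mh _]; rewrite stage_eq (exp_step hd) // /corr mxapp_plus !mxapp_scal mxapp_sum.
  have -> : sum_n_m (fun j => a i j *: Phi 0 h ((c i - c j) * k) (SK j h k t)) 1 (Nat.pred i) =
    plus (S h k t) (plus (sum_n_m (fun j => M h (a i j *: Phi 1 h ((c i - c j) * k) (((c i - c j) * k) *: Ph D h (F t)))) 1 (Nat.pred i))
      (c i *: Ph D h (F t))).
    have {1}-> : c i *: Ph D h (F t) = sum_n_m (fun j => a i j *: Ph D h (F t)) 1 (Nat.pred i).
      by rewrite sum_rscal_const (proj1 (proj2 tab)).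
    rewrite /S -!sum_n_m_plus; apply: sum_vec_ext => j _ _.
    by rewrite Phi_rscal !mxapp_scal Phi_minus (Phi_rec0 _ (Ph D h (F t))); vmod D h.
  rewrite (Phi_rec1 _ (Ph D h (A (u t)))) Ph_minus Ph_plus Ph_rscal /sol' Ph_plus; vmod D h.
apply: isO_plus; first apply: isO_plus.
- apply: (isO_weaken hd (C' := 1)) (sol_taylor_ord (node_range hi)) => [|k r q *]; [lra | nra].
- by apply: (isO_weaken hd (C' := 1)) (isO_lin (c i) (isO_Phi hd 1 (g := fun k => c i * k) g0 (proj1 (isO_defect hd hZ0)))) => [|k r q *]; [lra | nra].
- by apply: (isO_weaken hd (C' := 1)) (isO_k hS) => [|k r q *]; [lra | nra].
Qed.

Lemma isO_srch_u e Bd : ord e Bd -> ord (fun h k t => srch_u D h t (Ph D h (u t)) (e h k t)) Bd.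
Proof.
move=> [C [k0 [h0 [C0 [k00 [h00 H]]]]]]; have [dl [L [dl0 hL]]] := dh_srch_tube hd.
exists (Rabs L * C), k0, h0; split; first by apply: Rmult_le_pos => //; apply: Rabs_pos.
split=> //; split=> // h k t adm hh hk.
apply: Rle_trans (hL h t _ _ (proj1 adm) (admissible_time0 adm) _) _.
  by rewrite norm_minus_diag; lra.
rewrite Rmult_assoc; apply: (Rle_trans _ (Rabs L * norm (e h k t))).
  by apply: Rmult_le_compat_r; [apply: norm_ge_0 | apply: Rle_abs].
by apply: Rmult_le_compat_l; [apply: Rabs_pos | apply: H].
Qed.

Lemma isO_stable e Bd : ord e Bd ->
  ord (fun h k t => J h (srch_u D h t (Ph D h (u t)) (M h (e h k t)))) Bd.
Proof.
move=> [C [k0 [h0 [C0 [k00 [h00 H]]]]]]; have [L [h1 [h10 hL]]] := hstab.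
exists (Rabs L * C), k0, (Rmin h0 h1); split; first by apply: Rmult_le_pos => //; apply: Rabs_pos.
split=> //; split=> [|h k t adm hh hk]; first exact: Rmin_pos.
apply: Rle_trans (hL h t _ (proj1 adm) (Rle_trans _ _ _ hh (Rmin_r _ _)) (admissible_time0 adm)) _.
rewrite Rmult_assoc; apply: (Rle_trans _ (Rabs L * norm (e h k t))).
  by apply: Rmult_le_compat_r; [apply: norm_ge_0 | apply: Rle_abs].
apply: Rmult_le_compat_l; [exact: Rabs_pos | apply: H => //].
exact: Rle_trans hh (Rmin_l _ _).
Qed.

Lemma stage_src_refined_ord i : (1 <= i <= s)%N ->
  ord (fun h k t => J h (minus (SK i h k t) (Ph D h (F (t + c i * k))))) (fun k r _ => k ^ 2 + k * r).
Proof.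
move=> hi.
pose dK h k t := minus (K i h k t) (Ph D h (u (t + c i * k))).
have h1 := isO_J hd (srch_taylor hc hd hBu (node_range hi) hf2 (stage_ord hi)).
(* Here the stability assumption is essential: [corr i] is O(k^2), while [M h] applied to it need
   not be, uniformly in h. *)
have h2 := isO_stable (corr_ord hi).
have h3 := isO_J hd (isO_srch_u (stage_refined_ord hi)).
have wk e : ord e (fun k _ _ => k ^ 2) -> ord e (fun k r _ => k ^ 2 + k * r).
  by apply: (isO_weaken hd (C' := 1)) => [|k r q *]; [lra | nra].
apply: (isO_ext _ (isO_plus (isO_plus (wk _ h1) (wk _ h2)) h3)) => h k t adm.
have mh := proj1 adm; have ht := admissible_time0 adm.
have E : srch_u D h t (Ph D h (u t)) (dK h k t) = plus (srch_u D h t (Ph D h (u t)) (M h (corr i h k t)))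
    (srch_u D h t (Ph D h (u t)) (minus (dK h k t) (M h (corr i h k t)))).
  by rewrite -(srch_u_plus hd) //; congr (srch_u D h t _ _); vmod D h.
by rewrite -!mxapp_plus -/(dK h k t) E; congr (mxapp _ _); vmod D h.
Qed.

(** The identity for [u''] is solved for [F'], whose bound thus comes from those of the other three
    terms. *)
Lemma F'_ord : ord (fun h k t => Ph D h (F' t)) (fun _ _ _ => 1).
Proof.
apply: (isO_Ph_bounded D (C := B + (B + B))) => t ht.
have -> : F' t = minus (u2 t) (plus (A (A (u t))) (A (F t))).
  by rewrite hu2E //; modular_in (realify (cfun_NormedModule Om)).
have [[_ k1 _] [_ k2 k3]] := hB ht.
apply: Rle_trans (norm_minus_le _ _) _; apply: Rplus_le_compat => //.
by apply: Rle_trans (norm_triangle _ _) _; apply: Rplus_le_compat.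
Qed.

Lemma F_taylor_ord r : 0 <= r <= 1 ->
  ord (fun h k t => Ph D h (minus (minus (F (t + r * k)) (F t)) ((r * k) *: F' t))) (fun k _ _ => k ^ 2).
Proof.
move=> hr.
have [dd [L [d0 [L0 H]]]] := comp_src_taylor (ch_horizon hc) (sol_deriv hc) (ch_src hc) hBu hf2 hu2 hBu2.
apply: isO_Ph; exists L, dd; split=> //; split=> // h k t adm hk.
have kp : 0 < k by case: adm => _ [].
have rk : 0 <= r * k by apply: Rmult_le_pos; lra.
have rk1 : r * k <= k by rewrite -[X in _ <= X]Rmult_1_l; apply: Rmult_le_compat_r; lra.
have := H t (t + r * k) (admissible_time0 adm) (admissible_time adm hr).
have -> : t + r * k - t = r * k by ring.
move=> {}H; apply: Rle_trans (H _ _) _; [lra | lra |].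
by apply: Rmult_le_compat_l => //; apply: pow_incr; split.
Qed.

Lemma sol_taylor2_ord :
  ord (fun h k t => Ph D h (minus (plus (u t) (plus (k *: sol' P t) ((k ^ 2 / 2) *: u2 t))) (u (t + k))))
    (fun k _ _ => k ^ 3).
Proof.
have B0 := B_ge0.
apply: isO_Ph; exists B, 1; split=> //; split=> [|h k t adm _]; first lra.
have kp : 0 < k by case: adm => _ [].
have ht := admissible_time0 adm.
have htk : time T (t + k) by case: adm => _ [_ [? ?]]; split; lra.
have := taylor2 (W := XR) (u := u) (u' := sol' P) (u'' := u2) (a := t) (b := t + k) (B := B).
have -> : t + k - t = k by ring.
move=> tay.
have -> : minus (plus (u t) (plus (k *: sol' P t) ((k ^ 2 / 2) *: u2 t))) (u (t + k)) =
  opp (minus (minus (u (t + k)) (u t)) (plus (k *: sol' P t) ((k ^ 2 / 2) *: u2 t))).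
  by modular_in (realify (cfun_NormedModule Om)).
rewrite norm_opp.
have inT q : t <= q <= t + k -> time T q.
  by case: ht htk => ? ? [? ?] ?; split; lra.
apply: tay => // [|q hq|q hq|q hq]; first lra.
- apply: (has_deriv_sub (a := 0) (b := T)); [by case: ht | by case: htk |].
  by apply: sol_deriv; [exact: hc | apply: inT].
- apply: (has_deriv_sub (a := 0) (b := T)); [by case: ht | by case: htk |].
  by apply: hu2; apply: inT.
- have := bounded_deriv_lip hu3 hB3 ht (inT q hq).
  by rewrite Rabs_pos_eq; lra.
Qed.

Definition incr_rem i h k t :=
  plus (plus (plus (Phi 0 h ((1 - c i) * k) (J h (minus (SK i h k t) (Ph D h (F (t + c i * k))))))
                   (Phi 0 h ((1 - c i) * k) (J h (Ph D h (minus (minus (F (t + c i * k)) (F t)) ((c i * k) *: F' t))))))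
             (plus (((1 - c i) * k) *: ((c i * k) *: Phi 1 h ((1 - c i) * k) (Ph D h (F' t))))
                   (((1 - c i) * k) *: (((1 - c i) * k) *: Phi 2 h ((1 - c i) * k) (Ph D h (A (F t)))))))
       (((1 - c i) * k) *: Phi 1 h ((1 - c i) * k) (J h (delta h (F t)))).
Arguments incr_rem : clear implicits.

(** Since [M] and [J] are inverse, the recursion replaces a [J] under [Phi] by a factor [tau]; the
    leading terms [J y] and [J z] come out free of [Phi], ready for cancellation. *)
Lemma J_exp_expansion h r tau (x1 x2 y z w : Cvec (nodes D h)) : mesh D h ->
  J h (plus (plus (Phi 0 h tau (plus (plus x1 x2) (r *: y))) (tau *: Phi 1 h tau z))
     (tau *: Phi 1 h tau w)) =
  plus (plus (r *: J h y) (tau *: J h z))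
    (plus (plus (plus (Phi 0 h tau (J h x1)) (Phi 0 h tau (J h x2)))
                (plus (tau *: (r *: Phi 1 h tau y)) (tau *: (tau *: Phi 2 h tau z))))
          (tau *: Phi 1 h tau (J h w))).
Proof.
move=> mh; rewrite !Phi_plus Phi_rscal !mxapp_plus !mxapp_scal -!(Phi_J hd _ _ _ mh).
have -> : Phi 0 h tau (J h y) = plus (tau *: Phi 1 h tau y) (J h y).
  by rewrite Phi_rec0 -Phi_M (M_J hd).
have -> : Phi 1 h tau (J h z) = plus (tau *: Phi 2 h tau z) (J h z).
  by rewrite Phi_rec1 -Phi_M (M_J hd).
by vmod D h.
Qed.

Lemma J_incr i h k t : mesh D h -> J h (incr i h k t) =
  plus (plus ((c i * k) *: J h (Ph D h (F' t))) (((1 - c i) * k) *: J h (Ph D h (A (F t)))))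
       (incr_rem i h k t).
Proof.
move=> mh; rewrite /incr.
have -> : minus (SK i h k t) (Ph D h (F t)) =
  plus (plus (minus (SK i h k t) (Ph D h (F (t + c i * k))))
     (Ph D h (minus (minus (F (t + c i * k)) (F t)) ((c i * k) *: F' t)))) ((c i * k) *: Ph D h (F' t)).
  by rewrite !Ph_minus Ph_rscal; vmod D h.
exact: J_exp_expansion.
Qed.

Lemma incr_rem_ord i : (1 <= i <= s)%N -> ord (incr_rem i) (fun k r q => k ^ 2 + k * r + q).
Proof.
move=> hi; have g0 := fun k => @conode_ge0 i k hi.
have wk e : ord e (fun k _ _ => k ^ 2) -> ord e (fun k r q => k ^ 2 + k * r + q).
  by apply: (isO_weaken hd (C' := 1)) => [|k r q *]; [lra | nra].
apply: isO_plus; first (apply: isO_plus; apply: isO_plus).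
- apply: (isO_weaken hd (C' := 1)) (isO_Phi hd 0 (g := fun k => (1 - c i) * k) g0 (stage_src_refined_ord hi)) => [|k r q *]; lra.
- apply: wk; exact: (isO_Phi hd 0 (g := fun k => (1 - c i) * k) g0 (isO_J hd (F_taylor_ord (node_range hi)))).
- apply: wk; apply: (isO_weaken hd (C' := 1)) (isO_lin (1 - c i) (isO_lin (c i) (isO_Phi hd 1 (g := fun k => (1 - c i) * k) g0 F'_ord))) => [|k r q *]; lra.
- apply: wk; apply: (isO_weaken hd (C' := 1)) (isO_lin (1 - c i) (isO_lin (1 - c i) (isO_Phi hd 2 (g := fun k => (1 - c i) * k) g0 AF_ord))) => [|k r q *]; lra.
- by apply: (isO_weaken hd (C' := 1)) (isO_lin (1 - c i) (isO_Phi hd 1 (g := fun k => (1 - c i) * k) g0 (proj2 (isO_defect hd hZF)))) => [|k r q *]; [lra | nra].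
Qed.

(** The weights [b i * c i] and [b i * (1 - c i)] both sum to 1/2, and [Phi_rec2] extracts half of
    [A (A u)]. These three halves are exactly [u2 / 2], which completes the quadratic Taylor
    polynomial of [u]. *)
Lemma J_rho_eq h k t : mesh D h -> time T t -> J h (rho h k t) =
  plus (plus (plus (J h (Ph D h (minus (plus (u t) (plus (k *: sol' P t) ((k ^ 2 / 2) *: u2 t))) (u (t + k)))))
                   ((k ^ 3) *: Phi 3 h k (Ph D h (A (A (u t))))))
             (plus (k *: Phi 1 h k (J h (delta h (u t)))) ((k ^ 2) *: Phi 2 h k (J h (delta h (A (u t)))))))
       (k *: sum_n_m (fun i => b i *: incr_rem i h k t) 1 s).
Proof.
move=> mh ht; rewrite rho_eq // !Ph_minus !Ph_plus !Ph_rscal hu2E // !Ph_plus.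
rewrite !(mxapp_plus, mxapp_minus, mxapp_scal) mxapp_sum -!(Phi_J hd _ _ _ mh).
have -> : sum_n_m (fun i => J h (b i *: incr i h k t)) 1 s =
  plus (plus ((k / 2) *: J h (Ph D h (F' t))) ((k / 2) *: J h (Ph D h (A (F t)))))
       (sum_n_m (fun i => b i *: incr_rem i h k t) 1 s).
  have E1 : k / 2 = sum_n_m (fun i => b i * c i * k) 1 s by rewrite sum_n_m_scal_R hbc; field.
  have E2 : k / 2 = sum_n_m (fun i => (b i - b i * c i) * k) 1 s.
    rewrite sum_n_m_scal_R.
    rewrite sum_n_m_sub_R.
    by rewrite hbc (proj1 tab); field.
  rewrite {1}E1 E2 -!sum_rscal_const -!sum_n_m_plus; apply: sum_vec_ext => i _ _.
  by rewrite mxapp_scal J_incr //; vmod D h.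
have -> : Phi 2 h k (J h (Ph D h (A (A (u t))))) =
  plus (k *: Phi 3 h k (Ph D h (A (A (u t))))) ((/ 2) *: J h (Ph D h (A (A (u t))))).
  by rewrite Phi_rec2 -Phi_M (M_J hd).
by vmod D h; field.
Qed.

(** Defects appearing directly in the step are preceded by [J] and cost eta_h; eps_h survives only
    through the stages, where k eps_h meets the outer factor [k]. *)
Lemma J_rho_ord : ord (fun h k t => J h (rho h k t)) (fun k r q => k ^ 3 + k * q + k ^ 2 * r).
Proof.
have k0 := fun (k : R) => @Rlt_le 0 k.
apply: (isO_ext (e := _)) => [h k t adm|].
  exact: esym (J_rho_eq k (proj1 adm) (admissible_time0 adm)).
apply: isO_plus; first (apply: isO_plus; apply: isO_plus).
- apply: (isO_weaken hd (C' := 1)) (isO_J hd sol_taylor2_ord) => [|k r q [k1 _] [r0 _] q0]; first lra.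
  have := Rmult_le_pos _ _ (pow_le k 2 (Rlt_le _ _ k1)) r0; nra.
- apply: (isO_weaken hd (C' := 1)) (isO_kn 3 (isO_Phi hd 3 (g := fun k => k) k0 AAu_ord)) => [|k r q [k1 _] [r0 _] q0]; first lra.
  have := Rmult_le_pos _ _ (pow_le k 2 (Rlt_le _ _ k1)) r0; nra.
- apply: (isO_weaken hd (C' := 1)) (isO_k (isO_Phi hd 1 (g := fun k => k) k0 (proj2 (isO_defect hd hZ0)))) => [|k r q [k1 _] [r0 _] q0]; first lra.
  have := Rmult_le_pos _ _ (pow_le k 2 (Rlt_le _ _ k1)) r0; have := pow_le k 3 (Rlt_le _ _ k1); lra.
- apply: (isO_weaken hd (C' := 1)) (isO_kn 2 (isO_Phi hd 2 (g := fun k => k) k0 (proj2 (isO_defect hd hZ1)))) => [|k r q [k1 k2] [r0 _] q0]; first lra.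
  have := Rmult_le_pos _ _ (pow_le k 2 (Rlt_le _ _ k1)) r0; have := pow_le k 3 (Rlt_le _ _ k1).
  have : k ^ 2 * q <= k * q by apply: Rmult_le_compat_r => //; nra.
  lra.
- have h : ord (fun h k t => sum_n_m (fun i => b i *: incr_rem i h k t) 1 s) (fun k r q => k ^ 2 + k * r + q).
    apply: isO_sum => // [k r q *|i hi]; first nra.
    by apply: (isO_const hd); apply: incr_rem_ord.
  apply: (isO_weaken hd (C' := 1)) (isO_k h) => [|k r q *]; [lra | apply: Req_le; ring].
Qed.

End Method.

Lemma isO_landau d Om Y (P : ibvp Om Y) (D : @discretization d Om Y)
    (e : forall h, R -> R -> Cvec (nodes D h)) (Bd : R -> R -> R -> R) :
  isO P e Bd ->
  landau P D (fun h k n => e h k (INR n * k)) (fun h k => Bd k (epsh D h) (etah D h)).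
Proof.
move=> [C [k0 [h0 [_ [k00 [h00 H]]]]]]; exists C, k0, h0; split=> //; split=> //.
move=> h k n mh hh [k1 k2] hn; apply: H => //; split=> //; split=> //.
have n0 := pos_INR n; rewrite S_INR in hn.
by split; [apply: Rmult_le_pos; lra | lra].
Qed.

(** * The second order condition *)

Section Smooth.
Variables V W : NormedModule R_AbsRing.

Lemma smooth_upto_const n (w : W) : smooth_upto n (fun _ : V => w).
Proof.
elim: n w => [|n IH] w; split=> //; try (by move=> x; apply: continuous_const).
move=> v; exists (fun=> zero); split=> // x; exact: is_derive_const.
Qed.

Lemma smooth_upto_linear n (l : V -> W) : is_linear l -> smooth_upto n l.
Proof.
move=> lin; have cl x : continuous l x by apply: linear_cont.
case: n => [|n]; split=> // v; exists (fun=> l v); split; last exact: smooth_upto_const.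
move=> x; apply: (is_derive_ext (fun r : R => plus (l x) (scal r (l v)))) => [r|].
  by rewrite (linear_plus _ lin) (linear_scal _ lin).
rewrite -{2}(plus_zero_l (l v)) -{2}(scal_one (l v)).
apply: is_derive_plus; first exact: is_derive_const.
by apply: is_derive_scal_l; apply: is_derive_id.
Qed.

End Smooth.

Lemma sum_n_m_vecE N (v : nat -> Rvec N) m n i : sum_n_m v m n i = sum_n_m (fun j => v j i) m n.
Proof.
elim: n => [|n IH].
  case: m => [|m]; first by rewrite !sum_n_n.
  by rewrite !sum_n_m_zero //; lia.
case: (Compare_dec.le_lt_dec m n.+1) => h; last by rewrite !sum_n_m_zero.
by rewrite !sum_n_Sm // -IH.
Qed.

(* The method applied to y' = t. *)
Lemma order2_condition s a b c : classical_order_ge 2 s a b c ->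
  sum_n_m (fun i => b i * c i) 1 s = / 2.
Proof.
move=> ord.
(* This right-hand side is linear in the pair of time and state, hence smooth, and it does not see
   the stages. *)
pose F (t : R) (_ : Rvec 1) : Rvec 1 := fun=> t.
pose y (t : R) : Rvec 1 := fun=> t ^ 2 / 2.
have [|| C [k0 [k00 H]]] := ord 1%N F y 0.
- move=> n; apply: smooth_upto_linear; split=> //.
  exists 1; split=> [|[t x]]; first lra.
  rewrite Rmult_1_l; apply: maxnorm_lub => [|i]; first exact: norm_ge_0.
  exact: (proj1 (norm_pairR _ _)).
- apply: filter_forall => t.
  apply: (is_derive_ext (fun r => scal (r ^ 2 / 2) ((fun=> 1) : Rvec 1))) => [r|].
    by apply: functional_extensionality => i; rewrite /scal /= /vec_scal /mult /= Rmult_1_r.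
  have -> : F t (y t) = scal t ((fun=> 1) : Rvec 1).
    by apply: functional_extensionality => i; rewrite /scal /= /vec_scal /mult /= Rmult_1_r.
  by apply: is_derive_scal_l; auto_derive => //; field.
pose S := sum_n_m (fun i => b i * c i) 1 s.
(* The error is an exact multiple of [k ^ 2], so a cubic bound forces the factor to vanish. *)
have E k : minus (classical_step s a b c F 0 (y 0) k) (y (0 + k)) ord0 = k ^ 2 * (S - / 2).
  rewrite /classical_step /minus /plus /opp /= /vec_plus /vec_opp /plus /opp /= /scal /= /vec_scal.
  rewrite sum_n_m_vecE /y /mult /=.
  have -> : sum_n_m (fun j => scal (b j) (F (0 + c j * k) (classical_stage a c F 0 (y 0) k j)) ord0) 1 s = S * k.
    rewrite /S -sum_n_m_scal_R; apply: sum_n_m_ext => j.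
    by rewrite /F /scal /= /vec_scal /mult /=; ring.
  by field.
apply: (Rminus_diag_uniq S); apply: NNPP => ne.
have p : 0 < Rabs (S - / 2) by apply: Rabs_pos_lt.
(* Small enough that [C * k] stays below half of [Rabs (S - / 2)], against the assumed cubic
   bound. *)
pose k := Rmin k0 (Rabs (S - / 2) / (2 * (Rabs C + 1))).
have C0 := Rabs_pos C.
have q : 0 < Rabs (S - / 2) / (2 * (Rabs C + 1)) by apply: Rdiv_lt_0_compat; lra.
have k1 : 0 < k by apply: Rmin_pos.
have := H k (conj k1 (Rmin_l _ _)).
have := maxnorm_ub (minus (classical_step s a b c F 0 (y 0) k) (y (0 + k))) ord0.
rewrite E => h1 h2; have {h1 h2} h := Rle_trans _ _ _ h1 h2.
have {}h : k ^ 2 * Rabs (S - / 2) <= C * k ^ 3.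
  apply: Rle_trans h; rewrite /abs /= Rabs_mult (Rabs_pos_eq (k * (k * 1))); last nra.
  exact: Rle_refl.
have k2 : k * (2 * (Rabs C + 1)) <= Rabs (S - / 2).
  have -> : Rabs (S - / 2) = Rabs (S - / 2) / (2 * (Rabs C + 1)) * (2 * (Rabs C + 1)) by field; lra.
  by apply: Rmult_le_compat_r; [lra | apply: Rmin_r].
have h3 : Rabs (S - / 2) <= C * k.
  by apply: (Rmult_le_reg_l (k ^ 2)); [nra | apply: Rle_trans h _; apply: Req_le; ring].
have := Rle_abs C; nra.
Qed.

Lemma bounded_of_deriv (W : NormedModule R_AbsRing) T (v v' : R -> W) B : 0 < T ->
  (forall t, time T t -> has_deriv 0 T v t (v' t)) ->
  (forall t, time T t -> norm (v' t) <= B) ->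
  forall t, time T t -> norm (v t) <= norm (v 0) + B * T.
Proof.
move=> T0 hv hB t ht; have t0 : time T 0 by split; lra.
have := bounded_deriv_lip hv hB t0 ht; rewrite Rminus_0_r Rabs_pos_eq; last by case: ht.
have B0 : 0 <= B by apply: Rle_trans (norm_ge_0 _) (hB 0 t0).
have : B * t <= B * T by apply: Rmult_le_compat_l => //; case: ht.
by have := norm_le_minus (v t) (v 0); lra.
Qed.

Section Bounds.
Variables (d : nat) (Om : Rvec d -> Prop) (Y : CompleteNormedModule C_AbsRing) (P : ibvp Om Y).
Notation X := (cfun Om).
Notation XR := (realify (cfun_NormedModule Om)).
Notation T := (horizon P).
Notation A := (opA P).
Notation u := (sol P).
Notation F := (fun t => src P t (sol P t)).

(** [u'] is bounded by integrating the bound on [u2] from time 0, and the source term then as the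
    difference of [u'] and [A u]. *)
Lemma curve_bounds (u2 : R -> X) B2 : continuous_hyps P -> continuous_D P 2 u ->
  continuous_on (time T) (fun t => A (F t)) ->
  (forall t, time T t -> has_deriv (W := XR) 0 T (sol' P) t (u2 t)) ->
  (forall t, time T t -> norm (u2 t) <= B2) ->
  exists B, forall t, time T t ->
    [/\ norm (sol' P t) <= B, norm (u2 t) <= B & norm (F t) <= B] /\
    [/\ norm (A (u t)) <= B, norm (A (A (u t))) <= B & norm (A (F t)) <= B].
Proof.
move=> hc [_ huD] hAF hu2 h4; have T0 := ch_horizon hc.
have [B [B0 h1]] := continuous_on_bounded T0 (huD 1%N erefl).
have [B' [B'0 h2]] := continuous_on_bounded T0 (huD 2%N erefl).
have [B3 [B30 h3]] := continuous_on_bounded T0 hAF.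
have h5 := bounded_of_deriv T0 hu2 h4.
have n0 := norm_ge_0 (sol' P 0).
have B20 : 0 <= B2 by apply: Rle_trans (norm_ge_0 _) (h4 0 _); split; lra.
have p := Rmult_le_pos _ _ B20 (Rlt_le _ _ T0).
exists (norm (sol' P 0) + B2 * T + B + B' + B3 + B2) => t ht.
have k1 := h1 t ht; have k2 := h2 t ht; have k3 := h3 t ht; have k4 := h4 t ht.
have k5 : norm (sol' P t) <= norm (sol' P 0) + B2 * T := h5 t ht.
have k6 : norm (F t) <= norm (sol' P t) + norm (A (u t)).
  have -> : F t = minus (sol' P t) (A (u t)) by rewrite /sol'; modular_in (realify (cfun_NormedModule Om)).
  exact: norm_minus_le.
rewrite /= in k1 k2.
by split; split; lra.
Qed.

End Bounds.

Theorem theorem11 :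
  forall (d : nat) (Om : Rvec d -> Prop) (Y : CompleteNormedModule C_AbsRing)
    (P : ibvp Om Y) (D : discretization Om Y)
    (s : nat) (a : nat -> nat -> R) (b c : nat -> R),
  bounded_domain Om ->
  continuous_hyps P ->
  discretization_hyps P D ->
  erk_tableau s a b c ->
  let T := horizon P in
  let A := opA P in
  let u := sol P in
  let f := src P in
  let fu := fun t => f t (u t) in
  let XR := realify (cfun_NormedModule Om) in
  (forall t, time T t -> domA P (fu t)) ->
  continuous_on (time T) (fun t => A (fu t)) ->
  continuous_D P 2 u ->
  Ck_on XR T 2 u ->
  (forall l, (l <= 2)%N -> Z_valued P D (fun t => iter l A (u t))) ->
  Z_valued P D fu ->
  Z_valued P D (fun t => A (fu t)) ->
  landau P D (local_error P D s a b c) (fun h k => k ^ 2 + k * epsh D h) /\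
  (C2_on (prod_NormedModule R_AbsRing R_NormedModule XR) XR
     (slab P (W := cfun Om)) (fun p => f (fst p) (snd p)) (dsrc P) ->
   Ck_on XR T 3 u ->
   (exists C, forall t w x, time T t -> domA0 P w -> domA0 P x ->
      A x = src_u P t (u t) (A w) -> norm x <= C * norm w) ->
   classical_order_ge 2 s a b c ->
   (exists C h0, 0 < h0 /\ forall h t v, mesh D h -> h <= h0 -> time T t ->
      norm (mxapp (Ahinv D h) (srch_u D h t (Ph D h (u t)) (mxapp (Ah D h) v)))
        <= C * norm v) ->
   landau P D (fun h k n => mxapp (Ahinv D h) (local_error P D s a b c h k n))
     (fun h k => k ^ 3 + k * etah D h + k ^ 2 * epsh D h)).
Proof.
move=> d Om Y P D s a b c _ hc hd tab T A u f fu XR hFdom hAF huD [v [hv [v' [hv' cv']]]] hZ hZF _.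
have hZ0 : Z_valued P D u := hZ 0%N erefl.
have hZ1 : Z_valued P D (fun t => A (u t)) := hZ 1%N erefl.
have err_rho h k n : local_error P D s a b c h k n = @rho d Om Y P D s a b c h k (INR n * k).
  by rewrite /local_error /rho S_INR Rmult_plus_distr_r Rmult_1_l.
split.
  have hu2 := sol'_deriv hc hv hv'.
  have [B' [_ hB']] := continuous_on_bounded (ch_horizon hc) cv'.
  have [B hB] := curve_bounds hc huD hAF hu2 hB'.
  have [C [k0 [h0 [k00 [h00 H]]]]] := isO_landau (rho_ord hc hd tab hu2 hB hZ0 hZ1 hZF).
  by exists C, k0, h0; split=> //; split=> // h k n *; rewrite err_rho; apply: H.
(* The C^3 hypothesis brings its own derivative witnesses, so the second derivative is identified
   anew with that of the right-hand side. *)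
move=> hf2 [w [hw [w' [hw' [w'' [hw'' cw'']]]]]] _ ord hstab.
have hu2 := sol'_deriv hc hw hw'.
have hu3 t (ht : time T t) := deriv_on_has_deriv hw'' ht.
have T0 := ch_horizon hc.
have [B3 [B30 hB3]] := continuous_on_bounded T0 cw''.
have [B0 hB0] := curve_bounds hc huD hAF hu2 (bounded_of_deriv T0 hu3 hB3).
(* The error estimates take a single constant, which must bound the third derivative as well. *)
have hB t : time T t -> [/\ norm (sol' P t) <= Rmax B0 B3, norm (w' t) <= Rmax B0 B3 & norm (fu t) <= Rmax B0 B3] /\
    [/\ norm (A (u t)) <= Rmax B0 B3, norm (A (A (u t))) <= Rmax B0 B3 & norm (A (fu t)) <= Rmax B0 B3].
  move=> /hB0 [[? ? ?] [? ? ?]]; have m := Rmax_l B0 B3.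
  by split; split; apply: Rle_trans m.
have hB3' t : time T t -> norm (w'' t) <= Rmax B0 B3.
  by move=> ht; apply: Rle_trans (hB3 t ht) (Rmax_r _ _).
have hu2E := second_derivative hc hFdom huD hu2.
have [C [k0 [h0 [k00 [h00 H]]]]] := isO_landau
  (J_rho_ord hc hd tab hu2 hB hZ0 hZ1 hZF hu3 hB3' hu2E hf2 (order2_condition ord) hstab).
by exists C, k0, h0; split=> //; split=> // h k n *; rewrite err_rho; apply: H.
Qed.
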